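(* Let $c_0=1/86000$. There exists $\Delta_0$ such that for every $\Delta\ge\Delta_0$ the following holds. Let $H$ be a triangle-free hypergraph all of whose edges have size $2$ or $3$ such that every vertex lies in at most $\Delta$ edges of size $3$, every vertex lies in at most $(c_0\Delta\log\Delta)^{1/2}$ edges of size $2$, and every pair of distinct vertices is contained in at most $\Delta^{6/10}$ edges of size $3$. Then \[ \chi_l(H)\le\left(\frac{\Delta}{c_0\log\Delta}\right)^{1/2}. \]
   Context: A hypergraph $H=(V,E)$ consists of a finite vertex set $V$ and a set $E$ of subsets of $V$ (edges). A triangle in a hypergraph is a collection of three distinct vertices $u,v,w$ and three distinct edges $e,f,g$ with $u,v\in e$, $v,w\in f$, $w,u\in g$, and $\{u,v,w\}\cap e\cap f\cap g=\emptyset$. A hypergraph is triangle-free if it contains no triangle. A proper coloring is an assignment of colors to vertices such that no edge is monochromatic. Given lists $L(v)$ of colors for each vertex, a proper list coloring is a proper coloring in which each $v$ receives a color from $L(v)$. The list chromatic number $\chi_l(H)$ is the least $l$ such that $H$ has a proper list coloring whenever $|L(v)|\ge l$ for all $v$. $\log$ denotes the natural logarithm. *)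

(* Defs.v *)
From mathcomp Require Import all_boot.
From Stdlib Require Import Reals.

Set Implicit Arguments.
Unset Strict Implicit.
Unset Printing Implicit Defensive.

Definition is_triangle (V : finType) (E : {set {set V}}) (u v w : V) (e f g : {set V}) : bool :=
  [&& [&& u != v, v != w & w != u],
      [&& e \in E, f \in E & g \in E],
      [&& e != f, f != g & g != e],
      [&& u \in e, v \in e, v \in f, w \in f, w \in g & u \in g] &
      [set u; v; w] :&: e :&: f :&: g == set0].

Definition triangle_free (V : finType) (E : {set {set V}}) : Prop :=
  forall (u v w : V) (e f g : {set V}), ~~ is_triangle E u v w e f g.

Definition deg_k (V : finType) (E : {set {set V}}) (k : nat) (x : V) : nat :=
  #|[set e in E | (x \in e) && (#|e| == k)]|.

Definition codeg_k (V : finType) (E : {set {set V}}) (k : nat) (x y : V) : nat :=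
  #|[set e in E | [&& x \in e, y \in e & #|e| == k]]|.

Definition proper_coloring (V : finType) (E : {set {set V}}) (c : V -> nat) : Prop :=
  forall e, e \in E -> exists x y, [/\ x \in e, y \in e & c x <> c y].

Definition proper_list_coloring (V : finType) (E : {set {set V}})
    (L : V -> seq nat) (c : V -> nat) : Prop :=
  proper_coloring E c /\ forall x, c x \in L x.

Definition choosable (V : finType) (E : {set {set V}}) (l : nat) : Prop :=
  forall L : V -> seq nat, (forall x, l <= size (undup (L x))) ->
    exists c, proper_list_coloring E L c.

(* chi_l(H) <= X  (X real): the least such l is at most X, i.e. some l <= X works
   (choosability is monotone in l). *)
Definition list_chromatic_le (V : finType) (E : {set {set V}}) (X : R) : Prop :=
  exists l : nat, (INR l <= X)%R /\ choosable E l.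

(* Main.v *)
Require Import Defs.
From mathcomp Require Import all_boot.
From Stdlib Require Import Reals.
From mathcomp Require all_order all_algebra Rstruct reals ring lra.
Set Implicit Arguments.
Unset Strict Implicit.
Unset Printing Implicit Defensive.

(** The coloring is built by a semi-random process in the style of Johansson.
    A state consists of a partial proper coloring together with weights
    [p v c >= 0] on the colors still available at each blank vertex [v],
    initially [1/n] on a list of size [n].  In one step every pair [(v, c)] is
    selected independently with probability [alpha * p v c].  A color [c]
    survives at [v] unless the selections would complete a monochromatic edge
    at [v]; it then gets weight [p v c / P(c survives at v)], so that weights
    are martingales, and it is discarded if this exceeds a cap [ph].  A
    vertex takes a selected color that survives.

    Since the hypergraph is triangle-free, the survival events of a color at
    the vertices of one edge are nearly independent, so the expected weight of
    an edge hardly grows, while vertices leave the blank set at rate about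
    [alpha].  Hence the potential [Theta], the expected number of conflicts at
    [v] if all blank vertices were colored according to [p] (with edges of
    size three weighted by 4), decays like [(1 - alpha/8)^k].  The total weight
    of the discarded colors is controlled by the entropy-like sum
    [\sum_c p ln(ph/p)]: its expected decrease in a step is proportional to
    [alpha * Theta], so the total loss is at most a constant multiple of
    [c0 ln Delta / ln(ph * n)], which is less than a small constant.

    The choices for different colors are independent, which yields
    concentration at every vertex, and the local lemma makes one step succeed
    at all vertices simultaneously.  Once [Theta] is a small constant, coloring
    each blank vertex according to its weights succeeds by the local lemma. *)

(** The constant comes from one inequality. With [alpha = 1/ln Delta], the initial potential is at
    most [theta0 = 10 c0 ln Delta]: if [X] is the target and [n] its integer part, pairs contribute
    [X/n] and triples [8 (X/n)^2], each times [c0 ln Delta], where 8 is the weight 4 times the two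
    orders of a triple. A step costs [2 alpha theta / Lam] of entropy while [theta] shrinks by the
    factor [1 - alpha/8], so the costs telescope to at most [16 theta0 / Lam]. The cap
    [ph = Delta^(1/100) / n] makes [Lam = ln Delta / 100], and keeping this loss below [1/5] asks
    for [160 c0 <= 1/500], that is, [c0 <= 1/80000]. All other losses sum to at most [1/10], so the
    entropy of every blank vertex stays above [13/20]. Since weights are never below [1/n], the
    entropy is a lower bound for the total weight, which is all that the coloring rate and the final
    random choice require. *)

Lemma inv_86000 : (INR 86 * INR 1000 * (1 / 86000))%R = 1%R.
Proof. rewrite !INR_IZR_INZ; change (Z.of_nat 86) with 86%Z; change (Z.of_nat 1000) with 1000%Z; field. Qed.

Lemma six_tenths : (6 / 10)%R = (INR 60 / INR 100)%R.
Proof. rewrite !INR_IZR_INZ; change (Z.of_nat 60) with 60%Z; change (Z.of_nat 100) with 100%Z; field. Qed.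

Lemma sqrt_div_sqr (a x : R) : (0 < a)%R -> (0 < x)%R ->
  (sqrt (x / a) * sqrt (x / a) * a)%R = x.
Proof.
move=> a0 x0; rewrite sqrt_sqrt; first by field; apply: Rgt_not_eq.
exact/Rlt_le/Rdiv_lt_0_compat.
Qed.

(** Together with [sqrt_div_sqr] this eliminates square roots: if [X] is the target number of
    colors, the degree bound for edges of size 2 becomes [X * (c0 * l)]. *)
Lemma sqrt_div_mul (a x l : R) : (0 < a)%R -> (0 < x)%R -> (0 < l)%R ->
  sqrt (a * x * l) = (sqrt (x / (a * l)) * (a * l))%R.
Proof.
move=> a0 x0 l0; have al0 : (0 < a * l)%R by apply: Rmult_lt_0_compat.
apply: sqrt_lem_1.
- by apply/Rlt_le/Rmult_lt_0_compat => //; apply: Rmult_lt_0_compat.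
- by apply: Rmult_le_pos; [apply: sqrt_pos|apply: Rlt_le].
transitivity (sqrt (x / (a * l)) * sqrt (x / (a * l)) * (a * l) * (a * l))%R; first by ring.
by rewrite sqrt_div_sqr //; ring.
Qed.

Module Nibble.
Import all_boot all_order all_algebra Rstruct reals ring lra.
Import Order.TTheory GRing.Theory Num.Theory.
Local Open Scope ring_scope.
Bind Scope ring_scope with R.
Local Arguments exp _%_ring_scope.
Local Arguments ln _%_ring_scope.

(** * Finite product spaces and the local lemma *)

Section ProductSpace.
Variables (I X : finType) (mu : I -> X -> R).
Hypothesis mu_ge0 : forall i x, 0 <= mu i x.
Hypothesis mu_sum1 : forall i, \sum_x mu i x = 1.
Implicit Types (S T : {set I}) (f g : {ffun I -> X} -> R) (w : {ffun I -> X}).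

Definition prob w : R := \prod_i mu i (w i).
Definition expect f : R := \sum_w prob w * f w.
Definition mix S w' w : {ffun I -> X} := [ffun i => if i \in S then w' i else w i].
(** Conditional expectation given the coordinates outside [S], kept as a function on the whole
    product space so that conditioning can be iterated. *)
Definition cexpect S f w : R := expect (fun w' => f (mix S w' w)).
Definition determined_by (Y : Type) S (f : {ffun I -> X} -> Y) :=
  forall w w', (forall i, i \in S -> w i = w' i) -> f w = f w'.

Lemma prob_ge0 w : 0 <= prob w.
Proof. exact: prodr_ge0. Qed.

Lemma eq_expect f g : f =1 g -> expect f = expect g.
Proof. by move=> e; apply: eq_bigr => w _; rewrite e. Qed.

Lemma expect_prod (F : I -> X -> R) :
  expect (fun w => \prod_i F i (w i)) = \prod_i \sum_x mu i x * F i x.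
Proof.
rewrite (bigA_distr_bigA (fun i x => mu i x * F i x)) /=.
by apply: eq_bigr => w _; rewrite big_split.
Qed.

Lemma expect_const a : expect (fun=> a) = a.
Proof.
rewrite /expect -mulr_suml; suff -> : \sum_w prob w = 1 by rewrite mul1r.
transitivity (expect (fun w => \prod_(i : I) 1)).
  by apply: eq_bigr => w _; rewrite big1 ?mulr1.
rewrite (expect_prod (fun _ _ => 1)) big1 // => i _.
by under eq_bigr do rewrite mulr1; rewrite mu_sum1.
Qed.

Lemma expect_at i (h : X -> R) : expect (fun w => h (w i)) = \sum_x mu i x * h x.
Proof.
transitivity (expect (fun w => \prod_j (if j == i then h (w j) else 1))).
  by apply: eq_expect => w; rewrite -big_mkcond big_pred1_eq.
rewrite (expect_prod (fun j x => if j == i then h x else 1)).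
rewrite (bigD1 i) //= eqxx [X in _ * X]big1 ?mulr1 // => j /negPf ->.
by under eq_bigr do rewrite mulr1; rewrite mu_sum1.
Qed.

Lemma expectD f g : expect (fun w => f w + g w) = expect f + expect g.
Proof. by rewrite -big_split; apply: eq_bigr => w _; rewrite mulrDr. Qed.

Lemma expectZ a f : expect (fun w => a * f w) = a * expect f.
Proof. by rewrite /expect mulr_sumr; apply: eq_bigr => w _; rewrite mulrCA. Qed.

Lemma expectZr a f : expect (fun w => f w * a) = expect f * a.
Proof. by rewrite /expect mulr_suml; apply: eq_bigr => w _; rewrite mulrA. Qed.

Lemma expectN f : expect (fun w => - f w) = - expect f.
Proof. by rewrite /expect -sumrN; apply: eq_bigr => w _; rewrite mulrN. Qed.

Lemma expectB f g : expect (fun w => f w - g w) = expect f - expect g.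
Proof. by rewrite expectD expectN. Qed.

Lemma expect_sum (J : Type) (r : seq J) (P : pred J) (F : J -> {ffun I -> X} -> R) :
  expect (fun w => \sum_(j <- r | P j) F j w) = \sum_(j <- r | P j) expect (F j).
Proof.
rewrite /expect exchange_big; apply: eq_bigr => w _ /=.
by rewrite mulr_sumr.
Qed.

Lemma ler_expect f g : (forall w, f w <= g w) -> expect f <= expect g.
Proof. by move=> h; apply: ler_sum => w _; apply: ler_wpM2l; rewrite ?prob_ge0. Qed.

Lemma expect_ge0 f : (forall w, 0 <= f w) -> 0 <= expect f.
Proof. by move=> h; apply: sumr_ge0 => w _; rewrite mulr_ge0 ?prob_ge0. Qed.

Lemma ler_norm_expect f : `|expect f| <= expect (fun w => `|f w|).
Proof.
apply: le_trans (ler_norm_sum _ _ _) _.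
by apply: ler_sum => w _; rewrite normrM (ger0_norm (prob_ge0 w)).
Qed.

Lemma mixE S w' w i : mix S w' w i = if i \in S then w' i else w i.
Proof. by rewrite ffunE. Qed.

(** Resampling the coordinates in [S] from an independent copy does not change the law: exchanging
    these coordinates between two samples is an involution that preserves the joint weight. *)
Lemma expect_mix S f : expect f = expect (fun w => expect (fun w' => f (mix S w' w))).
Proof.
pose h (u : {ffun I -> X} * {ffun I -> X}) := (mix S u.2 u.1, mix S u.1 u.2).
have hK : involutive h.
  by move=> [a b]; rewrite /h /=; congr (_, _); apply/ffunP => i;
    rewrite !mixE; case: (i \in S).
have prob_h u : prob (h u).1 * prob (h u).2 = prob u.1 * prob u.2.
  rewrite /prob -!big_split; apply: eq_bigr => i _ /=.
  by rewrite !mixE; case: ifP => // _; rewrite mulrC.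
transitivity (\sum_u prob u.1 * prob u.2 * f (h u).1).
  rewrite [RHS](reindex_inj (inv_inj hK)).
  transitivity (\sum_u prob u.1 * prob u.2 * f u.1).
    rewrite -(pair_big predT predT (fun a b => prob a * prob b * f a)) /=.
    apply: eq_bigr => a _; rewrite -mulr_suml -mulr_sumr; congr (_ * _).
    have := expect_const 1; rewrite /expect; under eq_bigr do rewrite mulr1.
    by move=> ->; rewrite mulr1.
  by apply: eq_bigr => u _; rewrite hK prob_h.
rewrite -(pair_big predT predT (fun a b => prob a * prob b * f (mix S b a))) /=.
by apply: eq_bigr => a _; rewrite /expect mulr_sumr; apply: eq_bigr => b _; rewrite mulrA.
Qed.

(** Tower property; [S] and [T] may overlap because the inner resampling overrides the outer one on
    [S]. *)
Lemma cexpectU S T f w : cexpect (S :|: T) f w = cexpect T (cexpect S f) w.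
Proof.
rewrite /cexpect (expect_mix S).
apply: eq_expect => w1; apply: eq_expect => w2; congr f.
by apply/ffunP => i; rewrite !mixE inE; case: (i \in S); case: (i \in T).
Qed.

Lemma cexpect0 f w : cexpect set0 f w = f w.
Proof.
rewrite /cexpect (eq_expect (g := fun=> f w)) ?expect_const // => w'.
by congr f; apply/ffunP => i; rewrite mixE inE.
Qed.

Lemma cexpectT f w : cexpect setT f w = expect f.
Proof.
by apply: eq_expect => w'; congr f; apply/ffunP => i; rewrite mixE inE.
Qed.

Lemma determined_byS (Y : Type) S T (f : {ffun I -> X} -> Y) :
  S \subset T -> determined_by S f -> determined_by T f.
Proof. by move=> /subsetP sST hf w w' e; apply: hf => i /sST; apply: e. Qed.

(** After resampling [S], [f] reads only the new sample and [g] only the old one, so the double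
    expectation splits. *)
Lemma expectM_indep S T f g : determined_by S f -> determined_by T g -> [disjoint S & T] ->
  expect (fun w => f w * g w) = expect f * expect g.
Proof.
move=> fS gT dST; rewrite (expect_mix S) -expectZ.
apply: eq_expect => w; rewrite -expectZr.
apply: eq_expect => w'; congr (_ * _).
  by apply: fS => i iS; rewrite mixE iS.
apply: gT => i iT; rewrite mixE ifN //.
by apply/negP => iS; rewrite (disjointFr dST) in iT.
Qed.

Lemma expect_prod_indep (J : eqType) (s : seq J) (S : J -> {set I}) (F : J -> {ffun I -> X} -> R) :
  uniq s -> (forall j, determined_by (S j) (F j)) ->
  (forall j k, j != k -> [disjoint S j & S k]) ->
  expect (fun w => \prod_(j <- s) F j w) = \prod_(j <- s) expect (F j).
Proof.
move=> us FS dS; elim: s us => [|j s IH] /=.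
  by rewrite big_nil (eq_expect (g := fun=> 1)) ?expect_const // => w; rewrite big_nil.
case/andP=> js us; rewrite big_cons -IH //.
rewrite -(@expectM_indep (S j) (~: S j)) //.
- by apply: eq_expect => w; rewrite big_cons.
- move=> w w' e; apply: eq_big_seq => k ks; apply: FS => i ik; apply: e.
  rewrite inE; apply/negP => ij.
  have jk : j != k by apply: contraNneq js => ->.
  by rewrite (disjointFr (dS _ _ jk)) in ik.
- by rewrite -setI_eq0 setICr.
Qed.

Definition pr (A : pred {ffun I -> X}) : R := expect (fun w => (A w)%:R).

Lemma pr_ge0 A : 0 <= pr A.
Proof. by apply: expect_ge0 => w; case: (A w). Qed.

Lemma pr_le1 A : pr A <= 1.
Proof. by rewrite -[leRHS](expect_const 1); apply: ler_expect => w; case: (A w). Qed.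

(** The witness also has positive weight; this later excludes outcomes in which a color of weight
    zero is selected. *)
Lemma pr_pos A : 0 < pr A -> exists2 w, 0 < prob w & A w.
Proof.
move=> pA; case: (pickP (fun w => (0 < prob w) && A w)) => [w /andP[]|h].
  by exists w.
suff pA0 : pr A = 0 by rewrite pA0 ltxx in pA.
apply: big1 => w _; have := h w; rewrite lt0r prob_ge0 andbT.
by case: eqP => [->|_ /= ->]; rewrite ?mul0r ?mulr0.
Qed.

Lemma markov f a : 0 < a -> (forall w, 0 <= f w) -> pr (fun w => a < f w) <= expect f / a.
Proof.
move=> a0 f0; rewrite -expectZr; apply: ler_expect => w.
case: ltP => h /=; first by rewrite ler_pdivlMr ?mul1r // ltW.
by rewrite divr_ge0 // ltW.
Qed.

Section LocalLemma.
Variables (J : finType) (A : J -> pred {ffun I -> X}) (S : J -> {set I}).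
Hypothesis A_det : forall j, determined_by (S j) (A j).
Hypothesis A_small : forall j,
  \sum_(k | (k == j) || ~~ [disjoint S k & S j]) pr (A k) <= 1 / 4%:R.

Let avoids (T : {set J}) : pred {ffun I -> X} := fun w => [forall k in T, ~~ A k w].

Let avoids_det (T : {set J}) (j : J) : (forall k, k \in T -> [disjoint S k & S j]) ->
  determined_by (~: S j) (fun w => (avoids T w)%:R : R).
Proof.
move=> h w w' e; congr (nat_of_bool _)%:R.
rewrite /avoids; apply: eq_forallb => k; case kT: (k \in T) => //=; congr negb; apply: A_det => i ik.
by apply: e; rewrite inE (disjointFr (h _ kT) ik).
Qed.

Let pr_event_le j : pr (A j) <= 1 / 4%:R.
Proof.
apply: le_trans (A_small j); rewrite (bigD1 j) ?eqxx //=.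
by rewrite lerDl; apply: sumr_ge0 => k _; apply: pr_ge0.
Qed.

Let pr_avoids_le (T T' : {set J}) (h : T' \subset T) w :
  (avoids T w)%:R <= (avoids T' w)%:R :> R.
Proof.
rewrite ler_nat; case E : (avoids T w) => //.
suff -> : avoids T' w by [].
by apply/forall_inP => k kT; apply: (forall_inP E); apply: (subsetP h).
Qed.

(** The usual invariant of the local lemma, [P(A j | avoid T) <= 2 P(A j)], multiplied out so that
    no conditional probability is formed; positivity of [pr (avoids T)] is carried along in the same
    induction. *)
Let main_step (n : nat) : forall T : {set J}, (#|T| <= n)%N ->
  0 < pr (avoids T) /\
  forall j, pr (fun w => A j w && avoids T w) <= 2%:R * pr (A j) * pr (avoids T).
Proof.
elim: n => [|n IH] T.
  rewrite leqn0 cards_eq0 => /eqP ->.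
  have all0 w : avoids set0 w by apply/forall_inP => k; rewrite inE.
  have -> : pr (avoids set0) = 1.
    by rewrite -[RHS](expect_const 1); apply: eq_expect => w; rewrite all0.
  split; first exact: ltr01.
  move=> j; rewrite mulr1.
  have -> : pr (fun w => A j w && avoids set0 w) = pr (A j).
    by apply: eq_expect => w; rewrite all0 andbT.
  by have := pr_ge0 (A j); lra.
move=> leT.
have posT : 0 < pr (avoids T).
  have [->|/set0Pn [k kT]] := eqVneq T set0.
    by case: (IH set0); rewrite ?cards0.
  have ltk : (#|T :\ k| <= n)%N.
    by rewrite -ltnS; apply: leq_trans leT; rewrite (cardsD1 k T) kT.
  have [pos /(_ k)] := IH _ ltk.
  have -> : pr (fun w => A k w && avoids (T :\ k) w) = pr (avoids (T :\ k)) - pr (avoids T).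
    rewrite -expectB; apply: eq_expect => w.
    have -> : avoids T w = ~~ A k w && avoids (T :\ k) w.
      apply/idP/andP => [h|[h1 h2]].
        split; first exact: (forall_inP h).
        by apply/forall_inP => l; rewrite !inE => /andP[_ /(forall_inP h)].
      apply/forall_inP => l lT; have [->//|lk] := eqVneq l k.
      by apply: (forall_inP h2); rewrite !inE lk.
    by case: (A k w); case: (avoids _ w); rewrite /= ?subr0 ?subrr.
  have := pr_event_le k; have := pr_ge0 (A k); move: pos.
  move: (pr (A k)) (pr (avoids (T :\ k))) (pr (avoids T)) => a b c *; nra.
split=> // j.
pose T1 := [set k in T | ~~ [disjoint S k & S j]].
pose T2 := [set k in T | [disjoint S k & S j]].
have T2T : T2 \subset T by apply/subsetP => k; rewrite inE => /andP[].
have indep : pr (fun w => A j w && avoids T2 w) = pr (A j) * pr (avoids T2).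
  rewrite -(@expectM_indep (S j) (~: S j)).
  - by apply: eq_expect => w; rewrite -natrM mulnb.
  - by move=> w w' e; rewrite (A_det e).
  - by apply: avoids_det => l; rewrite inE => /andP[].
  - by rewrite -setI_eq0 setICr.
have le2 : pr (fun w => A j w && avoids T w) <= pr (A j) * pr (avoids T2).
  rewrite -indep; apply: ler_expect => w; have := pr_avoids_le T2T w.
  by case: (A j w) => //=; case: (avoids _ w).
(* It remains to restore the events of [T1]: given that [T2] is avoided, their total probability is
   at most [2 * 1/4], so avoiding them too costs at most a factor 2. *)
suff half : pr (avoids T2) <= 2%:R * pr (avoids T).
  apply: le_trans le2 _; have := pr_ge0 (A j).
  move: half; move: (pr (A j)) (pr (avoids T2)) (pr (avoids T)) => a b c *; nra.
have [T1_0|/set0Pn [l lT1]] := eqVneq T1 set0.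
  have -> : T = T2.
    apply/setP => k; rewrite !inE; case kT : (k \in T) => //=.
    by apply/esym; apply: contraT => hk; move/setP/(_ k): T1_0; rewrite !inE kT hk.
  by have := pr_ge0 (avoids T2); lra.
have ltT2 : (#|T2| <= n)%N.
  rewrite -ltnS; apply: leq_trans leT; apply: proper_card.
  rewrite properE T2T /=; apply/subsetPn; exists l.
    by move: lT1; rewrite inE => /andP[].
  by move: lT1; rewrite !inE => /andP[-> /negPf ->].
have [pos2 IH2] := IH _ ltT2.
have union : pr (avoids T2) <= pr (avoids T) + \sum_(k in T1) pr (fun w => A k w && avoids T2 w).
  rewrite -expect_sum -expectD; apply: ler_expect => w.
  case E2 : (avoids T2 w); last by rewrite addr_ge0 ?ler0n ?sumr_ge0 // => k _; rewrite andbF.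
  case E : (avoids T w); first by rewrite lerDl sumr_ge0 // => k _; rewrite ler0n.
  move/negbT: E; rewrite negb_forall => /existsP [k].
  rewrite negb_imply negbK => /andP [kT Ak].
  have kT1 : k \in T1.
    rewrite inE kT /=; apply/negP => dis.
    by move/forall_inP/(_ k): E2; rewrite inE kT dis Ak => /(_ isT).
  by rewrite add0r (bigD1 k) //= Ak lerDl sumr_ge0 // => i _; rewrite ler0n.
have : pr (avoids T2) <= pr (avoids T) + (\sum_(k in T1) pr (A k)) * (2%:R * pr (avoids T2)).
  apply: le_trans union _; rewrite lerD2l mulr_suml; apply: ler_sum => k _.
  by apply: le_trans (IH2 k) _; rewrite -mulrA mulrCA mulrA.
have : \sum_(k in T1) pr (A k) <= 1 / 4%:R.
  apply: le_trans (A_small j).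
  rewrite [leLHS]big_mkcond [leRHS]big_mkcond; apply: ler_sum => k _; rewrite inE.
  case: [disjoint _ & _]; rewrite ?andbF ?orbF ?andbT ?orbT //=.
    by case: ifP => // _; apply: pr_ge0.
  by case: ifP => // _; apply: pr_ge0.
move: pos2; move: (\sum_(k in T1) _) (pr (avoids T2)) (pr (avoids T)) => a b c *; nra.
Qed.

Theorem local_lemma : exists2 w, 0 < prob w & forall j, ~~ A j w.
Proof.
have [/pr_pos [w pw hw] _] := main_step (leqnn #|[set: J]|).
by exists w => // j; apply: (forall_inP hw).
Qed.

End LocalLemma.
End ProductSpace.

(** * Correlation and concentration *)

Section Harris.
Variables (I : finType) (mu : I -> bool -> R).
Hypothesis mu_ge0 : forall i x, 0 <= mu i x.
Hypothesis mu_sum1 : forall i, \sum_x mu i x = 1.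
Implicit Types (f g : {ffun I -> bool} -> R) (w : {ffun I -> bool}).

Definition antitone f := forall w w', (forall i, w i -> w' i) -> f w' <= f w.

Let cexpect1 i f w : cexpect mu [set i] f w =
  mu i true * f [ffun j => if j == i then true else w j] +
  mu i false * f [ffun j => if j == i then false else w j].
Proof.
have := expect_at mu_sum1 i (fun x => f [ffun j => if j == i then x else w j]).
rewrite big_bool /= => <-.
apply: eq_expect => w'; congr f; apply/ffunP => j; rewrite mixE ffunE inE.
by case: eqP => [->|].
Qed.

Lemma cexpect_antitone S f : antitone f -> antitone (cexpect mu S f).
Proof.
move=> hf w w' le; apply: ler_expect => // w1; apply: hf => i.
by rewrite !mixE; case: (i \in S) => //; apply: le.
Qed.

(** Induction on the coordinates averaged over. Monotonicity is inherited by [cexpect], so each step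
    is Chebyshev's inequality for a single bit. *)
Lemma harris_cexpect (s : seq I) f g w : antitone f -> antitone g ->
  cexpect mu [set i in s] f w * cexpect mu [set i in s] g w <=
  cexpect mu [set i in s] (fun w => f w * g w) w.
Proof.
move=> hf hg; elim: s w => [|i s IH] w.
  have -> : [set i : I in [::]] = set0 by apply/setP => i; rewrite !inE.
  by rewrite !(cexpect0 mu_sum1).
have -> : [set j in i :: s] = [set j in s] :|: [set i].
  by apply/setP => j; rewrite !inE orbC.
rewrite !cexpectU //; apply: (@le_trans _ _
  (cexpect mu [set i] (fun w => cexpect mu [set j in s] f w * cexpect mu [set j in s] g w) w)); last first.
  by apply: ler_expect => // w'; apply: IH.
rewrite !cexpect1.
set w1 := [ffun j => if j == i then true else w j].
set w0 := [ffun j => if j == i then false else w j].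
have le01 j : w0 j -> w1 j by rewrite !ffunE; case: eqP.
have lea := @cexpect_antitone [set j in s] f hf w0 w1 le01.
have leb := @cexpect_antitone [set j in s] g hg w0 w1 le01.
have := mu_sum1 i; rewrite big_bool /=.
have := mu_ge0 i true; have := mu_ge0 i false; move: lea leb.
move: (cexpect mu [set j in s] f w0) (cexpect mu [set j in s] f w1)
  (cexpect mu [set j in s] g w0) (cexpect mu [set j in s] g w1) (mu i true) (mu i false).
move=> a0 a1 b0 b1 t u lea leb u0 t0 tu.
have -> : u = 1 - t by lra.
(* The covariance of two functions of one bit, a product of two differences of equal sign. *)
rewrite -subr_ge0 (_ : _ - _ = t * u * ((a0 - a1) * (b0 - b1))); last first.
  by rewrite (_ : u = 1 - t); [ring|lra].
by rewrite !mulr_ge0 // subr_ge0.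
Qed.

Lemma harris f g : antitone f -> antitone g ->
  expect mu f * expect mu g <= expect mu (fun w => f w * g w).
Proof.
move=> hf hg; have := harris_cexpect (enum I) [ffun=> false] hf hg.
have -> : [set i in enum I] = setT by apply/setP => i; rewrite !inE mem_enum.
by rewrite !cexpectT.
Qed.

Lemma antitone_prod (J : Type) (s : seq J) (P : pred J) (F : J -> {ffun I -> bool} -> R) :
  (forall j w, 0 <= F j w) -> (forall j, antitone (F j)) ->
  antitone (fun w => \prod_(j <- s | P j) F j w).
Proof. by move=> F0 Fa w w' le; apply: ler_prod => j _; rewrite F0 Fa. Qed.

Lemma harris_prod (J : Type) (s : seq J) (P : pred J) (F : J -> {ffun I -> bool} -> R) :
  (forall j w, 0 <= F j w) -> (forall j, antitone (F j)) ->
  \prod_(j <- s | P j) expect mu (F j) <= expect mu (fun w => \prod_(j <- s | P j) F j w).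
Proof.
move=> F0 Fa; elim: s => [|j s IH].
  rewrite big_nil (@eq_expect _ _ mu _ (fun=> 1)) ?expect_const // => w; by rewrite big_nil.
have -> : expect mu (fun w => \prod_(i <- j :: s | P i) F i w) = expect mu (fun w =>
    if P j then F j w * \prod_(i <- s | P i) F i w else \prod_(i <- s | P i) F i w).
  by apply: eq_expect => w; rewrite big_cons.
rewrite big_cons.
case: (P j) => //.
apply: le_trans (harris (Fa j) (antitone_prod _ _ F0 Fa)).
by apply: ler_wpM2l => //; apply: expect_ge0.
Qed.

End Harris.

Lemma ler_expRD1 (x : R) : 1 + x <= exp x.
Proof. by apply/RleP; exact: exp_ineq1_le. Qed.

Lemma exp_gt0 (x : R) : 0 < exp x.
Proof. by apply/RltP; exact: exp_pos. Qed.

Lemma exp_ge0 (x : R) : 0 <= exp x.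
Proof. exact/ltW/exp_gt0. Qed.

Lemma expD (x y : R) : exp (x + y) = exp x * exp y.
Proof. exact: exp_plus. Qed.

Lemma exp0 : exp (0 : R) = 1. Proof. exact: exp_0. Qed.

Lemma ler_exp (x y : R) : x <= y -> exp x <= exp y.
Proof.
move=> xy; rewrite -[y](subrK x) addrC expD ler_peMr ?exp_ge0 //.
by apply: le_trans (ler_expRD1 _); rewrite lerDl subr_ge0.
Qed.

Lemma exp_sum (J : Type) (s : seq J) (P : pred J) (F : J -> R) :
  exp (\sum_(j <- s | P j) F j) = \prod_(j <- s | P j) exp (F j).
Proof. by rewrite (big_morph exp expD exp0). Qed.

Lemma ler_ln (x y : R) : 0 < x -> x <= y -> ln x <= ln y.
Proof.
move=> x0; rewrite le_eqVlt => /predU1P[->//|xy].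
by apply/RleP/Rlt_le/ln_increasing; apply/RltP.
Qed.

Lemma lnM (x y : R) : 0 < x -> 0 < y -> ln (x * y) = ln x + ln y.
Proof. by move=> /RltP x0 /RltP y0; rewrite -RmultE ln_mult. Qed.

Lemma lnK (x : R) : ln (exp x) = x. Proof. exact: ln_exp. Qed.

(** From [exp (- x) >= 1 - x] one gets [exp x * (1 - x) <= 1], and [(1 + x + 2 x^2) (1 - x) = 1 +
    x^2 (1 - 2 x)] is at least 1 on this range. *)
Lemma exp_quadratic (x : R) : `|x| <= 1 / 2%:R -> exp x <= 1 + x + 2%:R * x ^+ 2.
Proof.
rewrite ler_norml => /andP[h1 h2].
have hx : exp x * exp (- x) = 1 by rewrite -expD subrr exp0.
have := ler_expRD1 (- x); have := exp_gt0 x.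
move: (exp x) (exp (- x)) hx => a b ab a0 hb.
have: a * (1 - x) <= 1 by rewrite -[leRHS]ab ler_pM2l.
move=> h; rewrite -(@ler_pM2r _ (1 - x)); last by lra.
have : 0 <= x ^+ 2 * (1 - 2%:R * x) by rewrite mulr_ge0 ?sqr_ge0 //; lra.
move=> h3; apply: (le_trans h).
have -> : (1 + x + 2%:R * x ^+ 2) * (1 - x) = 1 + x ^+ 2 * (1 - 2%:R * x) by ring.
by rewrite lerDl.
Qed.

Section Concentration.
Variables (I K X : finType) (mu : I -> X -> R) (k : I -> K).
Hypothesis mu_ge0 : forall i x, 0 <= mu i x.
Hypothesis mu_sum1 : forall i, \sum_x mu i x = 1.
Implicit Types (f g : {ffun I -> X} -> R) (w : {ffun I -> X}).

Definition block c : {set I} := [set i | k i == c].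
Definition blocks (cs : seq K) : {set I} := [set i | k i \in cs].

Variables (d : K -> {ffun I -> X} -> R) (dmax : R).
Hypothesis d_ge0 : forall c w, 0 <= d c w.
Hypothesis d_le : forall c w, d c w <= dmax.
Hypothesis d_det : forall c, determined_by (block c) (d c).

(* The increments are bounded by functions [d c] of the block rather than by constants:
   unboundedly many colors occur near a vertex, and only the sum over the colors of the
   second moments of [d c] is small. *)
Definition block_lipschitz f := forall c w w',
  (forall i, k i != c -> w i = w' i) -> `|f w - f w'| <= d c w + d c w'.

(** Given the other blocks, [f] stays within [d c w + e] of its mean, where [e] is the mean of
    [d c]. The first-order term of [exp_quadratic] vanishes, and [(d + e)^2 <= 2 d^2 + 2 e^2] with
    [e^2 <= E d^2] gives the constant [2 * 4 = 8]. *)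
Lemma mgf_block f c w (s : R) :
  (forall w w', (forall i, k i != c -> w i = w' i) -> `|f w - f w'| <= d c w + d c w') -> 0 <= s -> s * dmax <= 1 / 4%:R ->
  cexpect mu (block c) (fun w => exp (s * f w)) w <=
  exp (s * cexpect mu (block c) f w + 8%:R * s ^+ 2 * expect mu (fun w => d c w ^+ 2)).
Proof.
move=> hf s0 sd.
pose g w' := f (mix (block c) w' w); pose m := expect mu g; pose e := expect mu (d c).
have e_le : e <= dmax by rewrite -(expect_const mu_sum1 dmax); apply: ler_expect.
have e_ge0 : 0 <= e by apply: expect_ge0.
have gm w1 : `|g w1 - m| <= d c w1 + e.
  have -> : g w1 - m = expect mu (fun w2 => g w1 - g w2).
    by rewrite expectB expect_const.
  apply: le_trans (ler_norm_expect mu_ge0 _) _.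
  have -> : d c w1 + e = expect mu (fun w2 => d c w1 + d c w2).
    by rewrite expectD expect_const.
  apply: ler_expect => // w2.
  rewrite -(@d_det c (mix (block c) w1 w)); last by move=> i ic; rewrite mixE ic.
  rewrite -(@d_det c (mix (block c) w2 w) w2); last by move=> i ic; rewrite mixE ic.
  by apply: hf => i ic; rewrite !mixE inE (negPf ic).
rewrite expD -[cexpect _ _ f w]/m.
have -> : cexpect mu (block c) (fun w => exp (s * f w)) w =
    exp (s * m) * expect mu (fun w' => exp (s * (g w' - m))).
  rewrite -expectZ; apply: eq_expect => w'; rewrite -expD; congr exp.
  by rewrite /g; ring.
rewrite ler_pM2l ?exp_gt0 //.
apply: le_trans (ler_expRD1 _).
apply: (@le_trans _ _ (expect mu (fun w' => 1 + (s * (g w' - m) + 2%:R * (s ^+ 2 * (g w' - m) ^+ 2))))).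
  apply: ler_expect => // w'; rewrite addrA -exprMn; apply: exp_quadratic.
  rewrite normrM (ger0_norm s0); apply: (@le_trans _ _ (s * (dmax + dmax))).
    by apply: ler_wpM2l => //; apply: le_trans (gm w') _; apply: lerD.
  by move: sd; rewrite mulrDr; lra.
rewrite expectD expect_const // lerD2l expectD expectZ expectB expect_const // -/m subrr mulr0 add0r.
rewrite !expectZ.
suff h : expect mu (fun w' => (g w' - m) ^+ 2) <= 4%:R * expect mu (fun w => d c w ^+ 2).
  by have := ler_wpM2l (sqr_ge0 s) h; lra.
have jensen : e ^+ 2 <= expect mu (fun w => d c w ^+ 2).
  have : 0 <= expect mu (fun w => (d c w - e) ^+ 2) by apply: expect_ge0 => // w'; apply: sqr_ge0.
  rewrite (@eq_expect _ _ mu _ (fun w => d c w ^+ 2 - 2%:R * e * d c w + e ^+ 2)); last by move=> w'; ring.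
  by rewrite expectD expect_const // expectB expectZ -/e; lra.
apply: (@le_trans _ _ (expect mu (fun w' => 2%:R * d c w' ^+ 2 + 2%:R * e ^+ 2))).
  apply: ler_expect => // w'.
  apply: (@le_trans _ _ ((d c w' + e) ^+ 2)).
    by rewrite -real_normK ?num_real // lerXn2r ?nnegrE ?addr_ge0.
  by have := sqr_ge0 (d c w' - e); rewrite !expr2; lra.
by rewrite expectD expect_const // expectZ; lra.
Qed.

(** Averaging over other blocks keeps the bound because [d c] depends on block [c] alone; blocks can
    therefore be integrated out one at a time. *)
Lemma cexpect_lipschitz f cs : block_lipschitz f -> forall c, c \notin cs ->
  forall w w', (forall i, k i != c -> w i = w' i) ->
  `|cexpect mu (blocks cs) f w - cexpect mu (blocks cs) f w'| <= d c w + d c w'.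
Proof.
move=> hf c ccs w w' eww'; rewrite -expectB; apply: le_trans (ler_norm_expect mu_ge0 _) _.
rewrite -[leRHS](expect_const mu_sum1); apply: ler_expect => // w1.
have dE w0 : d c (mix (blocks cs) w1 w0) = d c w0.
  by apply: d_det => i; rewrite inE => /eqP ic; rewrite mixE inE ic (negPf ccs).
rewrite -(dE w) -(dE w'); apply: hf => i ic; rewrite !mixE; case: ifP => // _.
exact: eww'.
Qed.

Lemma mgf_blocks f (s : R) cs w : uniq cs -> block_lipschitz f -> 0 <= s -> s * dmax <= 1 / 4%:R ->
  cexpect mu (blocks cs) (fun w => exp (s * f w)) w <=
  exp (s * cexpect mu (blocks cs) f w +
       8%:R * s ^+ 2 * \sum_(c <- cs) expect mu (fun w => d c w ^+ 2)).
Proof.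
move=> ucs hf s0 sd; elim: cs ucs w => [_ w|c cs IH /andP[ccs ucs] w].
  have -> : blocks [::] = set0 by apply/setP => i; rewrite !inE.
  by rewrite !cexpect0 // big_nil mulr0 addr0.
have -> : blocks (c :: cs) = blocks cs :|: block c.
  by apply/setP => i; rewrite !inE orbC.
rewrite big_cons !cexpectU //.
pose v := 8%:R * s ^+ 2 * \sum_(c <- cs) expect mu (fun w => d c w ^+ 2).
apply: (@le_trans _ _ (cexpect mu (block c) (fun w => exp v * exp (s * cexpect mu (blocks cs) f w)) w)).
  by apply: ler_expect => // w'; rewrite -expD [v + _]addrC; apply: IH.
have -> : cexpect mu (block c) (fun w => exp v * exp (s * cexpect mu (blocks cs) f w)) w =
    exp v * cexpect mu (block c) (fun w => exp (s * cexpect mu (blocks cs) f w)) w.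
  exact: expectZ.
rewrite /v.
have -> a b b' : exp (a + 8%:R * s ^+ 2 * (b + b')) = exp (8%:R * s ^+ 2 * b') * exp (a + 8%:R * s ^+ 2 * b).
  by rewrite -expD; congr exp; ring.
rewrite ler_pM2l ?exp_gt0 //.
by apply: mgf_block => // w1 w2; apply: cexpect_lipschitz.
Qed.

Lemma concentration f (s t V : R) : block_lipschitz f -> 0 <= s -> s * dmax <= 1 / 4%:R ->
  \sum_c expect mu (fun w => d c w ^+ 2) <= V ->
  pr mu (fun w => expect mu f + t < f w) <= exp (8%:R * s ^+ 2 * V - s * t).
Proof.
move=> hf s0 sd hV.
have blocksT : blocks (enum K) = setT by apply/setP => i; rewrite !inE mem_enum.
have h : expect mu (fun w => exp (s * f w)) <= exp (s * expect mu f + 8%:R * s ^+ 2 * V).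
  (* [cexpect] has to be evaluated at some base point; the space is nonempty because its total mass
     is 1. *)
  have /card_gt0P [w0 _] : (0 < #|{: {ffun I -> X}}|)%N.
    case: (pickP (mem {: {ffun I -> X}})) => [w _|w0]; first by apply/card_gt0P; exists w.
    have := expect_const mu_sum1 1; rewrite /expect big_pred0 //.
    by move/eqP; rewrite eq_sym oner_eq0.
  have := mgf_blocks w0 (enum_uniq K) hf s0 sd.
  rewrite blocksT !cexpectT //; move/le_trans; apply.
  rewrite big_enum /=; apply: ler_exp; rewrite lerD2l ler_wpM2l ?mulr_ge0 ?sqr_ge0 //.
apply: (@le_trans _ _ (expect mu (fun w => exp (s * f w) * exp (- (s * (expect mu f + t)))))).
  apply: ler_expect => // w; rewrite -expD.
  case: ltP => h' /=; last exact: exp_ge0.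
  apply: le_trans (ler_expRD1 _); rewrite lerDl -mulrBr mulr_ge0 // subr_ge0; exact: ltW.
rewrite expectZr; apply: (@le_trans _ _ (exp (s * expect mu f + 8%:R * s ^+ 2 * V) *
    exp (- (s * (expect mu f + t))))).
  by apply: ler_wpM2r => //; apply: exp_ge0.
by rewrite -expD; apply: ler_exp; rewrite mulrDr; lra.
Qed.

End Concentration.

Lemma exp_lower (x : R) : 0 <= x -> x <= 1 / 2%:R -> exp (- (2%:R * x)) <= 1 - x.
Proof.
move=> x0 x1.
have h : exp (2%:R * x) * exp (- (2%:R * x)) = 1 by rewrite -expD subrr exp0.
have h1 := ler_expRD1 (2%:R * x); have h2 := exp_gt0 (- (2%:R * x)).
move: (exp (2%:R * x)) (exp (- (2%:R * x))) h h1 h2 => a b ab ha hb.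
have h3 : (1 + 2%:R * x) * b <= 1 by apply: le_trans (ler_wpM2r (ltW hb) ha) _; rewrite ab.
have h4 : 0 <= x * (1 - 2%:R * x) by rewrite mulr_ge0 //; lra.
rewrite -(@ler_pM2l _ (1 + 2%:R * x)); last by lra.
apply: le_trans h3 _; have -> : (1 + 2%:R * x) * (1 - x) = 1 + x * (1 - 2%:R * x) by ring.
by rewrite lerDl.
Qed.

Lemma antitone_indicator (I : finType) (P : pred {ffun I -> bool}) :
  (forall w w' : {ffun I -> bool}, (forall i, w i -> w' i) -> P w' -> P w) ->
  antitone (fun w => (P w)%:R).
Proof.
by move=> h w w' le; case E: (P w') => //; rewrite ?ler0n // (h _ _ le E).
Qed.

(** * One step of the random process *)

Section Selection.
Variables (V C : finType) (p : V -> C -> R) (Q : C -> rel V) (T : V -> V -> V -> bool).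
Variables (alpha ph : R).
Hypothesis p_ge0 : forall v c, 0 <= p v c.
Hypothesis p_le : forall v c, p v c <= ph.
Hypothesis alpha_ge0 : 0 <= alpha.
Hypothesis alpha_le : alpha <= 1 / 10%:R.
Hypothesis ph_le : ph <= 1 / 10%:R.
Hypothesis T_sym : forall v x y, T v x y = T v y x.
Hypothesis T_irr : forall v x, ~~ T v x x.

Notation idx := (V * C)%type.
Notation Om := {ffun idx -> bool}.
Definition law (i : idx) (x : bool) : R :=
  if x then alpha * p i.1 i.2 else 1 - alpha * p i.1 i.2.

Let ap_ge0 v c : 0 <= alpha * p v c. Proof. exact: mulr_ge0. Qed.
Let ap_le v c : alpha * p v c <= 1 / 100%:R.
Proof.
have h1 := p_ge0 v c; have h2 := p_le v c.
apply: (@le_trans _ _ (1 / 10%:R * (1 / 10%:R))); last by lra.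
by apply: ler_pM => //; apply: le_trans h2 ph_le.
Qed.

Lemma law_ge0 i x : 0 <= law i x.
Proof. by case: x => /=; rewrite /law //; have := ap_le i.1 i.2; lra. Qed.

Lemma law_sum1 i : \sum_x law i x = 1.
Proof. by rewrite big_bool /= /law; ring. Qed.

Notation EE := (expect law).
Notation PP := (pr law).

Lemma expect_sel v c : EE (fun w => (w (v, c))%:R) = alpha * p v c.
Proof.
by rewrite (expect_at law_sum1 (v, c) (fun x => x%:R)) big_bool /= mulr1 mulr0 addr0.
Qed.

Lemma expect_sel2 x y c : x != y ->
  EE (fun w => (w (x, c) && w (y, c))%:R) = (alpha * p x c) * (alpha * p y c).
Proof.
move=> xy; rewrite -!expect_sel -(@expectM_indep _ _ _ law_sum1 [set (x, c)] [set (y, c)]).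
- by apply: eq_expect => w; rewrite -natrM mulnb.
- by move=> w w' e; rewrite e ?inE.
- by move=> w w' e; rewrite e ?inE.
- by rewrite disjoints1 inE xpair_eqE (negPf xy).
Qed.

(** In the application [Q c v u] forbids giving the color [c] to both [v] and [u], and [T v x y]
    says that the three vertices form an edge. [T] is symmetric in its last two arguments, so sums
    over [x] and [y] count every triple twice. *)
Definition unblocked (w : Om) v c : bool :=
  [forall u, Q c v u ==> ~~ w (u, c)] &&
  [forall x, forall y, T v x y ==> ~~ (w (x, c) && w (y, c))].

Lemma unblockedP (w : Om) v c : reflect
  ((forall u, Q c v u -> ~~ w (u, c)) /\
   (forall x y, T v x y -> ~~ (w (x, c) && w (y, c)))) (unblocked w v c).
Proof.
apply: (iffP andP) => -[h1 h2]; split.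
- by move=> u; apply/implyP/(forallP h1).
- by move=> x y; apply/implyP/(forallP (forallP h2 x)).
- by apply/forallP => u; apply/implyP/h1.
- by apply/forallP => x; apply/forallP => y; apply/implyP/h2.
Qed.

Definition survival v c := PP (fun w => unblocked w v c).
Definition load v c := \sum_u (Q c v u)%:R * p u c.
Definition load3 v c := \sum_x \sum_y (T v x y)%:R * (p x c * p y c).
Definition block_rate v c := alpha * load v c + alpha ^+ 2 * load3 v c.

Lemma unblocked_mono (w w' : Om) v c : (forall i, w i -> w' i) -> unblocked w' v c -> unblocked w v c.
Proof.
move=> le /unblockedP [h1 h2]; apply/unblockedP; split.
  by move=> u /h1; apply: contra; apply: le.
by move=> x y /h2; apply: contra => /andP[a b]; rewrite !le.
Qed.

Lemma unblocked_antitone v c : antitone (fun w => (unblocked w v c)%:R).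
Proof. by apply: antitone_indicator => w w'; apply: unblocked_mono. Qed.

Let F2 v c (z : V * V) (w : Om) : R := 1 - (T v z.1 z.2 && (w (z.1, c) && w (z.2, c)))%:R.
Let F1 v c u (w : Om) : R := 1 - (Q c v u && w (u, c))%:R.

Let F1_ge0 v c u w : 0 <= F1 v c u w.
Proof. by rewrite /F1; case: (_ && _); rewrite ?subrr ?subr0. Qed.
Let F2_ge0 v c u w : 0 <= F2 v c u w.
Proof. by rewrite /F2; case: (_ && _); rewrite ?subrr ?subr0. Qed.
Let F1_anti v c u : antitone (F1 v c u).
Proof.
move=> w w' le; rewrite lerD2l lerN2 ler_nat.
by case: (Q c v u) => //=; have := le (u, c); case: (w _) => // ->.
Qed.
Let F2_anti v c u : antitone (F2 v c u).
Proof.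
move=> w w' le; rewrite lerD2l lerN2 ler_nat.
case: (T _ _ _) => //=; move: (le (u.1, c)) (le (u.2, c)).
by case: (w (u.1, c)) => // /(_ isT) ->; case: (w (u.2, c)) => // /(_ isT) ->.
Qed.

(** Escaping a given conflict is a decreasing event, so Harris' inequality bounds the survival
    probability from below by a product over all conflicts, and [1 - x >= exp (- 2 x)] turns it into
    an exponential. The entropy estimate takes its logarithm. *)
Lemma survival_lower v c : exp (- (2%:R * block_rate v c)) <= survival v c.
Proof.
apply: (@le_trans _ _ (EE (fun w => (\prod_u F1 v c u w) * (\prod_z F2 v c z w)))); last first.
  apply: (ler_expect law_ge0) => w.
  case: (boolP (unblocked w v c)) => [_|].
    rewrite -[leRHS]mulr1; apply: ler_pM; rewrite ?prodr_ge0 //.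
      by apply: prodr_ile1 => u _; rewrite F1_ge0 /F1 gerBl ler0n.
    by apply: prodr_ile1 => u _; rewrite F2_ge0 /F2 gerBl ler0n.
  rewrite negb_and => /orP[] /forallPn [u].
    rewrite negb_imply negbK => h.
    by rewrite (bigD1 u) //= {1}/F1 h subrr !mul0r.
  case/forallPn => y; rewrite negb_imply negbK => h.
  by rewrite mulrC (bigD1 (u, y)) //= {1}/F2 h subrr !mul0r.
apply: le_trans (harris law_ge0 law_sum1 (antitone_prod _ _ (@F1_ge0 v c) (@F1_anti v c))
  (antitone_prod _ _ (@F2_ge0 v c) (@F2_anti v c))).
apply: le_trans (ler_pM _ _ (harris_prod law_ge0 law_sum1 _ _ (@F1_ge0 v c) (@F1_anti v c))
  (harris_prod law_ge0 law_sum1 _ _ (@F2_ge0 v c) (@F2_anti v c))); last 2 first.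
- by apply: prodr_ge0 => u _; apply: (expect_ge0 law_ge0).
- by apply: prodr_ge0 => u _; apply: (expect_ge0 law_ge0).
rewrite mulrDr opprD expD; apply: ler_pM; rewrite ?exp_ge0 //.
  rewrite /load !mulr_sumr -sumrN exp_sum; apply: ler_prod => u _; rewrite exp_ge0 /=.
  rewrite /F1 expectB (expect_const law_sum1); case: (Q c v u) => /=.
    rewrite mul1r expect_sel; apply: exp_lower => //; have := ap_le u c; lra.
  by rewrite (expect_const law_sum1) mulr0n mul0r !mulr0 oppr0 exp0 addr0.
rewrite /load3 pair_big /= !mulr_sumr -sumrN exp_sum; apply: ler_prod => -[x y] _; rewrite exp_ge0 /=.
rewrite /F2 /= expectB (expect_const law_sum1); case E: (T v x y) => /=.
  rewrite mul1r expect_sel2; last by apply: contraTneq E => ->; apply: T_irr.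
  have -> : alpha ^+ 2 * (p x c * p y c) = (alpha * p x c) * (alpha * p y c) by ring.
  apply: exp_lower; first exact: mulr_ge0.
  apply: (@le_trans _ _ (1 / 100%:R * (1 / 100%:R))); [exact: ler_pM|lra].
by rewrite (expect_const law_sum1) mulr0n mul0r !mulr0 oppr0 exp0 addr0.
Qed.

Lemma survival_gt0 v c : 0 < survival v c.
Proof. exact: lt_le_trans (exp_gt0 _) (survival_lower v c). Qed.

Lemma survival_le1 v c : survival v c <= 1.
Proof. exact: (pr_le1 law_ge0 law_sum1). Qed.

(** Union bound. To first order it gains a factor 2 over [survival_lower], which the rate in
    [expect_beta] uses. *)
Lemma survival_union v c : 1 - block_rate v c <= survival v c.
Proof.
rewrite lerBlDr -lerBlDl.
have -> : 1 - survival v c = EE (fun w => 1 - (unblocked w v c)%:R).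
  by rewrite expectB (expect_const law_sum1).
have -> : block_rate v c = EE (fun w => \sum_u (Q c v u)%:R * (w (u, c))%:R +
    \sum_x \sum_y (T v x y)%:R * (w (x, c) && w (y, c))%:R).
  rewrite expectD; congr (_ + _).
    rewrite expect_sum mulr_sumr; apply: eq_bigr => u _.
    by rewrite expectZ expect_sel; ring.
  rewrite expect_sum mulr_sumr; apply: eq_bigr => x _.
  rewrite expect_sum mulr_sumr; apply: eq_bigr => y _.
  rewrite expectZ; case E: (T v x y); last by rewrite !mul0r mulr0.
  by rewrite expect_sel2; [ring|apply: contraTneq E => ->; apply: T_irr].
apply: (ler_expect law_ge0) => w.
have s1 : 0 <= \sum_u (Q c v u)%:R * (w (u, c))%:R :> R.
  by apply: sumr_ge0 => u _; apply: mulr_ge0.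
have s2 : 0 <= \sum_x \sum_y (T v x y)%:R * (w (x, c) && w (y, c))%:R :> R.
  by apply: sumr_ge0 => x _; apply: sumr_ge0 => y _; apply: mulr_ge0.
case: (boolP (unblocked w v c)) => [_|]; first by rewrite subrr addr_ge0.
rewrite subr0 negb_and => /orP[] /forallPn [u].
  rewrite negb_imply negbK => /andP[h1 h2].
  apply: le_trans (ler_wpDr s2 (lexx _)); rewrite (bigD1 u) //= h1 h2 mulr1 lerDl.
  by apply: sumr_ge0 => x _; apply: mulr_ge0.
case/forallPn => y; rewrite negb_imply negbK => /andP[h1 h2].
apply: le_trans (ler_wpDl s1 (lexx _)).
rewrite (bigD1 u) //= (bigD1 y) //= h1 h2 mulr1 -addrA lerDl.
by apply: addr_ge0; [|apply: sumr_ge0 => x _]; apply: sumr_ge0 => z _; apply: mulr_ge0.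
Qed.

Definition touched c v : {set idx} :=
  [set i | (i.2 == c) && (Q c v i.1 || [exists y, T v i.1 y])].

Lemma unblocked_touched v c : determined_by (touched c v) (fun w => unblocked w v c).
Proof.
suff h (w w' : Om) : (forall i, i \in touched c v -> w i = w' i) -> unblocked w v c -> unblocked w' v c.
  by move=> w w' e; apply/idP/idP; apply: h => // i iS; rewrite e.
move=> e /unblockedP [h1 h2]; apply/unblockedP; split.
  by move=> u Qu; rewrite -e ?h1 // inE /= eqxx Qu.
move=> x y Txy; rewrite -!e ?h2 // inE /= eqxx; apply/orP; right; apply/existsP.
  by exists x; rewrite T_sym.
by exists y.
Qed.

(* Zeroing the selections on an edge [e] only unblocks more; the remaining
   dependence sets of the vertices of [e] are disjoint in a triangle-free hypergraph. *)
Definition erase (e : {set V}) (w : Om) : Om := [ffun i => (i.1 \notin e) && w i].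
Definition touched_off (e : {set V}) c v : {set idx} :=
  [set i | [&& i.2 == c, i.1 \notin e & Q c v i.1 || [exists y, (y \notin e) && T v i.1 y]]].

Lemma unblocked_erase e w v c : unblocked w v c -> unblocked (erase e w) v c.
Proof. by apply: unblocked_mono => i; rewrite ffunE => /andP[]. Qed.

Lemma erased_touched e v c : determined_by (touched_off e c v) (fun w => unblocked (erase e w) v c).
Proof.
suff h (w w' : Om) : (forall i, i \in touched_off e c v -> w i = w' i) ->
    unblocked (erase e w) v c -> unblocked (erase e w') v c.
  by move=> w w' ee; apply/idP/idP; apply: h => // i iS; rewrite ee.
move=> ee /unblockedP [h1 h2]; apply/unblockedP; split.
  move=> u Qu; move: (h1 _ Qu); rewrite !ffunE /=; case ue: (u \in e) => //=.
  by rewrite -ee // inE /= eqxx ue Qu.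
move=> x y Txy; move: (h2 _ _ Txy); rewrite !ffunE /=.
case xe: (x \in e) => //=; case ye: (y \in e); rewrite /= ?andbF //.
rewrite -!ee // inE /= eqxx ?xe ?ye; apply/orP; right; apply/existsP.
  by exists x; rewrite T_sym xe.
by exists y; rewrite ye.
Qed.

Definition survival_off e v c := PP (fun w => unblocked (erase e w) v c).

(** If no vertex of [e] selects [c], erasing changes nothing for the color [c]. That event is
    independent of the erased survival and fails with probability at most [3 * alpha * ph]. *)
Lemma survival_off_le (e : {set V}) v c : (#|e| <= 3)%N ->
  survival_off e v c * (1 - 3%:R * (alpha * ph)) <= survival v c.
Proof.
move=> e3; apply: (@le_trans _ _
  (EE (fun w => (unblocked (erase e w) v c)%:R * [forall u in e, ~~ w (u, c)]%:R))).
  rewrite (@expectM_indep _ _ _ law_sum1 (touched_off e c v) [set i | i.1 \in e]).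
  - apply: ler_wpM2l; first exact: (pr_ge0 law_ge0).
    apply: (@le_trans _ _ (EE (fun w => 1 - \sum_(u in e) (w (u, c))%:R))).
      rewrite expectB (expect_const law_sum1) expect_sum lerD2l lerN2.
      apply: (@le_trans _ _ (\sum_(u in e) alpha * ph)).
        by apply: ler_sum => u _; rewrite expect_sel ler_wpM2l.
      rewrite sumr_const -[leLHS]mulr_natl; apply: ler_wpM2r; last by rewrite ler_nat.
      by apply: mulr_ge0 => //; apply: le_trans (p_ge0 v c) (p_le v c).
    apply: (ler_expect law_ge0) => w.
    case: (boolP [forall u in e, _]) => [h|]; first by rewrite gerBl sumr_ge0.
    rewrite negb_forall => /existsP [u]; rewrite negb_imply negbK => /andP[ue wu].
    by rewrite subr_le0 (bigD1 u) //= wu lerDl sumr_ge0.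
  - by move=> w w' h; congr (nat_of_bool _)%:R; apply: erased_touched.
  - move=> w w' h; congr (nat_of_bool _)%:R; apply: eq_forallb => u.
    by case ue: (u \in e) => //=; rewrite h // inE.
  - rewrite -setI_eq0; apply/eqP/setP => i; rewrite !inE.
    by case: (i.1 \in e); rewrite ?andbF.
apply: (ler_expect law_ge0) => w; rewrite -natrM ler_nat mulnb.
case: (boolP [forall u in e, _]) => [h|]; last by rewrite andbF.
rewrite andbT; have -> // : unblocked (erase e w) v c = unblocked w v c.
apply: unblocked_touched => -[u c']; rewrite inE ffunE /= => /andP[/eqP -> _].
by case ue: (u \in e) => //=; move/forall_inP/(_ _ ue)/negbTE: h => ->.
Qed.

(** The price per vertex of replacing a survival event by the one with an edge erased. *)
Definition kappa := (1 - 3%:R * (alpha * ph))^-1.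

Let kden : 0 < 1 - 3%:R * (alpha * ph).
Proof.
suff : alpha * ph <= 1 / 10%:R * (1 / 10%:R) by lra.
have [ph0|ph0] := leP 0 ph; first exact: ler_pM.
by apply: (@le_trans _ _ 0); [apply: mulr_ge0_le0 => //; apply: ltW|lra].
Qed.

Lemma survival_off_kappa (e : {set V}) v c : (#|e| <= 3)%N -> survival_off e v c <= kappa * survival v c.
Proof. by move=> e3; rewrite mulrC ler_pdivlMr ?survival_off_le. Qed.

Lemma survival_off_ge0 e v c : 0 <= survival_off e v c.
Proof. exact: (pr_ge0 law_ge0). Qed.

Let det_off e v c : determined_by (touched_off e c v) (fun w => (unblocked (erase e w) v c)%:R : R).
Proof. by move=> w w' h; rewrite (erased_touched h). Qed.

Lemma near_indep2 (e : {set V}) c u v : (#|e| <= 3)%N ->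
  [disjoint touched_off e c u & touched_off e c v] ->
  EE (fun w => (unblocked w v c)%:R * (unblocked w u c)%:R) <= kappa ^+ 2 * (survival v c * survival u c).
Proof.
move=> e3 dis; apply: (@le_trans _ _ (EE (fun w =>
    (unblocked (erase e w) v c)%:R * (unblocked (erase e w) u c)%:R))).
  apply: (ler_expect law_ge0) => w; rewrite -!natrM ler_nat !mulnb.
  case: (boolP (unblocked w v c && _)) => // /andP[h1 h2].
  by rewrite !unblocked_erase.
rewrite (expectM_indep law_sum1 (@det_off e v c) (@det_off e u c)) 1?disjoint_sym //.
have -> : kappa ^+ 2 * (survival v c * survival u c) = (kappa * survival v c) * (kappa * survival u c) by ring.
by apply: ler_pM; rewrite ?survival_off_kappa // survival_off_ge0.
Qed.

(** [x] lies on the erased edge, so its selection is independent of both erased survival events. *)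
Lemma near_indep2_sel (e : {set V}) c u v x : (#|e| <= 3)%N -> x \in e ->
  [disjoint touched_off e c u & touched_off e c v] ->
  EE (fun w => (w (x, c))%:R * ((unblocked w v c)%:R * (unblocked w u c)%:R)) <=
  alpha * p x c * (kappa ^+ 2 * (survival v c * survival u c)).
Proof.
move=> e3 xe dis; apply: (@le_trans _ _ (EE (fun w => (w (x, c))%:R *
    ((unblocked (erase e w) v c)%:R * (unblocked (erase e w) u c)%:R)))).
  apply: (ler_expect law_ge0) => w; rewrite -!natrM ler_nat !mulnb.
  case: (boolP (_ && (unblocked w v c && _))) => // /and3P[h0 h1 h2].
  by rewrite h0 !unblocked_erase.
rewrite (@expectM_indep _ _ _ law_sum1 [set i | i.1 \in e] (touched_off e c v :|: touched_off e c u)).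
- rewrite expect_sel; apply: ler_wpM2l => //.
  rewrite (expectM_indep law_sum1 (@det_off e v c) (@det_off e u c)) 1?disjoint_sym //.
  have -> : kappa ^+ 2 * (survival v c * survival u c) = (kappa * survival v c) * (kappa * survival u c) by ring.
  by apply: ler_pM; rewrite ?survival_off_kappa // survival_off_ge0.
- by move=> w w' h; rewrite h // inE.
- move=> w w' h; congr (_ * _); apply: det_off => i iS; apply: h; rewrite inE iS ?orbT //.
- rewrite -setI_eq0; apply/eqP/setP => i; rewrite !inE.
  by case: (i.1 \in e); rewrite ?andbF.
Qed.

Lemma near_indep3 (e : {set V}) c u v x : (#|e| <= 3)%N ->
  [disjoint touched_off e c u & touched_off e c v] ->
  [disjoint touched_off e c u & touched_off e c x] ->
  [disjoint touched_off e c v & touched_off e c x] ->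
  EE (fun w => (unblocked w v c)%:R * ((unblocked w u c)%:R * (unblocked w x c)%:R)) <=
  kappa ^+ 3 * (survival v c * (survival u c * survival x c)).
Proof.
move=> e3 duv dux dvx; apply: (@le_trans _ _ (EE (fun w => (unblocked (erase e w) v c)%:R *
    ((unblocked (erase e w) u c)%:R * (unblocked (erase e w) x c)%:R)))).
  apply: (ler_expect law_ge0) => w; rewrite -!natrM ler_nat !mulnb.
  case: (boolP (_ && (_ && _))) => // /and3P[h0 h1 h2].
  by rewrite !unblocked_erase.
rewrite (@expectM_indep _ _ _ law_sum1 (touched_off e c v) (touched_off e c u :|: touched_off e c x)).
- rewrite (expectM_indep law_sum1 (@det_off e u c) (@det_off e x c)) //.
  have -> : kappa ^+ 3 * (survival v c * (survival u c * survival x c)) =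
     (kappa * survival v c) * ((kappa * survival u c) * (kappa * survival x c)) by ring.
  by apply: ler_pM; rewrite ?mulr_ge0 ?survival_off_ge0 ?survival_off_kappa //; apply: ler_pM; rewrite ?survival_off_kappa // survival_off_ge0.
- exact: det_off.
- move=> w w' h; congr (_ * _); apply: det_off => i iS; apply: h; rewrite inE iS ?orbT //.
- by rewrite -setI_eq0 setIUr setU_eq0 !setI_eq0 dvx disjoint_sym duv.
Qed.

End Selection.

(** * Expected change of the potential in one step *)

Section Step.
Variables (V C : finType) (p : V -> C -> R) (Q : C -> rel V) (T : V -> V -> V -> bool).
Variables (alpha ph n D Dg cod Bd b theta : R).
Hypothesis p_ge0 : forall v c, 0 <= p v c.
Hypothesis p_le : forall v c, p v c <= ph.
Hypothesis alpha_ge0 : 0 <= alpha.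
Hypothesis alpha_le : alpha <= 1 / 10%:R.
Hypothesis ph_gt0 : 0 < ph.
Hypothesis ph_le : ph <= 1 / 100%:R.
Hypothesis Q_irr : forall c v, ~~ Q c v v.
Hypothesis T_sym : forall v x y, T v x y = T v y x.
Hypothesis T_irr : forall v x, ~~ T v x x.
Hypothesis T_irr1 : forall v x, ~~ T v v x.
Definition supp v c : bool := 0 < p v c.
Hypothesis D_ge0 : 0 <= D.
Hypothesis n_ge0 : 0 <= n.
Hypothesis color_degree : forall v c, supp v c -> \sum_u (Q c v u)%:R <= D.
Hypothesis degree3 : forall v, \sum_x \sum_y (T v x y)%:R <= Dg.
Hypothesis codegree : forall v u, \sum_y (T v u y)%:R <= cod.
Hypothesis list_size : forall v, \sum_c (supp v c)%:R <= n.

Let ph_le' : ph <= 1 / 10%:R. Proof. apply: le_trans ph_le _. lra. Qed.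

Notation Om := {ffun V * C -> bool}.
Notation mu := (law p alpha).
Notation EE := (expect mu).
Notation PP := (pr mu).
Notation pi := (survival p Q T alpha).
Notation col := (fun i : V * C => i.2).
Notation kappa := (kappa alpha ph).

Let mu_ge0 : forall i x, 0 <= mu i x := law_ge0 p_ge0 p_le alpha_ge0 alpha_le ph_le'.
Let mu_sum1 : forall i, \sum_x mu i x = 1 := law_sum1 p alpha.
Let pi_pos v c : 0 < pi v c := survival_gt0 Q p_ge0 p_le alpha_ge0 alpha_le ph_le' T_irr v c.
Let pi_le v c : pi v c <= 1 := survival_le1 Q T p_ge0 p_le alpha_ge0 alpha_le ph_le' v c.

(* With the factor 4, removing blank triples pays for the pairs that they turn into:
   [alpha + 4 (1 - alpha/2) = 4 (1 - alpha/4)]. *)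
Definition Theta v := \sum_c p v c * (load p Q v c + 4%:R * load3 p T v c).
Definition new_weight v c : R := let z := p v c / pi v c in if z <= ph then z else 0.
(* Selections violating [few_selected] would create too many new conflicts of color [c] at [v];
   this color is then dropped, which keeps all color degrees bounded deterministically. *)
Definition few_selected (w : Om) v c : bool := \sum_x \sum_y (T v x y)%:R * (w (x, c))%:R <= Bd.
(** How far [new_Theta v] can move when the factors [beta] of [u] change: a pair weighs at most
    [ph ^+ 2] in each color, a triple at most [4 * ph ^+ 3] in each of at most [n] colors. *)
Definition influence v u : R := ph ^+ 2 * (\sum_c (supp v c && Q c v u)%:R) +
  4%:R * n * ph ^+ 3 * (\sum_y (T v u y)%:R).
(* [beta v w u c] bounds the indicator that [u] stays blank.  It omits color [c], so as to be
   independent of the survival of [c], and the colors whose selections near [v] have a large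
   total influence on [new_Theta v], so that the bounded-difference condition holds always. *)
Definition untruncated v (w : Om) u c : bool :=
  \sum_(u' | u' != u) (w (u', c))%:R * influence v u' <= b.
Definition colored v (w : Om) u c : bool :=
  [&& w (u, c), unblocked Q T w u c & untruncated v w u c].
Definition beta v (w : Om) u c : R := \prod_(c' | c' != c) (1 - (colored v w u c')%:R).

Lemma new_weight_ge0 v c : 0 <= new_weight v c.
Proof. by rewrite /new_weight; case: ifP => // _; rewrite divr_ge0 // ltW. Qed.

Lemma new_weight_le v c : new_weight v c <= ph.
Proof. by rewrite /new_weight; case: ifP => // _; apply: ltW. Qed.

Lemma new_weight_survival v c : new_weight v c * pi v c <= p v c.
Proof. by rewrite /new_weight; case: ifP => // _; rewrite ?mul0r // divfK ?gt_eqF. Qed.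

Lemma new_weight_pos v c : 0 < new_weight v c -> 0 < p v c.
Proof.
rewrite /new_weight; case: ifP => [_|_]; last by rewrite ltxx.
by rewrite pmulr_lgt0 // invr_gt0.
Qed.

Lemma new_weight_ge v c : 0 < new_weight v c -> p v c <= new_weight v c.
Proof.
rewrite /new_weight; case: ifP => [_ _|_]; last by rewrite ltxx.
by rewrite ler_pdivlMr // ler_piMr.
Qed.

Lemma load_ge0 v c : 0 <= load p Q v c.
Proof. by apply: sumr_ge0 => u _; apply: mulr_ge0. Qed.

Lemma load3_ge0 v c : 0 <= load3 p T v c.
Proof. by apply: sumr_ge0 => x _; apply: sumr_ge0 => y _; rewrite !mulr_ge0. Qed.

Lemma sum_block_rate v : Theta v <= theta ->
  \sum_c p v c * block_rate p Q T alpha v c <= alpha * theta.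
Proof.
move=> h; apply: (@le_trans _ _ (alpha * Theta v)); last exact: ler_wpM2l.
rewrite mulr_sumr; apply: ler_sum => c _; rewrite mulrCA; apply: ler_wpM2l => //.
rewrite /block_rate mulrDr lerD2l; have := load3_ge0 v c; move: (load3 _ _ _ _) => l l0.
rewrite expr2 -mulrA; apply: ler_wpM2l => //; apply: ler_wpM2r => //; have := alpha_le; lra.
Qed.

Lemma influence_ge0 v u : 0 <= influence v u.
Proof.
rewrite /influence addr_ge0 // mulr_ge0 ?sqr_ge0 ?sumr_ge0 //.
by rewrite !mulr_ge0 ?n_ge0 ?exprn_ge0 // ltW.
Qed.

Definition total_influence := ph ^+ 2 * (n * D) + 4%:R * n * ph ^+ 3 * Dg.

Lemma sum_influence v : \sum_u influence v u <= total_influence.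
Proof.
rewrite big_split /= -!mulr_sumr; apply: lerD; last first.
  by apply: ler_wpM2l; rewrite ?degree3 // !mulr_ge0 ?n_ge0 ?exprn_ge0 // ltW.
apply: ler_wpM2l; first exact: sqr_ge0.
rewrite exchange_big /=; apply: (@le_trans _ _ (\sum_c (supp v c)%:R * D)).
  apply: ler_sum => c _; case E: (supp v c) => /=; last by rewrite mul0r big1.
  by rewrite mul1r color_degree.
by rewrite -mulr_suml; apply: ler_wpM2r.
Qed.

Definition influence_bound := ph ^+ 2 * n + 4%:R * n * ph ^+ 3 * cod.

Lemma influence_le v u : influence v u <= influence_bound.
Proof.
apply: lerD; last first.
  by apply: ler_wpM2l; rewrite ?codegree // !mulr_ge0 ?n_ge0 ?exprn_ge0 // ltW.
apply: ler_wpM2l; first exact: sqr_ge0.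
apply: le_trans (list_size v); apply: ler_sum => c _.
by rewrite ler_nat; case: (supp v c); case: (Q _ _ _).
Qed.

Lemma sum_p_le u : \sum_c p u c <= n * ph.
Proof.
apply: (@le_trans _ _ (\sum_c (supp u c)%:R * ph)); last first.
  by rewrite -mulr_suml; apply: ler_wpM2r => //; apply: ltW.
apply: ler_sum => c _; rewrite /supp; case: ltP => /=; first by rewrite mul1r.
by rewrite mul0r.
Qed.

Lemma touched_block c v : touched Q T c v \subset block col c.
Proof. by apply/subsetP => i; rewrite !inE => /andP[]. Qed.

Lemma unblocked_block c v : determined_by (block col c) (fun w => unblocked Q T w v c).
Proof. exact: (@determined_byS _ _ _ _ _ _ (touched_block c v) (@unblocked_touched _ _ Q T T_sym v c)). Qed.

Lemma few_selected_block c v : determined_by (block col c) (fun w => few_selected w v c).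
Proof.
move=> w w' h; rewrite /few_selected; congr (_ <= _); apply: eq_bigr => x _; apply: eq_bigr => y _.
by rewrite h // inE.
Qed.

Lemma colored_block v u c : determined_by (block col c) (fun w => colored v w u c).
Proof.
move=> w w' h; rewrite /colored (@unblocked_block c u w w' h) (h (u, c)) ?inE //.
congr [&& _, _ & _]; rewrite /untruncated; congr (_ <= _); apply: eq_bigr => x _.
by rewrite h // inE.
Qed.

Lemma blocks_disjoint (c c' : C) : c != c' -> [disjoint block col c & block col c'].
Proof.
move=> cc; rewrite -setI_eq0; apply/eqP/setP => i; rewrite !inE.
by apply/negbTE/negP => /andP[/eqP -> /eqP ?]; move/eqP: cc.
Qed.

Lemma expect_few_selected v c : 0 < Bd -> 1 - alpha * ph * Dg / Bd <= PP (fun w => few_selected w v c).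
Proof.
move=> Bd0; rewrite lerBlDr -lerBlDl.
have -> : 1 - PP (fun w => few_selected w v c) = PP (fun w => Bd < \sum_x \sum_y (T v x y)%:R * (w (x, c))%:R).
  rewrite -[X in X - _](expect_const mu_sum1) -expectB; apply: eq_expect => w.
  by rewrite /few_selected; case: leP; rewrite ?subrr ?subr0.
apply: le_trans (markov mu_ge0 Bd0 _) _.
  by move=> w; apply: sumr_ge0 => x _; apply: sumr_ge0 => y _; apply: mulr_ge0.
apply: ler_wpM2r; first by rewrite invr_ge0 ltW.
rewrite expect_sum; apply: (@le_trans _ _ (\sum_x \sum_y alpha * ph * (T v x y)%:R)).
  apply: ler_sum => x _; rewrite expect_sum; apply: ler_sum => y _.
  by rewrite expectZ expect_sel mulrC; apply: ler_wpM2r => //; apply: ler_wpM2l.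
under eq_bigr do rewrite -mulr_sumr.
by rewrite -mulr_sumr; apply: ler_wpM2l => //; apply: mulr_ge0 => //; apply: ltW.
Qed.

Hypothesis b_gt0 : 0 < b.
Hypothesis truncation : alpha * ph * total_influence <= b / 20%:R.

Lemma expect_influence v c :
  EE (fun w => \sum_u (w (u, c))%:R * influence v u) = \sum_u alpha * p u c * influence v u.
Proof. by rewrite expect_sum; apply: eq_bigr => u _; rewrite expectZr expect_sel. Qed.

(** Neither the survival of [c] at [u] nor the truncation, whose sum omits [u], looks at the
    selections at [u]; the selection of [(u, c)] is therefore independent of both. By Markov's
    inequality the truncation fails with probability at most [1/20]. *)
Lemma expect_colored v u c :
  alpha * (p u c * (pi u c - 1 / 20%:R)) <= EE (fun w => (colored v w u c)%:R).
Proof.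
have -> : EE (fun w => (colored v w u c)%:R) =
    EE (fun w => (w (u, c))%:R * (unblocked Q T w u c && untruncated v w u c)%:R).
  by apply: eq_expect => w; rewrite -natrM mulnb.
rewrite (@expectM_indep _ _ _ mu_sum1 [set (u, c)] [set i | i.1 != u]); last 3 first.
- by move=> w w' h; rewrite h // inE.
- move=> w w' h; rewrite (@unblocked_touched _ _ Q T T_sym u c w w').
    congr (nat_of_bool (_ && _))%:R; rewrite /untruncated; congr (_ <= _).
    by apply: eq_bigr => x xu; rewrite h // inE.
  move=> [x c']; rewrite inE /= => /andP[_ hx]; apply: h; rewrite inE /=.
  apply: contraTneq hx => ->; rewrite negb_or Q_irr /=.
  by apply/existsP => -[y]; apply/negP.
- by rewrite disjoints1 inE eqxx.
rewrite expect_sel mulrA; apply: ler_wpM2l; first exact: mulr_ge0.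
apply: (@le_trans _ _ (EE (fun w => (unblocked Q T w u c)%:R - (b < \sum_u' (w (u', c))%:R * influence v u')%R%:R))).
  rewrite expectB lerD2l lerN2.
  apply: le_trans (markov mu_ge0 b_gt0 _) _.
    by move=> w; apply: sumr_ge0 => x _; rewrite mulr_ge0 ?influence_ge0.
  rewrite ler_pdivrMr // expect_influence mul1r mulrC; apply: le_trans truncation.
  apply: (@le_trans _ _ (\sum_u' alpha * ph * influence v u')).
    by apply: ler_sum => x _; rewrite ler_wpM2r ?influence_ge0 // ler_wpM2l.
  by rewrite -mulr_sumr; apply: ler_wpM2l; rewrite ?sum_influence // mulr_ge0 // ltW.
apply: (ler_expect mu_ge0) => w.
case: (unblocked _ _ w u c) => /=; last by rewrite sub0r oppr_le0.
case: ltP => h /=; first by rewrite subrr.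
rewrite subr0 (_ : untruncated v w u c) //; apply: le_trans h.
by rewrite [leRHS](bigD1 u) //= lerDr mulr_ge0 ?influence_ge0.
Qed.

(** Different colors use disjoint blocks, so the expectation is a product of factors
    [1 - x <= exp (- x)]. *)
Lemma expect_beta v u c : 0 < alpha -> alpha * theta <= 1 / 20%:R -> Theta u <= theta ->
  13%:R / 20%:R <= \sum_c p u c -> EE (fun w => beta v w u c) <= 1 - alpha / 2%:R.
Proof.
move=> a0 ath hTh hp.
have -> : EE (fun w => beta v w u c) = \prod_(c' | c' != c) EE (fun w => 1 - (colored v w u c')%:R).
  rewrite -[RHS]big_filter -(@expect_prod_indep _ _ _ mu_sum1 _ _ (block col)).
  - by apply: eq_expect => w; rewrite big_filter.
  - exact/filter_uniq/index_enum_uniq.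
  - by move=> c' w w' h; rewrite (@colored_block v u c' w w' h).
  - exact: blocks_disjoint.
apply: (@le_trans _ _ (\prod_(c' | c' != c) exp (- EE (fun w => (colored v w u c')%:R)))).
  apply: ler_prod => c' _; rewrite expectB (expect_const mu_sum1); apply/andP; split.
    by rewrite subr_ge0; apply: (pr_le1 mu_ge0 mu_sum1).
  by rewrite ler_expRD1.
rewrite -exp_sum sumrN.
(* Up to the factor [alpha], the sum is at least [13/20 * 19/20], less [1/20] for blocking and
   [1/100] for the omitted color [c]. The excess over [1/2] pays for passing from the exponential to
   [1 - alpha / 2]. *)
have h : 11%:R / 20%:R * alpha <= \sum_(c' | c' != c) EE (fun w => (colored v w u c')%:R).
  apply: (@le_trans _ _ (\sum_(c' | c' != c) alpha * (p u c' * (pi u c' - 1 / 20%:R)))); last first.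
    by apply: ler_sum => c' _; apply: expect_colored.
  rewrite -mulr_sumr mulrC; apply: ler_wpM2l => //.
  have e : \sum_c' p u c' * (pi u c' - 1 / 20%:R) =
      p u c * (pi u c - 1 / 20%:R) + \sum_(c' | c' != c) p u c' * (pi u c' - 1 / 20%:R).
    by rewrite (bigD1 c).
  have h1 : p u c * (pi u c - 1 / 20%:R) <= ph.
    apply: le_trans (p_le u c); rewrite ler_piMr //; have := pi_le u c; lra.
  have h2 : \sum_c' p u c' * (1 - 1 / 20%:R) - \sum_c' p u c' * block_rate p Q T alpha u c' <=
      \sum_c' p u c' * (pi u c' - 1 / 20%:R).
    rewrite -sumrB; apply: ler_sum => c' _; rewrite -mulrBr; apply: ler_wpM2l => //.
    have := survival_union Q p_ge0 p_le alpha_ge0 alpha_le ph_le' T_irr u c'; lra.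
  have h3 := sum_block_rate hTh; rewrite -mulr_suml in h2.
  move: e h1 h2 h3; move: (\sum_(c' | c' != c) _) (\sum_c' p u c' * (pi u c' - _)) (\sum_c' p u c' * block_rate _ _ _ _ _ _).
  by move: hp ph_le ath; move: (\sum_c p u c) => x hp hph hat y z t *; lra.
apply: (@le_trans _ _ (exp (- (11%:R / 20%:R * alpha)))); first by apply: ler_exp; rewrite lerN2.
set x := 11%:R / 20%:R * alpha.
have e1 : exp x * exp (- x) = 1 by rewrite -expD subrr exp0.
have e2 := ler_expRD1 x; have e3 := exp_gt0 (- x).
have e4 : (1 + x) * exp (- x) <= 1 by rewrite -[leRHS]e1 ler_pM2r.
rewrite -(@ler_pM2l _ (1 + x)); last by rewrite /x; have := alpha_ge0; lra.
apply: le_trans e4 _; rewrite /x.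
have h5 : 0 <= alpha * (1 / 10%:R - alpha) by rewrite mulr_ge0 // subr_ge0.
have -> : (1 + 11%:R / 20%:R * alpha) * (1 - alpha / 2%:R) =
  1 + alpha * (1 / 10%:R - alpha) * (11%:R / 40%:R) + alpha * (9%:R / 400%:R) by field.
have := alpha_ge0; lra.
Qed.

Hypothesis Bd_ge0 : 0 <= Bd.
Hypothesis near_pair : forall c v u, Q c v u -> supp v c -> supp u c ->
  exists2 e : {set V}, (#|e| <= 3)%N & [disjoint touched_off Q T e c u & touched_off Q T e c v].
Hypothesis near_triple : forall c v x y, T v x y -> supp v c -> supp x c -> supp y c ->
  exists2 e : {set V}, (#|e| <= 3)%N /\ [/\ v \in e, x \in e & y \in e] &
  [/\ [disjoint touched_off Q T e c x & touched_off Q T e c v],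
      [disjoint touched_off Q T e c x & touched_off Q T e c y] &
      [disjoint touched_off Q T e c v & touched_off Q T e c y]].
Hypothesis alpha_gt0 : 0 < alpha.
Hypothesis alpha_theta : alpha * theta <= 1 / 20%:R.
Hypothesis Theta_le : forall v, Theta v <= theta.
Hypothesis mass : forall u c, supp u c -> 13%:R / 20%:R <= \sum_c p u c.

Notation U w v c := ((unblocked Q T w v c)%:R : R).

(** The next three sums majorize the pairs that remain, the pairs created from triples whose third
    vertex selects the color, and the triples that remain. Created pairs already carry the
    probability [alpha] of a selection, so they get no factor [beta]; the other two use it for a
    single vertex besides [v]. *)
Definition old_pair_sum v (w : Om) c : R := new_weight v c * U w v c * (few_selected w v c)%:R *
  \sum_u (Q c v u)%:R * (new_weight u c * U w u c * beta v w u c).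
Definition new_pair_sum v (w : Om) c : R := new_weight v c * U w v c * (few_selected w v c)%:R *
  \sum_u \sum_x (T v u x)%:R * ((w (x, c))%:R * (new_weight u c * U w u c)).
Definition triple_sum v (w : Om) c : R := 4%:R * (new_weight v c * U w v c) *
  \sum_x \sum_y (T v x y)%:R * (new_weight x c * U w x c * (new_weight y c * U w y c) * beta v w x c).
Definition new_Theta v (w : Om) : R := \sum_c (old_pair_sum v w c + new_pair_sum v w c + triple_sum v w c).

Lemma beta01 v w u c : 0 <= beta v w u c <= 1.
Proof.
rewrite /beta prodr_ge0 /=; last by move=> c' _; rewrite subr_ge0; case: (colored _ _ _ _).
by apply: prodr_ile1 => c' _; case: (colored _ _ _ _); rewrite ?subrr ?subr0 ?lexx ?ler01.
Qed.

Lemma supp_or_0 v c : supp v c \/ p v c = 0 /\ new_weight v c = 0.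
Proof.
case E : (supp v c); [by left|right].
have p0 : p v c = 0.
  by apply/eqP; rewrite eq_le p_ge0 andbT leNgt; apply/negP; move: E; rewrite /supp => ->.
by rewrite /new_weight p0 mul0r; case: ifP.
Qed.

Lemma kappa_ge1 : 1 <= kappa.
Proof.
rewrite invf_ge1 ?gerBl ?mulr_ge0 //; first exact: ltW.
have : alpha * ph <= 1 / 10%:R * (1 / 10%:R) by apply: ler_pM => //; apply: ltW.
by move=> *; lra.
Qed.

Let kappaX_ge0 k : 0 <= kappa ^+ k.
Proof. by rewrite exprn_ge0 // (le_trans ler01 kappa_ge1). Qed.

Lemma ler_kappa (k : nat) (x : R) : 0 <= x -> (k <= 3)%N -> kappa ^+ k * x <= kappa ^+ 3 * x.
Proof. by move=> x0 k3; apply: ler_wpM2r => //; apply: ler_weXn2l => //; apply: kappa_ge1. Qed.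

Lemma beta_off v u c : determined_by (~: block col c) (fun w => beta v w u c).
Proof.
move=> w w' h; apply: eq_bigr => c' cc'; rewrite (@colored_block v u c' w w') // => i.
by rewrite inE => /eqP ic; apply: h; rewrite !inE ic.
Qed.

Let qp_ge0 v c : 0 <= new_weight v c * pi v c.
Proof. by apply: mulr_ge0; [apply: new_weight_ge0|apply: ltW]. Qed.

(** Survival of [c] is decided inside the block of [c] and [beta] outside it, so the two are
    independent. The joint survival costs [kappa ^+ 2], and [new_weight * pi <= p] undoes the
    rescaling. *)
Lemma expect_pair v u c : Q c v u -> 
  new_weight v c * new_weight u c * EE (fun w => U w v c * U w u c * beta v w u c) <=
  kappa ^+ 3 * ((1 - alpha / 2%:R) * (p v c * p u c)).
Proof.
move=> Quv.
have a2 : 0 <= 1 - alpha / 2%:R by have := alpha_le; lra.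
have rhs0 : 0 <= kappa ^+ 3 * ((1 - alpha / 2%:R) * (p v c * p u c)).
  by apply: mulr_ge0 => //; apply: mulr_ge0 => //; apply: mulr_ge0.
case: (supp_or_0 v c) => [sv|[_ ->]]; last by rewrite !mul0r.
case: (supp_or_0 u c) => [su|[_ ->]]; last by rewrite mulr0 mul0r.
have [e e3 dis] := near_pair Quv sv su.
rewrite (@expectM_indep _ _ _ mu_sum1 (block col c) (~: block col c)); last 3 first.
- by move=> w w' h; rewrite (@unblocked_block c v w w' h) (@unblocked_block c u w w' h).
- exact: beta_off.
- by rewrite -setI_eq0 setICr.
have h1 := near_indep2 p_ge0 p_le alpha_ge0 alpha_le ph_le' T_sym e3 dis.
have h2 := expect_beta v c alpha_gt0 alpha_theta (Theta_le u) (mass su).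
apply: (@le_trans _ _ (new_weight v c * new_weight u c * (kappa ^+ 2 * (pi v c * pi u c) * (1 - alpha / 2%:R)))).
  apply: ler_wpM2l; first by rewrite mulr_ge0 ?new_weight_ge0.
  apply: ler_pM => //; apply: (expect_ge0 mu_ge0) => w; first by rewrite mulr_ge0.
  by case/andP: (beta01 v w u c).
have -> : new_weight v c * new_weight u c * (kappa ^+ 2 * (pi v c * pi u c) * (1 - alpha / 2%:R)) =
  kappa ^+ 2 * ((1 - alpha / 2%:R) * ((new_weight v c * pi v c) * (new_weight u c * pi u c))) by ring.
apply: le_trans (ler_kappa _ _) _ => //.
  by apply: mulr_ge0 => //; apply: mulr_ge0 => //; apply: mulr_ge0.
apply: ler_wpM2l;  first exact: kappaX_ge0.
by apply: ler_wpM2l => //; apply: ler_pM; rewrite ?new_weight_survival ?qp_ge0.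
Qed.

Lemma expect_new v u x c : T v u x ->
  new_weight v c * new_weight u c * EE (fun w => (w (x, c))%:R * (U w v c * U w u c)) <=
  kappa ^+ 3 * (alpha * (p v c * (p u c * p x c))).
Proof.
move=> Tvux.
case: (supp_or_0 v c) => [sv|[-> ->]]; last by rewrite !(mul0r, mulr0).
case: (supp_or_0 u c) => [su|[-> ->]]; last by rewrite !(mul0r, mulr0).
case: (supp_or_0 x c) => [sx|[x0 _]]; last first.
  (* Near-independence is available only when all three vertices have positive weight; here [x]
     selects [c] with probability 0 and the left side vanishes. *)
  rewrite x0 !mulr0 -(mulr0 (new_weight v c * new_weight u c)); apply: ler_wpM2l.
    by rewrite mulr_ge0 ?new_weight_ge0.
  rewrite -(mulr0 alpha) -x0 -expect_sel; apply: (ler_expect mu_ge0) => w.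
  by apply: ler_piMr => //; apply: mulr_ile1; rewrite ?ler0n ?lern1 ?leq_b1.
have [e [e3 [ve ue xe]] [d1 d2 d3]] := near_triple Tvux sv su sx.
have h1 := near_indep2_sel p_ge0 p_le alpha_ge0 alpha_le ph_le' T_sym e3 xe d1.
apply: (@le_trans _ _ (new_weight v c * new_weight u c * (alpha * p x c * (kappa ^+ 2 * (pi v c * pi u c))))).
  by apply: ler_wpM2l => //; rewrite mulr_ge0 ?new_weight_ge0.
have -> : new_weight v c * new_weight u c * (alpha * p x c * (kappa ^+ 2 * (pi v c * pi u c))) =
  kappa ^+ 2 * (alpha * ((new_weight v c * pi v c) * ((new_weight u c * pi u c) * p x c))) by ring.
apply: le_trans (ler_kappa _ _) _ => //.
  by apply: mulr_ge0 => //; apply: mulr_ge0 => //; apply: mulr_ge0.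
apply: ler_wpM2l;  first exact: kappaX_ge0.
apply: ler_wpM2l => //; apply: ler_pM; rewrite ?new_weight_survival ?qp_ge0 //; first by apply: mulr_ge0.
by apply: ler_wpM2r => //; apply: new_weight_survival.
Qed.

Lemma expect_triple v x y c : T v x y ->
  new_weight v c * (new_weight x c * new_weight y c) * EE (fun w => U w v c * (U w x c * U w y c) * beta v w x c) <=
  kappa ^+ 3 * ((1 - alpha / 2%:R) * (p v c * (p x c * p y c))).
Proof.
move=> Tvxy.
have a2 : 0 <= 1 - alpha / 2%:R by have := alpha_le; lra.
case: (supp_or_0 v c) => [sv|[-> ->]]; last by rewrite !(mul0r, mulr0).
case: (supp_or_0 x c) => [sx|[-> ->]]; last by rewrite !(mul0r, mulr0).
case: (supp_or_0 y c) => [sy|[-> ->]]; last by rewrite !(mul0r, mulr0).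
have [e [e3 _] [d1 d2 d3]] := near_triple Tvxy sv sx sy.
rewrite (@expectM_indep _ _ _ mu_sum1 (block col c) (~: block col c)); last 3 first.
- move=> w w' h; by rewrite (@unblocked_block c v w w' h) (@unblocked_block c x w w' h)
    (@unblocked_block c y w w' h).
- exact: beta_off.
- by rewrite -setI_eq0 setICr.
have h1 := near_indep3 p_ge0 p_le alpha_ge0 alpha_le ph_le' T_sym e3 d1 d2 d3.
have h2 := expect_beta v c alpha_gt0 alpha_theta (Theta_le x) (mass sx).
apply: (@le_trans _ _ (new_weight v c * (new_weight x c * new_weight y c) *
    (kappa ^+ 3 * (pi v c * (pi x c * pi y c)) * (1 - alpha / 2%:R)))).
  apply: ler_wpM2l; first by rewrite !mulr_ge0 ?new_weight_ge0.
  apply: ler_pM => //; apply: (expect_ge0 mu_ge0) => w; first by rewrite !mulr_ge0.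
  by case/andP: (beta01 v w x c).
have -> : new_weight v c * (new_weight x c * new_weight y c) * (kappa ^+ 3 * (pi v c * (pi x c * pi y c)) * (1 - alpha / 2%:R)) =
  kappa ^+ 3 * ((1 - alpha / 2%:R) * ((new_weight v c * pi v c) * ((new_weight x c * pi x c) * (new_weight y c * pi y c)))) by ring.
apply: ler_wpM2l;  first exact: kappaX_ge0.
apply: ler_wpM2l => //; apply: ler_pM; rewrite ?new_weight_survival ?qp_ge0 //; first by apply: mulr_ge0.
by apply: ler_pM; rewrite ?new_weight_survival ?qp_ge0.
Qed.

Lemma expect_new_Theta v : EE (new_Theta v) <= kappa ^+ 3 * ((1 - alpha / 4%:R) * Theta v).
Proof.
have a2 : 0 <= 1 - alpha / 2%:R by have := alpha_le; lra.
rewrite expect_sum /Theta !mulr_sumr; apply: ler_sum => c _.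
have t1 : EE (fun w => old_pair_sum v w c) <= kappa ^+ 3 * ((1 - alpha / 2%:R) * (p v c * load p Q v c)).
  apply: (@le_trans _ _ (\sum_u (Q c v u)%:R * (kappa ^+ 3 * ((1 - alpha / 2%:R) * (p v c * p u c))))); last first.
    rewrite /load !mulr_sumr; apply: ler_sum => u _; rewrite le_eqVlt; apply/orP; left; apply/eqP; ring.
  apply: (@le_trans _ _ (EE (fun w => \sum_u (Q c v u)%:R *
     (new_weight v c * new_weight u c * (U w v c * U w u c * beta v w u c))))).
    apply: (ler_expect mu_ge0) => w; rewrite /old_pair_sum mulr_sumr; apply: ler_sum => u _.
    have /andP[b0 b1] := beta01 v w u c.
    rewrite [leLHS](_ : _ = (few_selected w v c)%:R * ((Q c v u)%:R *
     (new_weight v c * new_weight u c * (U w v c * U w u c * beta v w u c)))); last by ring.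
    by apply: ler_piMl; rewrite ?lern1 ?leq_b1 // !mulr_ge0 ?new_weight_ge0.
  rewrite expect_sum; apply: ler_sum => u _; rewrite expectZ; case E: (Q c v u); last by rewrite !mul0r.
  by rewrite !mul1r expectZ; apply: expect_pair.
have t2 : EE (fun w => new_pair_sum v w c) <= kappa ^+ 3 * (alpha * (p v c * load3 p T v c)).
  apply: (@le_trans _ _ (\sum_u \sum_x (T v u x)%:R * (kappa ^+ 3 * (alpha * (p v c * (p u c * p x c)))))); last first.
    rewrite /load3 !mulr_sumr; apply: ler_sum => u _; rewrite !mulr_sumr; apply: ler_sum => x _.
    rewrite le_eqVlt; apply/orP; left; apply/eqP; ring.
  apply: (@le_trans _ _ (EE (fun w => \sum_u \sum_x (T v u x)%:R *
     (new_weight v c * new_weight u c * ((w (x, c))%:R * (U w v c * U w u c)))))).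
    apply: (ler_expect mu_ge0) => w; rewrite /new_pair_sum mulr_sumr; apply: ler_sum => u _.
    rewrite mulr_sumr; apply: ler_sum => x _.
    rewrite [leLHS](_ : _ = (few_selected w v c)%:R * ((T v u x)%:R *
     (new_weight v c * new_weight u c * ((w (x, c))%:R * (U w v c * U w u c))))); last by ring.
    by apply: ler_piMl; rewrite ?lern1 ?leq_b1 // !mulr_ge0 ?new_weight_ge0.
  rewrite expect_sum; apply: ler_sum => u _; rewrite expect_sum; apply: ler_sum => x _.
  rewrite expectZ; case E: (T v u x); last by rewrite !mul0r.
  by rewrite !mul1r expectZ; apply: expect_new.
have t3 : EE (fun w => triple_sum v w c) <= kappa ^+ 3 * ((1 - alpha / 2%:R) * (4%:R * (p v c * load3 p T v c))).
  apply: (@le_trans _ _ (\sum_x \sum_y 4%:R * ((T v x y)%:R * (kappa ^+ 3 * ((1 - alpha / 2%:R) * (p v c * (p x c * p y c))))))); last first.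
    rewrite /load3 !mulr_sumr; apply: ler_sum => u _; rewrite !mulr_sumr; apply: ler_sum => x _.
    rewrite le_eqVlt; apply/orP; left; apply/eqP; ring.
  apply: (@le_trans _ _ (EE (fun w => \sum_x \sum_y 4%:R * ((T v x y)%:R *
     (new_weight v c * (new_weight x c * new_weight y c) * (U w v c * (U w x c * U w y c) * beta v w x c)))))).
    apply: (ler_expect mu_ge0) => w; rewrite /triple_sum mulr_sumr; apply: ler_sum => x _.
    rewrite mulr_sumr; apply: ler_sum => y _; rewrite le_eqVlt; apply/orP; left; apply/eqP; ring.
  rewrite expect_sum; apply: ler_sum => x _; rewrite expect_sum; apply: ler_sum => y _.
  rewrite !expectZ; apply: ler_wpM2l => //; case E: (T v x y); last by rewrite !mul0r.
  by rewrite !mul1r; apply: expect_triple.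
rewrite !expectD; apply: le_trans (lerD (lerD t1 t2) t3) _.
rewrite -!mulrDr; apply: ler_wpM2l;  first exact: kappaX_ge0.
have := mulr_ge0 (p_ge0 v c) (load_ge0 v c); have := mulr_ge0 (p_ge0 v c) (load3_ge0 v c).
have -> : p v c * (load p Q v c + 4%:R * load3 p T v c) =
  p v c * load p Q v c + 4%:R * (p v c * load3 p T v c) by ring.
move: (p v c * load p Q v c) (p v c * load3 p T v c) => a c' c0 a0.
have := mulr_ge0 alpha_ge0 a0; have := mulr_ge0 alpha_ge0 c0; lra.
Qed.

(** * Bounded differences and concentration of the new potential *)

Definition direct_bound := ph ^+ 2 * D + ph ^+ 2 * Bd + 4%:R * ph ^+ 3 * Dg.
(** Changing the selections of the color [c] alters the summand of [c] itself by at most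
    [direct_bound], and all other summands only through [beta] of vertices that are [colored] with
    [c]. *)
Definition oscillation v c (w : Om) : R :=
  direct_bound * (supp v c)%:R + \sum_u (colored v w u c)%:R * influence v u.

Let ph_ge0 : 0 <= ph. Proof. exact: ltW. Qed.

Lemma Dg_ge0 (v : V) : 0 <= Dg.
Proof. by apply: le_trans (degree3 v); apply: sumr_ge0 => x _; apply: sumr_ge0. Qed.

Let UU_le w v c u c' : new_weight u c' * U w v c <= ph.
Proof. by apply: le_trans (new_weight_le u c'); apply: ler_piMr; rewrite ?new_weight_ge0 ?lern1 ?leq_b1. Qed.

Let UU_ge0 w v c u c' : 0 <= new_weight u c' * U w v c.
Proof. by apply: mulr_ge0; rewrite ?new_weight_ge0 ?ler0n. Qed.

Lemma old_pair_sum_bound v w c : 0 <= old_pair_sum v w c <= ph ^+ 2 * D * (supp v c)%:R.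
Proof.
have b0 u : 0 <= beta v w u c by case/andP: (beta01 v w u c).
have b1 u : beta v w u c <= 1 by case/andP: (beta01 v w u c).
have s0 : 0 <= \sum_u (Q c v u)%:R * (new_weight u c * U w u c * beta v w u c).
  by apply: sumr_ge0 => u _; apply: mulr_ge0 => //; apply: mulr_ge0.
apply/andP; split; first by rewrite /old_pair_sum mulr_ge0 // mulr_ge0.
rewrite /old_pair_sum; case: (supp_or_0 v c) => [sv|[_ ->]]; last first.
  by rewrite !mul0r; apply: mulr_ge0 => //; apply: mulr_ge0 => //; apply: sqr_ge0.
rewrite sv mulr1 expr2 -[leRHS]mulrA; apply: ler_pM => //.
- by rewrite mulr_ge0.
- by apply: le_trans (UU_le w v c v c); apply: ler_piMr; rewrite ?lern1 ?leq_b1.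
- apply: (@le_trans _ _ (\sum_u (Q c v u)%:R * ph)).
    apply: ler_sum => u _; apply: ler_wpM2l => //.
    by apply: le_trans (UU_le w u c u c); apply: ler_piMr.
  by rewrite -mulr_suml mulrC; apply: ler_wpM2l => //; apply: color_degree.
Qed.

Lemma new_pair_sum_bound v w c : 0 <= new_pair_sum v w c <= ph ^+ 2 * Bd * (supp v c)%:R.
Proof.
have s0 : 0 <= \sum_u \sum_x (T v u x)%:R * ((w (x, c))%:R * (new_weight u c * U w u c)).
  by apply: sumr_ge0 => u _; apply: sumr_ge0 => x _; apply: mulr_ge0 => //; apply: mulr_ge0.
apply/andP; split; first by rewrite /new_pair_sum mulr_ge0 // mulr_ge0.
rewrite /new_pair_sum; case: (supp_or_0 v c) => [sv|[_ ->]]; last first.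
  by rewrite !mul0r; apply: mulr_ge0 => //; apply: mulr_ge0 => //; apply: sqr_ge0.
rewrite sv mulr1 expr2 -[leRHS]mulrA -mulrA; apply: ler_pM => //.
  by rewrite mulr_ge0.
case: (boolP (few_selected w v c)) => [hf|_]; last by rewrite mul0r mulr_ge0.
rewrite mul1r; apply: (@le_trans _ _ (\sum_u \sum_x ph * ((T v x u)%:R * (w (x, c))%:R))).
  apply: ler_sum => u _; apply: ler_sum => x _.
  rewrite T_sym mulrA mulrC; apply: ler_wpM2r => //; exact: mulr_ge0.
under eq_bigr do rewrite -mulr_sumr.
rewrite -mulr_sumr; apply: ler_wpM2l => //.
by rewrite exchange_big.
Qed.

Lemma triple_sum_bound v w c : 0 <= triple_sum v w c <= 4%:R * ph ^+ 3 * Dg * (supp v c)%:R.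
Proof.
have b0 u : 0 <= beta v w u c by case/andP: (beta01 v w u c).
have b1 u : beta v w u c <= 1 by case/andP: (beta01 v w u c).
have s0 : 0 <= \sum_x \sum_y (T v x y)%:R * (new_weight x c * U w x c * (new_weight y c * U w y c) * beta v w x c).
  apply: sumr_ge0 => u _; apply: sumr_ge0 => x _; apply: mulr_ge0 => //; apply: mulr_ge0 => //.
  exact: mulr_ge0.
apply/andP; split; first by rewrite /triple_sum mulr_ge0 // mulr_ge0.
rewrite /triple_sum; case: (supp_or_0 v c) => [sv|[_ ->]]; last first.
  rewrite !(mul0r, mulr0); apply: mulr_ge0 => //; apply: mulr_ge0 => //; last exact: (Dg_ge0 v).
  by apply: mulr_ge0 => //; apply: exprn_ge0.
rewrite sv mulr1 (_ : 4%:R * ph ^+ 3 * Dg = 4%:R * ph * (ph * ph * Dg)); last by ring.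
apply: ler_pM => //; first by rewrite mulr_ge0.
  by apply: ler_wpM2l.
apply: (@le_trans _ _ (\sum_x \sum_y ph * ph * (T v x y)%:R)).
  apply: ler_sum => x _; apply: ler_sum => y _; rewrite mulrC; apply: ler_wpM2r => //.
  apply: (@le_trans _ _ (new_weight x c * U w x c * (new_weight y c * U w y c))); last exact: ler_pM.
  by apply: ler_piMr => //; apply: mulr_ge0.
under eq_bigr do rewrite -mulr_sumr.
by rewrite -mulr_sumr; apply: ler_wpM2l; [apply: mulr_ge0|apply: degree3].
Qed.

Lemma beta_diff v u c c0 (w w' : Om) : c0 != c ->
  (forall i : V * C, i.2 != c0 -> w i = w' i) ->
  `|beta v w u c - beta v w' u c| <= (colored v w u c0)%:R + (colored v w' u c0)%:R.
Proof.
move=> cc h; rewrite /beta (bigD1 c0) //= [X in _ - X](bigD1 c0) //=.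
have -> : \prod_(c' | (c' != c) && (c' != c0)) (1 - (colored v w' u c')%:R) =
    \prod_(c' | (c' != c) && (c' != c0)) (1 - (colored v w u c')%:R) :> R.
  apply: eq_bigr => c' /andP[_ cc']; rewrite (@colored_block v u c' w w') // => i.
  by rewrite inE => /eqP ic; apply: h; rewrite ic.
set r := \prod_(_ | _) _.
have r0 : 0 <= r by apply: prodr_ge0 => c' _; rewrite subr_ge0 lern1 leq_b1.
have r1 : r <= 1.
  by apply: prodr_ile1 => c' _; rewrite subr_ge0 lern1 leq_b1 gerBl ler0n.
rewrite -mulrBl normrM (ger0_norm r0); apply: (@le_trans _ _ (`|1 - (colored v w u c0)%:R -
    (1 - (colored v w' u c0)%:R)| * 1)); first by apply: ler_wpM2l.
rewrite mulr1 ler_norml; case: (colored v w u c0); case: (colored v w' u c0);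
  rewrite /= ?mulr1n ?mulr0n; apply/andP; split; lra.
Qed.

Lemma new_Theta_lipschitz v c0 (w w' : Om) : (forall i : V * C, i.2 != c0 -> w i = w' i) ->
  `|new_Theta v w - new_Theta v w'| <= oscillation v c0 w + oscillation v c0 w'.
Proof.
move=> h; rewrite /new_Theta -sumrB; apply: le_trans (ler_norm_sum _ _ _) _.
have same c : c != c0 -> forall i, i \in block col c -> w i = w' i.
  by move=> cc i; rewrite inE => /eqP ic; apply: h; rewrite ic.
rewrite (bigD1 c0) //=.
pose z u : R := (colored v w u c0)%:R + (colored v w' u c0)%:R.
have z0 u : 0 <= z u by rewrite addr_ge0.
have direct : `|old_pair_sum v w c0 + new_pair_sum v w c0 + triple_sum v w c0 -
    (old_pair_sum v w' c0 + new_pair_sum v w' c0 + triple_sum v w' c0)| <= direct_bound * (supp v c0)%:R.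
  have /andP[a1 a2] := old_pair_sum_bound v w c0; have /andP[a3 a4] := new_pair_sum_bound v w c0.
  have /andP[a5 a6] := triple_sum_bound v w c0.
  have /andP[a1' a2'] := old_pair_sum_bound v w' c0; have /andP[a3' a4'] := new_pair_sum_bound v w' c0.
  have /andP[a5' a6'] := triple_sum_bound v w' c0.
  rewrite ler_norml /direct_bound !mulrDl; apply/andP; split; lra.
have indirect : \sum_(c | c != c0) `|old_pair_sum v w c + new_pair_sum v w c + triple_sum v w c -
    (old_pair_sum v w' c + new_pair_sum v w' c + triple_sum v w' c)| <= \sum_u z u * influence v u.
  apply: (@le_trans _ _ (\sum_c (ph ^+ 2 * (\sum_u ((supp v c && Q c v u)%:R * z u)) +
      4%:R * ph ^+ 3 * (\sum_x \sum_y (supp v c)%:R * ((T v x y)%:R * z x))))).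
    rewrite [leLHS]big_mkcond /=; apply: ler_sum => c _.
    case: ifP => cc; last first.
      apply: addr_ge0; first by apply: mulr_ge0; rewrite ?sqr_ge0 // sumr_ge0 // => u _; apply: mulr_ge0.
      apply: mulr_ge0; first by apply: mulr_ge0; rewrite // exprn_ge0.
      by apply: sumr_ge0 => x _; apply: sumr_ge0 => y _; rewrite !mulr_ge0.
    have sw := same _ cc.
    have sU x : U w x c = U w' x c by rewrite (@unblocked_block c x w w' sw).
    have sf : few_selected w v c = few_selected w' v c by apply: few_selected_block sw.
    have bd u : `|beta v w u c - beta v w' u c| <= z u.
      by apply: beta_diff => //; rewrite eq_sym.
    have e2 : new_pair_sum v w c = new_pair_sum v w' c.
      rewrite /new_pair_sum sU sf; congr (_ * _); apply: eq_bigr => u _; apply: eq_bigr => x _.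
      by rewrite sU (sw (x, c)) // inE.
    rewrite e2; set t1 := old_pair_sum _ _ _; set t1' := old_pair_sum _ _ _; set t2 := new_pair_sum _ _ _.
    set t3 := triple_sum _ _ _; set t3' := triple_sum _ _ _.
    rewrite (_ : t1 + t2 + t3 - (t1' + t2 + t3') = (t1 - t1') + (t3 - t3')); last by ring.
    apply: le_trans (ler_normD _ _) _; apply: lerD.
      have -> : t1 - t1' = \sum_u (new_weight v c * U w v c * (few_selected w v c)%:R * ((Q c v u)%:R * (new_weight u c * U w u c))) *
          (beta v w u c - beta v w' u c).
        rewrite /t1 /t1' /old_pair_sum -sU -sf !mulr_sumr -sumrB; apply: eq_bigr => u _.
        by rewrite -sU; ring.
      apply: le_trans (ler_norm_sum _ _ _) _; rewrite mulr_sumr; apply: ler_sum => u _.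
      rewrite normrM [leRHS]mulrA; apply: ler_pM => //.
      rewrite ger0_norm; last by rewrite !mulr_ge0 ?new_weight_ge0.
      case: (supp_or_0 v c) => [sv|[_ ->]]; last first.
        by rewrite !mul0r mulr_ge0 ?sqr_ge0.
      rewrite sv /= expr2; case: (Q c v u); last by rewrite !(mul0r, mulr0).
      rewrite mul1r mulr1; apply: ler_pM => //; first by rewrite mulr_ge0.
      by apply: le_trans (UU_le w v c v c); apply: ler_piMr; rewrite ?lern1 ?leq_b1.
    have -> : t3 - t3' = \sum_x \sum_y (4%:R * (new_weight v c * U w v c) * ((T v x y)%:R * (new_weight x c * U w x c * (new_weight y c * U w y c)))) *
        (beta v w x c - beta v w' x c).
      rewrite /t3 /t3' /triple_sum -sU !mulr_sumr -sumrB; apply: eq_bigr => x _.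
      rewrite !mulr_sumr -sumrB; apply: eq_bigr => y _.
      by rewrite -!sU; ring.
    apply: le_trans (ler_norm_sum _ _ _) _; rewrite mulr_sumr; apply: ler_sum => x _.
    apply: le_trans (ler_norm_sum _ _ _) _; rewrite mulr_sumr; apply: ler_sum => y _.
    rewrite normrM ![leRHS]mulrA; apply: ler_pM => //.
    rewrite ger0_norm; last by rewrite !mulr_ge0 ?new_weight_ge0.
    case: (supp_or_0 v c) => [sv|[_ ->]]; last first.
      by rewrite !(mul0r, mulr0) !mulr_ge0 ?exprn_ge0.
    rewrite sv /=; case: (T v x y); last by rewrite !(mul0r, mulr0).
    rewrite !mulr1n [leLHS](_ : _ = 4%:R * ((new_weight v c * U w v c) * ((new_weight x c * U w x c) * (new_weight y c * U w y c)))); last by ring.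
    rewrite [leRHS](_ : _ = 4%:R * (ph * (ph * ph))); last by ring.
    apply: ler_wpM2l => //; apply: ler_pM => //; first exact: mulr_ge0.
    exact: ler_pM.
  rewrite big_split /= -!mulr_sumr /influence.
  rewrite exchange_big /= [X in _ + _ * X]exchange_big /=.
  rewrite !mulr_sumr -big_split /=; apply: ler_sum => u _.
  rewrite mulrDr; apply: lerD.
    by rewrite -mulr_suml mulrA mulrC.
  rewrite exchange_big /=.
  rewrite (_ : z u * (4%:R * n * ph ^+ 3 * \sum_y (T v u y)%:R) =
     4%:R * ph ^+ 3 * (n * (\sum_y (T v u y)%:R) * z u)); last by ring.
  apply: ler_wpM2l; first by apply: mulr_ge0; rewrite // exprn_ge0.
  rewrite mulr_sumr mulr_suml; apply: ler_sum => y _.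
  by rewrite -mulr_suml -mulrA; apply: ler_wpM2r; rewrite ?list_size // mulr_ge0.
apply: le_trans (lerD direct indirect) _; rewrite /oscillation.
have -> : \sum_u z u * influence v u = \sum_u (colored v w u c0)%:R * influence v u + \sum_u (colored v w' u c0)%:R * influence v u.
  by rewrite -big_split; apply: eq_bigr => u _; rewrite /z mulrDl.
have : 0 <= direct_bound * (supp v c0)%:R by apply: le_trans direct; apply: normr_ge0.
lra.
Qed.

(** Here truncation pays off. If some [u] is colored with [c], selections of [c] elsewhere have
    total influence at most [b], and [u] itself adds at most [influence_bound]; without such a [u]
    the sum is 0. *)
Lemma sum_colored_le v w c : \sum_u (colored v w u c)%:R * influence v u <= b + influence_bound.
Proof.
case: (pickP (fun u => colored v w u c)) => [u hu|h]; last first.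
  rewrite big1 => [|u _]; last by rewrite h mul0r.
  apply: addr_ge0; first exact: ltW.
  exact: le_trans (influence_ge0 v v) (influence_le v v).
rewrite (bigD1 u) //= hu mul1r addrC; apply: lerD; last exact: influence_le.
have /and3P[_ _ hb] := hu; apply: le_trans hb.
apply: ler_sum => u' _; apply: ler_wpM2r; rewrite ?influence_ge0 //.
by rewrite ler_nat /colored; case: (w (u', c)) => //=; apply: leq_b1.
Qed.

Lemma oscillation_ge0 v c w : 0 <= oscillation v c w.
Proof.
apply: addr_ge0; last by apply: sumr_ge0 => u _; rewrite mulr_ge0 ?influence_ge0.
by have /andP[/le_trans h1 /h1] := old_pair_sum_bound v w c; have /andP[/le_trans h2 /h2] := new_pair_sum_bound v w c;
  have /andP[/le_trans h3 /h3] := triple_sum_bound v w c; rewrite /direct_bound !mulrDl => *; lra.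
Qed.

Let direct_bound_ge0 (v : V) : 0 <= direct_bound.
Proof.
rewrite /direct_bound; apply: addr_ge0; first by rewrite addr_ge0 // mulr_ge0 ?sqr_ge0.
by rewrite !mulr_ge0 ?exprn_ge0 ?(Dg_ge0 v).
Qed.

Lemma oscillation_le v c w : oscillation v c w <= direct_bound + (b + influence_bound).
Proof.
apply: lerD; last exact: sum_colored_le.
by rewrite ler_piMr ?(direct_bound_ge0 v) // lern1 leq_b1.
Qed.

Lemma oscillation_block v c : determined_by (block col c) (oscillation v c).
Proof.
by move=> w w' h; congr (_ + _); apply: eq_bigr => u _; rewrite (@colored_block v u c w w').
Qed.

Definition variance_bound := 2%:R * (direct_bound ^+ 2 * n) + 2%:R * ((b + influence_bound) * (alpha * (n * ph) * total_influence)).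

(** The square of the random part is at most its maximum times a linear majorant, the total
    influence of all selections of [c]. Summed over the colors, the majorant has a controlled
    expectation however many colors there are, since the weights at each vertex have sum at most
    [n * ph]. *)
Lemma oscillation_variance v : \sum_c EE (fun w => oscillation v c w ^+ 2) <= variance_bound.
Proof.
have bw0 : 0 <= b + influence_bound.
  by rewrite addr_ge0 //; [apply: ltW|apply: le_trans (influence_ge0 v v) (influence_le v v)].
apply: (@le_trans _ _ (\sum_c (2%:R * (direct_bound ^+ 2 * (supp v c)%:R) +
    2%:R * ((b + influence_bound) * \sum_u alpha * p u c * influence v u)))).
  apply: ler_sum => c _.
  apply: (@le_trans _ _ (EE (fun w => 2%:R * (direct_bound ^+ 2 * (supp v c)%:R) +
     2%:R * ((b + influence_bound) * \sum_u (w (u, c))%:R * influence v u)))); last first.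
    by rewrite expectD (expect_const mu_sum1) !expectZ expect_influence.
  apply: (ler_expect mu_ge0) => w; rewrite /oscillation.
  have h1 := sum_colored_le v w c.
  have h2 : \sum_u (colored v w u c)%:R * influence v u <= \sum_u (w (u, c))%:R * influence v u.
    apply: ler_sum => u _; apply: ler_wpM2r; rewrite ?influence_ge0 //.
    by rewrite ler_nat /colored; case: (w (u, c)) => //=; apply: leq_b1.
  have h0 : 0 <= \sum_u (colored v w u c)%:R * influence v u.
    by apply: sumr_ge0 => u _; rewrite mulr_ge0 ?influence_ge0.
  have h3 := ler_pM h0 h0 h1 h2.
  move: (\sum_u (colored v w u c)%:R * influence v u) (\sum_u (w (u, c))%:R * influence v u) h0 h1 h2 h3.
  move=> x y h0 h1 h2 h3.
  apply: (@le_trans _ _ (2%:R * (direct_bound * (supp v c)%:R) ^+ 2 + 2%:R * x ^+ 2)).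
    by have := sqr_ge0 (direct_bound * (supp v c)%:R - x); rewrite !expr2; lra.
  apply: lerD; last by rewrite expr2; lra.
  by rewrite exprMn -natrX; case: (supp v c).
rewrite big_split /= -!mulr_sumr; apply: lerD.
  by do 2 (apply: ler_wpM2l; rewrite ?sqr_ge0 //).
apply: ler_wpM2l => //; apply: ler_wpM2l => //.
rewrite exchange_big /=; apply: (@le_trans _ _ (\sum_u alpha * (n * ph) * influence v u)).
  apply: ler_sum => u _; rewrite -mulr_suml; apply: ler_wpM2r; rewrite ?influence_ge0 //.
  by rewrite -mulr_sumr; apply: ler_wpM2l => //; apply: sum_p_le.
rewrite -mulr_sumr; apply: ler_wpM2l; last exact: sum_influence.
by rewrite !mulr_ge0.
Qed.

Lemma new_Theta_tail v (s t : R) : 0 <= s -> s * (direct_bound + (b + influence_bound)) <= 1 / 4%:R ->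
  PP (fun w => EE (new_Theta v) + t < new_Theta v w) <= exp (8%:R * s ^+ 2 * variance_bound - s * t).
Proof.
move=> s0 hs.
apply: (@concentration _ _ _ mu col mu_ge0 mu_sum1 (oscillation v) (direct_bound + (b + influence_bound))) => //.
- exact: oscillation_ge0.
- exact: oscillation_le.
- exact: oscillation_block.
- by move=> c w w' h; apply: new_Theta_lipschitz.
- exact: oscillation_variance.
Qed.

(** * The entropy of the weights at a vertex *)

Variable Lam : R.
Hypothesis Lam_gt0 : 0 < Lam.
Hypothesis n_gt0 : 0 < n.
Hypothesis LamE : Lam = ln (ph * n).
Hypothesis p_min : forall v c, supp v c -> n^-1 <= p v c.

(** Scaled so that the minimal weight [1/n] counts in full and a weight at the cap counts nothing.
    At [z = 0] the factor [z] makes the default value of [ln (ph / z)] immaterial. *)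
Definition entropy_term (z : R) : R := z * ln (ph / z) / Lam.
Definition entropy v := \sum_c entropy_term (p v c).
Definition new_entropy v (w : Om) : R := \sum_c entropy_term (new_weight v c) * (U w v c * (few_selected w v c)%:R).

Lemma entropy_term0 : entropy_term 0 = 0. Proof. by rewrite /entropy_term !mul0r. Qed.

Lemma entropy_term_ge0 z : 0 <= z -> z <= ph -> 0 <= entropy_term z.
Proof.
rewrite le_eqVlt => /predU1P[<-|z0 zp]; first by rewrite entropy_term0.
apply: mulr_ge0; last by rewrite invr_ge0 ltW.
apply: mulr_ge0; first exact: ltW.
have -> : 0 = ln (1 : R) by rewrite ln_1.
by apply: ler_ln => //; rewrite ler_pdivlMr // mul1r.
Qed.

Lemma entropy_term_le z : n^-1 <= z -> entropy_term z <= z.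
Proof.
move=> nz; have z0 : 0 < z by apply: lt_le_trans nz; rewrite invr_gt0.
rewrite /entropy_term -mulrA; apply: ler_piMr; first exact: ltW.
rewrite ler_pdivrMr // mul1r LamE; apply: ler_ln; first by rewrite divr_gt0.
by apply: ler_wpM2l => //; rewrite -(invrK n) lef_pV2 // posrE invr_gt0.
Qed.

Lemma entropy_new_weight_bound v c : 0 <= entropy_term (new_weight v c) <= ph * (supp v c)%:R.
Proof.
rewrite entropy_term_ge0 ?new_weight_ge0 ?new_weight_le //=.
case: (supp_or_0 v c) => [sv|[_ ->]]; last by rewrite entropy_term0 mulr_ge0.
rewrite sv mulr1; have [q0|q0] := ltP 0 (new_weight v c).
  by apply: le_trans (new_weight_le v c); apply: entropy_term_le; apply: le_trans (p_min sv) (new_weight_ge q0).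
by rewrite (_ : new_weight v c = 0) ?entropy_term0 //; apply/eqP; rewrite eq_le q0 new_weight_ge0.
Qed.

(* Discarding a color above the cap costs nothing here, since [z * ln (ph / z)] is
   negative for [z > ph]. *)
Lemma entropy_new_weight_lower v c : entropy_term (p v c) - 2%:R * (p v c * block_rate p Q T alpha v c) / Lam <=
  entropy_term (new_weight v c) * pi v c.
Proof.
have li0 : 0 <= Lam^-1 by rewrite invr_ge0 ltW.
case: (supp_or_0 v c) => [sv|[-> ->]]; last by rewrite entropy_term0 !(mul0r, mulr0) subr0.
have pv : 0 < p v c := sv; have pip := pi_pos v c.
have lnpi : - (2%:R * block_rate p Q T alpha v c) <= ln (pi v c).
  rewrite -[leLHS]lnK; apply: ler_ln; first exact: exp_gt0.
  exact: (survival_lower Q p_ge0 p_le alpha_ge0 alpha_le ph_le' T_irr).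
have lnE : ln (ph / (p v c / pi v c)) = ln (ph / p v c) + ln (pi v c).
  by rewrite -lnM ?divr_gt0 // invf_div mulrA mulrAC.
set r := block_rate _ _ _ _ _ _ in lnpi *.
have -> : entropy_term (p v c) - 2%:R * (p v c * r) / Lam = (p v c * (ln (ph / p v c) - 2%:R * r)) / Lam.
  by rewrite /entropy_term; ring.
rewrite /new_weight; case: ifP => hz.
  have -> : entropy_term (p v c / pi v c) * pi v c = (p v c * (ln (ph / p v c) + ln (pi v c))) / Lam.
    rewrite /entropy_term lnE; field; rewrite !gt_eqF //=.
  apply: ler_wpM2r => //; apply: ler_wpM2l; first exact: ltW.
  lra.
rewrite entropy_term0 mul0r; apply: mulr_le0_ge0 => //; apply: mulr_ge0_le0; first exact: ltW.
have : ln (ph / (p v c / pi v c)) <= 0.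
  have -> : 0 = ln (1 : R) by rewrite ln_1.
  apply: ler_ln; first by rewrite !divr_gt0.
  by rewrite ler_pdivrMr ?divr_gt0 // mul1r ltW // ltNge hz.
rewrite lnE; lra.
Qed.

Lemma few_selected_antitone v c : antitone (fun w => (few_selected w v c)%:R).
Proof.
apply: antitone_indicator => w w' le; apply: le_trans.
apply: ler_sum => x _; apply: ler_sum => y _; apply: ler_wpM2l => //.
by rewrite ler_nat; have := le (x, c); case: (w (x, c)) => // ->.
Qed.

(** Survival of [c] and [few_selected] are both decreasing in the selections, so by Harris'
    inequality their joint probability is at least the product, although they depend on the same
    selections. *)
Lemma expect_new_entropy v (eta j : R) : 0 < Bd -> alpha * ph * Dg / Bd <= eta -> eta <= 1 ->
  j <= entropy v -> j <= 1 -> j - 2%:R * alpha * theta / Lam - eta <= EE (new_entropy v).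
Proof.
move=> Bd0 heta eta1 hj j1.
have eta0 : 0 <= eta.
  apply: le_trans heta; rewrite !mulr_ge0 ?(Dg_ge0 v) //; by rewrite invr_ge0 ltW.
have li0 : 0 <= Lam^-1 by rewrite invr_ge0 ltW.
apply: (@le_trans _ _ ((1 - eta) * \sum_c entropy_term (new_weight v c) * pi v c)); last first.
  rewrite mulr_sumr /new_entropy expect_sum; apply: ler_sum => c _.
  have /andP[g0 _] := entropy_new_weight_bound v c.
  rewrite expectZ mulrCA; apply: ler_wpM2l => //.
  apply: le_trans (harris mu_ge0 mu_sum1 (@unblocked_antitone _ _ _ _ _ _) (@few_selected_antitone _ _)).
  rewrite mulrC; apply: ler_wpM2l; first exact: ltW.
  by apply: le_trans (expect_few_selected v c Bd0); rewrite lerD2l lerN2.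
have h : j - 2%:R * (alpha * theta) / Lam <= \sum_c entropy_term (new_weight v c) * pi v c.
  apply: (@le_trans _ _ (entropy v - 2%:R * (alpha * theta) / Lam)); first by rewrite lerD2r.
  apply: (@le_trans _ _ (\sum_c (entropy_term (p v c) - 2%:R * (p v c * block_rate p Q T alpha v c) / Lam))).
    rewrite sumrB lerD2l lerN2 -mulr_suml -mulr_sumr; apply: ler_wpM2r => //.
    by apply: ler_wpM2l => //; apply: sum_block_rate.
  by apply: ler_sum => c _; apply: entropy_new_weight_lower.
have th0 : 0 <= 2%:R * (alpha * theta) / Lam.
  rewrite !mulr_ge0 //; apply: le_trans (Theta_le v); apply: sumr_ge0 => c _.
  by rewrite mulr_ge0 // addr_ge0 ?load_ge0 // mulr_ge0 ?load3_ge0.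
apply: le_trans (ler_wpM2l _ h); last by rewrite subr_ge0.
have -> : 2%:R * alpha * theta / Lam = 2%:R * (alpha * theta) / Lam by ring.
move: th0; move: (2%:R * (alpha * theta) / Lam) => x x0.
(* As [j <= 1] and [x >= 0], the factor [1 - eta] costs at most [eta]. *)
have : 0 <= eta * (1 - j) by rewrite mulr_ge0 // subr_ge0.
have : 0 <= eta * x by rewrite mulr_ge0.
by rewrite !(mulrBl, mulrBr); lra.
Qed.

(** A lower tail, obtained by applying [concentration] to the negated sum. A color affects only its
    own term here, so the increments are constants and no truncation is involved. *)
Lemma new_entropy_tail v (s t : R) : 0 <= s -> s * ph <= 1 / 4%:R ->
  PP (fun w => new_entropy v w < EE (new_entropy v) - t) <= exp (8%:R * s ^+ 2 * (ph ^+ 2 * n) - s * t).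
Proof.
move=> s0 hs.
have -> : PP (fun w => new_entropy v w < EE (new_entropy v) - t) =
    PP (fun w => EE (fun w => - new_entropy v w) + t < - new_entropy v w).
  by apply: eq_expect => w; rewrite expectN ltrNr opprD opprK.
apply: (@concentration _ _ _ mu col mu_ge0 mu_sum1 (fun c _ => ph * (supp v c)%:R) ph) => //.
- by move=> c _; apply: mulr_ge0.
- by move=> c _; rewrite ler_piMr // lern1 leq_b1.
- move=> c0 w w' h; rewrite opprK addrC /new_entropy -sumrB.
  rewrite (bigD1 c0) //= [X in _ + X]big1 ?addr0; last first.
    move=> c cc; have sw i : i \in block col c -> w i = w' i.
      by rewrite inE => /eqP ic; apply: h; rewrite ic.
    by rewrite (@unblocked_block c v w w' sw) (@few_selected_block c v w w' sw) subrr.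
  rewrite -mulrBr normrM; have /andP[g0 g1] := entropy_new_weight_bound v c0.
  rewrite (ger0_norm g0); apply: (@le_trans _ _ (entropy_term (new_weight v c0) * 1)).
    apply: ler_wpM2l => //; rewrite ler_norml -!natrM !mulnb.
    move: (unblocked Q T w v c0 && few_selected w v c0) (unblocked Q T w' v c0 && few_selected w' v c0).
    by move=> [] []; rewrite ?mulr1n ?mulr0n; apply/andP; split; lra.
  by rewrite mulr1; apply: le_trans g1 _; rewrite lerDl mulr_ge0.
apply: (@le_trans _ _ (\sum_c ph ^+ 2 * (supp v c)%:R)).
  apply: ler_sum => c _; rewrite (expect_const mu_sum1) exprMn -natrX.
  by case: (supp v c).
by rewrite -mulr_sumr; apply: ler_wpM2l; rewrite ?sqr_ge0.
Qed.

(** * Locality and simultaneous success of one step *)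

Variable nb : V -> {set V}.
Hypothesis nb_refl : forall v, v \in nb v.
Hypothesis nb_sym : forall u v, (u \in nb v) = (v \in nb u).
Hypothesis nbQ : forall c v u, Q c v u -> u \in nb v.
Hypothesis nbT : forall v x y, T v x y -> x \in nb v.

(** The outcome at [v] depends on selections within distance 2, because survival at a neighbor is
    decided by the neighbors of that neighbor. Dependent events thus lie within distance 4, whence
    the factor [m ^+ 4]. *)
Definition ball2 v : {set V} := \bigcup_(u in nb v) nb u.
Definition region v : {set V * C} := [set i | i.1 \in ball2 v].

Let nb_ball2 v u x : u \in nb v -> x \in nb u -> x \in ball2 v.
Proof. by move=> uv xu; apply/bigcupP; exists u. Qed.

Let unblocked_region v u c (w w' : Om) : u \in nb v ->
  (forall i, i \in region v -> w i = w' i) -> unblocked Q T w u c = unblocked Q T w' u c.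
Proof.
move=> uv h; apply: (unblocked_touched T_sym) => -[x c']; rewrite inE /= => /andP[_ hx].
apply: h; rewrite inE /=; apply: nb_ball2 uv _.
by case/orP: hx => [/nbQ //|/existsP[y] /nbT].
Qed.

Let few_selected_region v c (w w' : Om) :
  (forall i, i \in region v -> w i = w' i) -> few_selected w v c = few_selected w' v c.
Proof.
move=> h; rewrite /few_selected; congr (_ <= _); apply: eq_bigr => x _; apply: eq_bigr => y _.
case E: (T v x y); last by rewrite !mul0r.
by rewrite h // inE; apply: nb_ball2 (nbT E) (nb_refl x).
Qed.

Lemma new_entropy_region v : determined_by (region v) (new_entropy v).
Proof.
move=> w w' h; apply: eq_bigr => c _.
by rewrite (unblocked_region c (nb_refl v) h) (few_selected_region c h).
Qed.

Let influence0 v u : u \notin nb v -> influence v u = 0.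
Proof.
move=> uv; rewrite /influence !big1 ?mulr0 ?addr0 // => [y _|c _].
  by case E: (T v u y) => //; rewrite (nbT E) in uv.
by case E: (Q c v u); rewrite ?andbF //; rewrite (nbQ E) in uv.
Qed.

Let beta_region v u c (w w' : Om) : u \in nb v ->
  (forall i, i \in region v -> w i = w' i) -> beta v w u c = beta v w' u c.
Proof.
move=> uv h; apply: eq_bigr => c' _; congr (1 - (nat_of_bool _)%:R).
rewrite /colored (unblocked_region c' uv h) (h (u, c')); last first.
  by rewrite inE; apply: nb_ball2 uv (nb_refl u).
congr [&& _, _ & _]; rewrite /untruncated; congr (_ <= _); apply: eq_bigr => x _.
case: (boolP (x \in nb v)) => [xv|/influence0 ->]; last by rewrite !mulr0.
by rewrite h // inE; apply: nb_ball2 xv (nb_refl x).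
Qed.

Lemma new_Theta_region v : determined_by (region v) (new_Theta v).
Proof.
move=> w w' h; apply: eq_bigr => c _; congr (_ + _ + _).
- rewrite /old_pair_sum (unblocked_region c (nb_refl v) h) (few_selected_region c h); congr (_ * _).
  apply: eq_bigr => u _; case E: (Q c v u); last by rewrite !mul0r.
  by rewrite (unblocked_region c (nbQ E) h) (beta_region c (nbQ E) h).
- rewrite /new_pair_sum (unblocked_region c (nb_refl v) h) (few_selected_region c h); congr (_ * _).
  apply: eq_bigr => u _; apply: eq_bigr => x _; case E: (T v u x); last by rewrite !mul0r.
  rewrite (unblocked_region c (nbT E) h) (h (x, c)) // inE.
  by rewrite T_sym in E; apply: nb_ball2 (nbT E) (nb_refl x).
rewrite /triple_sum (unblocked_region c (nb_refl v) h); congr (_ * _).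
apply: eq_bigr => x _; apply: eq_bigr => y _; case E: (T v x y); last by rewrite !mul0r.
rewrite (unblocked_region c (nbT E) h) (beta_region c (nbT E) h).
by rewrite T_sym in E; rewrite (unblocked_region c (nbT E) h).
Qed.

Lemma card_bigcup_le (A : {set V}) (F : V -> {set V}) :
  (#|\bigcup_(u in A) F u| <= \sum_(u in A) #|F u|)%N.
Proof.
elim/big_rec2: _ => [|u m B _ h]; first by rewrite cards0.
by apply: leq_trans (leq_card_setU _ _) _; rewrite leq_add2l.
Qed.

Theorem nibble_step (blank : pred V) (m s t eta j j' theta' : R) :
  (forall v, #|nb v|%:R <= m) ->
  0 < Bd -> alpha * ph * Dg / Bd <= eta -> eta <= 1 -> j <= 1 ->
  (forall v, blank v -> j <= entropy v) ->
  0 <= s -> s * (direct_bound + (b + influence_bound)) <= 1 / 4%:R -> s * ph <= 1 / 4%:R ->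
  m ^+ 4 * (exp (8%:R * s ^+ 2 * variance_bound - s * t) + exp (8%:R * s ^+ 2 * (ph ^+ 2 * n) - s * t)) <= 1 / 4%:R ->
  j' <= j - 2%:R * alpha * theta / Lam - eta - t ->
  kappa ^+ 3 * ((1 - alpha / 4%:R) * theta) + t <= theta' ->
  exists2 w : Om, forall v c, w (v, c) -> 0 < p v c &
    forall v, blank v -> j' <= new_entropy v w /\ new_Theta v w <= theta'.
Proof.
move=> hm Bd0 heta eta1 j1 hj s0 hs1 hs2 hP hj' hth'.
pose bad v w := blank v && ((new_entropy v w < j') || (theta' < new_Theta v w)).
pose eps := exp (8%:R * s ^+ 2 * variance_bound - s * t) + exp (8%:R * s ^+ 2 * (ph ^+ 2 * n) - s * t).
have eps0 : 0 <= eps by rewrite addr_ge0 ?exp_ge0.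
have bad_le v : PP (bad v) <= eps.
  rewrite /bad; case: (boolP (blank v)) => [bv|_]; last first.
    by rewrite (_ : PP _ = 0) //; apply: (expect_const mu_sum1).
  apply: (@le_trans _ _ (PP (fun w => EE (new_Theta v) + t < new_Theta v w) +
     PP (fun w => new_entropy v w < EE (new_entropy v) - t))); last first.
    by apply: lerD; [apply: new_Theta_tail|apply: new_entropy_tail].
  rewrite -expectD; apply: (ler_expect mu_ge0) => w; rewrite andTb.
  have h1 : theta' < new_Theta v w -> EE (new_Theta v) + t < new_Theta v w.
    apply: le_lt_trans; apply: le_trans hth'; rewrite lerD2r.
    apply: le_trans (expect_new_Theta v) _; apply: ler_wpM2l; first exact: kappaX_ge0.
    by apply: ler_wpM2l; rewrite ?Theta_le //; have := alpha_le; lra.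
  have h2 : new_entropy v w < j' -> new_entropy v w < EE (new_entropy v) - t.
    move/lt_le_trans; apply; apply: le_trans hj' _; rewrite lerD2r.
    by apply: expect_new_entropy => //; apply: hj.
  case: (ltP (new_entropy v w) j') => [/h2 ->|_]; first by rewrite lerDr ler0n.
  case: (ltP theta' (new_Theta v w)) => [/h1 ->|_]; first by rewrite lerDl ler0n.
  by apply: addr_ge0.
have small v : \sum_(k | (k == v) || ~~ [disjoint region k & region v]) PP (bad k) <= 1 / 4%:R.
  apply: le_trans hP; rewrite -/eps.
  pose far := \bigcup_(x in ball2 v) ball2 x.
  apply: (@le_trans _ _ (\sum_(k in far) eps)).
    rewrite [leLHS]big_mkcond [leRHS]big_mkcond; apply: ler_sum => k _.
    case: ifP => [hk|_]; last by case: ifP.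
    suff -> : k \in far by [].
    have ball_refl u : u \in ball2 u by apply: nb_ball2 (nb_refl u) (nb_refl u).
    case/orP: hk => [/eqP ->|]; first by apply/bigcupP; exists v.
    rewrite -setI_eq0 => /set0Pn [[x c]]; rewrite !inE /= => /andP[xk xv].
    apply/bigcupP; exists x => //; case/bigcupP: xk => y yk xy.
    by apply: (@nb_ball2 _ y); rewrite nb_sym.
  rewrite sumr_const -[leLHS]mulr_natl; apply: ler_wpM2r => //.
  have sq v' : #|ball2 v'|%:R <= m ^+ 2.
    apply: (@le_trans _ _ (\sum_(u in nb v') m)).
      apply: (@le_trans _ _ (\sum_(u in nb v') #|nb u|)%N%:R); first by rewrite ler_nat card_bigcup_le.
      by rewrite natr_sum; apply: ler_sum.
    rewrite sumr_const -[leLHS]mulr_natl expr2; apply: ler_wpM2r => //.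
    by apply: le_trans (hm v').
  apply: (@le_trans _ _ (\sum_(u in ball2 v) m ^+ 2)).
    apply: (@le_trans _ _ (\sum_(u in ball2 v) #|ball2 u|)%N%:R); first by rewrite ler_nat card_bigcup_le.
    by rewrite natr_sum; apply: ler_sum.
  rewrite sumr_const -[leLHS]mulr_natl (_ : m ^+ 4 = m ^+ 2 * m ^+ 2); last by ring.
  by apply: ler_wpM2r => //; apply: sqr_ge0.
have det v : determined_by (region v) (bad v).
  by move=> w w' h; rewrite /bad (new_entropy_region h) (new_Theta_region h).
have [w pw hw] := local_lemma mu_ge0 mu_sum1 det small.
exists w.
  (* An outcome of positive weight contains no selection whose probability [alpha * p v c] is 0. *)
  move=> v c wvc; move: pw; rewrite /prob (bigD1 (v, c)) //= wvc /law /= => h.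
  rewrite lt_neqAle p_ge0 andbT; apply: contraTneq h => <-.
  by rewrite mulr0 mul0r ltxx.
move=> v bv; move: (hw v); rewrite /bad bv andTb negb_or -!leNgt => /andP[h1 h2].
by split.
Qed.

End Step.

(** * Partial colorings of triangle-free hypergraphs *)

Section Hypergraph.
Variables (V C : finType) (E : {set {set V}}) (Lst : V -> {set C}).
Hypothesis tri_free : triangle_free E.
Hypothesis edge_size : forall e, e \in E -> (#|e| == 2%N) || (#|e| == 3%N).

Definition triple v x y : bool := [&& v != x, v != y, x != y & [set v; x; y] \in E].

(** The relation depends on the color because an edge of size 3 acts as a pair in the color [c] once
    its third vertex has received [c]. *)
Definition conflict (cl : V -> option C) (c : C) : rel V := fun v u =>
  (v != u) && (([set v; u] \in E) || [exists x, (cl x == Some c) && triple v u x]).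

Definition nbhd v : {set V} := [set u | (u == v) || [exists e in E, (v \in e) && (u \in e)]].

Lemma triple_sym v x y : triple v x y = triple v y x.
Proof. by rewrite /triple setUAC [y == x]eq_sym; case: (v != x); case: (v != y). Qed.

Lemma triple_rot v x y : triple v x y = triple x v y.
Proof.
by rewrite /triple [x == v]eq_sym [[set x; v]]setUC; case: (v != x); case: (v != y); case: (x != y).
Qed.

Lemma triple_irr v x : ~~ triple v x x.
Proof. by rewrite /triple eqxx /= !andbF. Qed.

Lemma triple_irr1 v x : ~~ triple v v x.
Proof. by rewrite /triple eqxx. Qed.

Lemma conflict_irr cl c v : ~~ conflict cl c v v.
Proof. by rewrite /conflict eqxx. Qed.

Lemma conflict_sym cl c v u : conflict cl c v u = conflict cl c u v.
Proof.
rewrite /conflict eq_sym setUC; congr (_ && (_ || _)); apply: eq_existsb => x.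
by rewrite triple_rot.
Qed.

Lemma nbhd_refl v : v \in nbhd v.
Proof. by rewrite inE eqxx. Qed.

Lemma nbhd_sym u v : (u \in nbhd v) = (v \in nbhd u).
Proof.
rewrite !inE eq_sym; congr (_ || _); apply: eq_existsb => e.
by rewrite [(v \in e) && _]andbC.
Qed.

Lemma nbhd_edge (e : {set V}) u v : e \in E -> v \in e -> u \in e -> u \in nbhd v.
Proof.
by move=> eE ve ue; rewrite inE; apply/orP; right; apply/exists_inP; exists e; rewrite // ve ue.
Qed.

Lemma triple_nbhd v x y : triple v x y -> x \in nbhd v.
Proof. by case/and4P => _ _ _ /nbhd_edge; apply; rewrite !inE eqxx ?orbT. Qed.

Lemma conflict_nbhd cl c v u : conflict cl c v u -> u \in nbhd v.
Proof.
case/andP => _ /orP[/nbhd_edge|/existsP[x /andP[_ /triple_nbhd //]]].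
by apply; rewrite !inE eqxx ?orbT.
Qed.

Lemma edge_cases (e : {set V}) v x : e \in E -> v \in e -> x \in e -> x != v ->
  e = [set v; x] \/ exists2 y, e = [set v; x; y] & triple v x y.
Proof.
move=> eE ve xe xv.
have card : (#|e| = (#|e :\ v :\ x|).+2)%N.
  by rewrite (cardsD1 v e) ve (cardsD1 x (e :\ v)) !inE xv xe.
have eU : e = [set v; x] :|: (e :\ v :\ x).
  apply/setP => z; rewrite !inE; case: (eqVneq z v) => [->|] //=.
  by case: (eqVneq z x) => [->|].
have /orP[] := edge_size eE; rewrite card.
  by rewrite eqSS eqSS cards_eq0 => /eqP e0; left; rewrite eU e0 setU0.
rewrite !eqSS => /cards1P [y ey]; right; exists y; first by rewrite -ey.
have : y \in e :\ v :\ x by rewrite ey inE.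
rewrite !inE => /and3P[yx yv _].
by rewrite /triple eq_sym xv eq_sym yv eq_sym yx -ey -eU.
Qed.

(** A positive weight certifies that the vertex is blank and that no edge has all its other vertices
    already in that color ([st_alive]). Colored vertices have weight 0, so [st_Theta] can be
    required everywhere, but [st_entropy] only at blank vertices. *)
Record state (n ph Lam j theta D : R) (cl : V -> option C) (p : V -> C -> R) : Prop := State {
  st_list : forall v c, cl v = Some c -> c \in Lst v;
  st_proper : forall e c, e \in E -> ~~ [forall x in e, cl x == Some c];
  st_blank : forall v c, 0 < p v c -> cl v = None;
  st_inlist : forall v c, 0 < p v c -> c \in Lst v;
  st_alive : forall v c e, 0 < p v c -> e \in E -> v \in e ->
    ~~ [forall x in e, (x == v) || (cl x == Some c)];
  st_ge0 : forall v c, 0 <= p v c;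
  st_le : forall v c, p v c <= ph;
  st_min : forall v c, 0 < p v c -> n^-1 <= p v c;
  st_deg : forall v c, 0 < p v c -> \sum_u (conflict cl c v u)%:R <= D;
  st_entropy : forall v, cl v = None -> j <= entropy p ph Lam v;
  st_Theta : forall v, Theta p (conflict cl) triple v <= theta }.

(** The edge joining [v] to [x] avoids [u]: its third vertex, if there is one, is either colored,
    whereas [u] is blank, or lies outside [e]. *)
Lemma touch_edge cl (e : {set V}) c u v x : u \in e -> v \in e -> u != v -> cl u = None -> x \notin e ->
  conflict cl c v x || [exists y, (y \notin e) && triple v x y] ->
  exists f : {set V}, [/\ f \in E, v \in f, x \in f & u \notin f].
Proof.
move=> ue ve uv clu xe.
have ux : u != x by apply: contraNneq xe => <-.
case/orP => [/andP[vx /orP[vxE|/existsP[z /andP[/eqP clz]]]]|/existsP[y /andP[ye]]].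
- by exists [set v; x]; rewrite !inE !eqxx ?orbT (negPf uv) (negPf ux).
- case/and4P => _ _ _ vxzE; exists [set v; x; z]; rewrite !inE !eqxx ?orbT (negPf uv) (negPf ux) /=.
  by split=> //; apply: contra_eqN clu => /eqP ->; rewrite clz.
case/and4P => _ _ _ vxyE; exists [set v; x; y]; rewrite !inE !eqxx ?orbT (negPf uv) (negPf ux) /=.
by split=> //; apply: contraNneq ye => <-.
Qed.

(* If the dependence sets of [u] and [v] off the edge [e] met in [x], then [e] and
   the edges through [v x] and [u x] would form a triangle. *)
Lemma touched_off_disjoint cl (e : {set V}) c u v : e \in E -> u \in e -> v \in e -> u != v ->
  cl u = None -> cl v = None ->
  [disjoint touched_off (conflict cl) triple e c u & touched_off (conflict cl) triple e c v].
Proof.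
move=> eE ue ve uv clu clv; rewrite -setI_eq0; apply/eqP/setP => -[x c']; rewrite !inE /=.
apply/negbTE/negP => /andP[/and3P[_ xe tu] /and3P[_ _ tv]].
have [f [fE vf xf uf]] := touch_edge ue ve uv clu xe tv.
have vu : v != u by rewrite eq_sym.
have [g [gE ug xg vg]] := touch_edge ve ue vu clv xe tu.
have vx : v != x by apply: contraNneq xe => <-.
have xu : x != u by apply: contraNneq xe => ->.
have /negP := tri_free u v x e f g; apply; rewrite /is_triangle uv vx xu eE fE gE ue ve vf xf xg ug.
have -> : e != f by apply: contraNneq uf => <-.
have -> : f != g by apply: contraNneq vg => <-.
have -> : g != e by apply: contraNneq vg => ->.
rewrite /=; apply/eqP/setP => z; rewrite !inE; apply/negbTE/negP.
by case/andP => /andP[/andP[/orP[/orP[]|] /eqP -> ze zf] zg];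
  [rewrite zf in uf|rewrite zg in vg|rewrite ze in xe].
Qed.

Section OneStep.
Variables (n ph Lam j theta D : R) (cl : V -> option C) (p : V -> C -> R).
Hypothesis st : state n ph Lam j theta D cl p.
Variables (alpha Dg cod Bd b m s t eta j' theta' : R).
Hypothesis alpha_gt0 : 0 < alpha.
Hypothesis alpha_le : alpha <= 1 / 10%:R.
Hypothesis ph_gt0 : 0 < ph.
Hypothesis ph_le : ph <= 1 / 100%:R.
Hypothesis D_ge0 : 0 <= D.
Hypothesis n_gt0 : 0 < n.
Hypothesis degree3 : forall v, \sum_x \sum_y (triple v x y)%:R <= Dg.
Hypothesis codegree : forall v u, \sum_y (triple v u y)%:R <= cod.
Hypothesis list_size : forall v, #|Lst v|%:R <= n.
Hypothesis b_gt0 : 0 < b.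
Hypothesis truncation : alpha * ph * total_influence ph n D Dg <= b / 20%:R.
Hypothesis Bd_gt0 : 0 < Bd.
Hypothesis alpha_theta : alpha * theta <= 1 / 20%:R.
Hypothesis j_ge : 13%:R / 20%:R <= j.
Hypothesis j_le1 : j <= 1.
Hypothesis Lam_gt0 : 0 < Lam.
Hypothesis LamE : Lam = ln (ph * n).

Notation Q := (conflict cl).
Notation Om := {ffun V * C -> bool}.
Notation new_weight := (new_weight p Q triple alpha ph).
Notation few_selected := (few_selected triple Bd).

Let alpha_ge0 : 0 <= alpha. Proof. exact: ltW. Qed.
Let p_ge0 := st_ge0 st.
Let p_le := st_le st.
Let new_weight_ge0' := new_weight_ge0 Q p_ge0 p_le alpha_ge0 alpha_le ph_le triple_irr.

Definition color_step (w : Om) v : option C :=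
  if cl v is Some c then Some c else [pick c | w (v, c) && unblocked Q triple w v c].
Definition weight_step (w : Om) v c : R :=
  if color_step w v is Some _ then 0
  else new_weight v c * ((unblocked Q triple w v c)%:R * (few_selected w v c)%:R).

Lemma entropy_le_mass v : entropy p ph Lam v <= \sum_c p v c.
Proof.
apply: ler_sum => c _; have [pv|pv] := ltP 0 (p v c).
  by have := st_min st pv; move=> /(entropy_term_le ph_gt0 Lam_gt0 n_gt0 LamE).
have -> : p v c = 0 by apply/eqP; rewrite eq_le pv p_ge0.
by rewrite entropy_term0.
Qed.

Lemma supp_size v : \sum_c (supp p v c)%:R <= n.
Proof.
apply: le_trans (list_size v); rewrite -sum1_card natr_sum [leRHS]big_mkcond /=.
apply: ler_sum => c _; case sv: (supp p v c); last by case: ifP.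
by rewrite (st_inlist st sv).
Qed.

Section Outcome.
Variable w : Om.
Hypothesis w_supp : forall v c, w (v, c) -> 0 < p v c.

Lemma color_stepP v c : color_step w v = Some c ->
  cl v = Some c \/ [/\ cl v = None, w (v, c) & unblocked Q triple w v c].
Proof.
rewrite /color_step; case cv: (cl v) => [d|]; first by left.
by case: pickP => // d /andP[wd ud] [<-]; right.
Qed.

(** Preservation of [st_alive]. Otherwise some other vertex [x] of [e] was not colored [c] before
    and selected [c] in this step; then [c] would be blocked at [v] through a pair, or through a
    triple if the third vertex was colored in this step as well. *)
Lemma unblocked_alive v c (e : {set V}) : 0 < p v c -> unblocked Q triple w v c -> e \in E -> v \in e ->
  ~~ [forall x in e, (x == v) || (color_step w x == Some c)].
Proof.
move=> pv /unblockedP [u1 u2] eE ve; apply/negP => /forall_inP h.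
have /forallPn [x] := st_alive st pv eE ve.
rewrite negb_imply negb_or => /and3P[xe xv clx].
have sel y : y \in e -> y != v -> cl y != Some c -> w (y, c).
  move=> ye yv cly; have := h y ye; rewrite (negPf yv) /= => /eqP /color_stepP [] //.
    by move=> cy; rewrite cy eqxx in cly.
  by case.
have wx := sel x xe xv clx.
have [eE2|[y eE3 Tvxy]] := edge_cases eE ve xe xv.
  by have := u1 x; rewrite wx /conflict eq_sym xv -eE2 eE => /(_ isT).
have ye : y \in e by rewrite eE3 !inE eqxx !orbT.
have yv : y != v by case/and4P: Tvxy => _; rewrite eq_sym.
have [cy|cy] := eqVneq (cl y) (Some c).
  have := u1 x; rewrite wx /conflict eq_sym xv /=.
  have -> : [exists x0, (cl x0 == Some c) && triple v x x0].
    by apply/existsP; exists y; rewrite cy eqxx.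
  by rewrite orbT => /(_ isT).
by have := u2 x y Tvxy; rewrite wx (sel y ye yv cy).
Qed.

(** A newly monochromatic edge has a vertex colored in this step, and the color survived there,
    against [unblocked_alive]. *)
Lemma color_step_proper e c : e \in E -> ~~ [forall x in e, color_step w x == Some c].
Proof.
move=> eE; apply/negP => /forall_inP h.
have /forallPn [v] := st_proper st c eE; rewrite negb_imply => /andP[ve clv].
have /color_stepP [cv|[_ wv uv]] := eqP (h v ve); first by rewrite cv eqxx in clv.
have /negP := unblocked_alive (w_supp wv) uv eE ve; apply.
by apply/forall_inP => x xe; rewrite h ?orbT.
Qed.

Lemma weight_step_supp v c : 0 < weight_step w v c ->
  [/\ color_step w v = None, 0 < new_weight v c, unblocked Q triple w v c & few_selected w v c].
Proof.
rewrite /weight_step; case: (color_step w v) => [d|]; first by rewrite ltxx.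
case: (unblocked _ _ _ _ _); last by rewrite mul0r mulr0 ltxx.
case: (few_selected _ _ _); last by rewrite !mulr0 ltxx.
by rewrite !mulr1.
Qed.

Lemma weight_step_ge0 v c : 0 <= weight_step w v c.
Proof.
rewrite /weight_step; case: (color_step w v) => // .
by apply: mulr_ge0; [apply: new_weight_ge0'|rewrite mulr_ge0].
Qed.

Lemma weight_step_le v c :
  weight_step w v c <= new_weight v c * (unblocked Q triple w v c)%:R * (few_selected w v c)%:R.
Proof.
rewrite -mulrA /weight_step; case: (color_step w v) => // _.
by apply: mulr_ge0; [apply: new_weight_ge0'|rewrite mulr_ge0].
Qed.

Lemma weight_step_le' v c : weight_step w v c <= new_weight v c * (unblocked Q triple w v c)%:R.
Proof.
apply: le_trans (weight_step_le v c) _; apply: ler_piMr; last by rewrite lern1 leq_b1.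
by apply: mulr_ge0; [apply: new_weight_ge0'|].
Qed.

(** If [u] gets a color, its weight is 0; if not, none of its selected colors survived and every
    factor of [beta] equals 1. *)
Lemma weight_step_beta v u c : weight_step w u c <=
  new_weight u c * (unblocked Q triple w u c)%:R * beta p Q triple ph n b v w u c.
Proof.
have /andP[b0 b1] := @beta01 _ _ p Q triple ph n b v w u c.
case cu: (color_step w u) => [d|].
  rewrite {1}/weight_step cu mulr_ge0 // mulr_ge0 //; exact: new_weight_ge0'.
suff -> : beta p Q triple ph n b v w u c = 1 by rewrite mulr1 weight_step_le'.
rewrite /beta big1 // => c' _; rewrite /colored.
case wc: (w (u, c')) => /=; last by rewrite subr0.
case uc: (unblocked _ _ _ _ _) => /=; last by rewrite subr0.
move: cu; rewrite /color_step (st_blank st (w_supp wc)); case: pickP => // /(_ c').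
by rewrite wc uc.
Qed.

(** A conflict can be new only through a triple whose third vertex has just selected [c]. *)
Lemma conflict_step c v u : (conflict (color_step w) c v u)%:R <=
  (Q c v u)%:R + \sum_x (triple v u x)%:R * (w (x, c))%:R :> R.
Proof.
have s0 : 0 <= \sum_x (triple v u x)%:R * (w (x, c))%:R :> R.
  by apply: sumr_ge0 => x _; apply: mulr_ge0.
case cvu: (conflict (color_step w) c v u) => /=; last by rewrite addr_ge0.
case: (boolP (Q c v u)) => [_|nQ]; first by rewrite lerDl.
rewrite add0r; case/andP: cvu => vu /orP[vuE|/existsP[x /andP[/eqP cx Tx]]].
  by rewrite /conflict vu vuE in nQ.
case: (color_stepP cx) => [clx|[_ wx _]]; last first.
  rewrite (bigD1 x) //= Tx wx mulr1 lerDl; apply: sumr_ge0 => y _; exact: mulr_ge0.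
case/negP: nQ; rewrite /conflict vu; apply/orP; right; apply/existsP; exists x.
by rewrite clx eqxx.
Qed.

Lemma Theta_step v : Theta (weight_step w) (conflict (color_step w)) triple v <=
  new_Theta p Q triple alpha ph n Bd b v w.
Proof.
have ws0 := weight_step_ge0.
have qU0 u c : 0 <= new_weight u c * (unblocked Q triple w u c)%:R by apply: mulr_ge0; [apply: new_weight_ge0'|].
apply: ler_sum => c _; rewrite mulrDr; apply: lerD.
  apply: (@le_trans _ _ (weight_step w v c * \sum_u ((Q c v u)%:R * weight_step w u c +
     (\sum_x (triple v u x)%:R * (w (x, c))%:R) * weight_step w u c))).
    by apply: ler_wpM2l => //; apply: ler_sum => u _; rewrite -mulrDl; apply: ler_wpM2r => //; apply: conflict_step.
  rewrite big_split /= mulrDr; apply: lerD; apply: ler_pM.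
  - exact: ws0.
  - by apply: sumr_ge0 => u _; apply: mulr_ge0.
  - exact: weight_step_le.
  - by apply: ler_sum => u _; apply: ler_wpM2l => //; apply: weight_step_beta.
  - exact: ws0.
  - by apply: sumr_ge0 => u _; apply: mulr_ge0 => //; apply: sumr_ge0 => x _; apply: mulr_ge0.
  - exact: weight_step_le.
  apply: ler_sum => u _; rewrite mulr_suml; apply: ler_sum => x _.
  rewrite -mulrA; apply: ler_wpM2l => //; apply: ler_wpM2l => //; exact: weight_step_le'.
rewrite mulrCA /triple_sum -mulrA; apply: ler_wpM2l => //; apply: ler_pM => //.
- by apply: sumr_ge0 => x _; apply: sumr_ge0 => y _; rewrite !mulr_ge0.
- exact: weight_step_le'.
apply: ler_sum => x _; apply: ler_sum => y _; apply: ler_wpM2l => //.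
rewrite [leRHS]mulrAC; apply: ler_pM => //; first exact: weight_step_beta.
exact: weight_step_le'.
Qed.

Lemma entropy_step v : color_step w v = None -> entropy (weight_step w) ph Lam v =
  new_entropy p Q triple alpha ph Bd Lam v w.
Proof.
move=> cv; apply: eq_bigr => c _; rewrite /weight_step cv.
case: (unblocked _ _ _ _ _); last by rewrite !mul0r !mulr0 entropy_term0.
by case: (few_selected _ _ _); rewrite ?mulr1 // !mulr0 entropy_term0.
Qed.

Lemma degree_step v c : 0 < weight_step w v c ->
  \sum_u (conflict (color_step w) c v u)%:R <= D + Bd.
Proof.
case/weight_step_supp => _ /(new_weight_pos p_ge0 p_le alpha_ge0 alpha_le ph_le triple_irr) pv _ hf.
apply: le_trans (ler_sum _ (fun u _ => conflict_step c v u)) _.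
rewrite big_split /=; apply: lerD; first by have := st_deg st pv.
apply: le_trans hf; rewrite exchange_big /=; apply: ler_sum => x _; apply: ler_sum => u _.
by rewrite triple_sym.
Qed.

End Outcome.

Lemma near_pair c v u : Q c v u -> supp p v c -> supp p u c ->
  exists2 e : {set V}, (#|e| <= 3)%N &
    [disjoint touched_off Q triple e c u & touched_off Q triple e c v].
Proof.
move=> /andP[vu hQ] sv su; have clv := st_blank st sv; have clu := st_blank st su.
have [e [eE ve ue]] : exists e, [/\ e \in E, v \in e & u \in e].
  case/orP: hQ => [vuE|/existsP[x /andP[_ /and4P[_ _ _ vuxE]]]].
    by exists [set v; u]; rewrite !inE !eqxx ?orbT.
  by exists [set v; u; x]; rewrite !inE !eqxx ?orbT.
exists e; first by case/orP: (edge_size eE) => /eqP ->.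
by apply: touched_off_disjoint => //; rewrite eq_sym.
Qed.

Lemma near_triple c v x y : triple v x y -> supp p v c -> supp p x c -> supp p y c ->
  exists2 e : {set V}, (#|e| <= 3)%N /\ [/\ v \in e, x \in e & y \in e] &
  [/\ [disjoint touched_off Q triple e c x & touched_off Q triple e c v],
      [disjoint touched_off Q triple e c x & touched_off Q triple e c y] &
      [disjoint touched_off Q triple e c v & touched_off Q triple e c y]].
Proof.
move=> /and4P[vx vy xy eE] /(st_blank st) clv /(st_blank st) clx /(st_blank st) cly.
exists [set v; x; y].
  by rewrite !inE !eqxx ?orbT; split=> //; case/orP: (edge_size eE) => /eqP ->.
by split; apply: touched_off_disjoint => //; rewrite ?inE ?eqxx ?orbT // eq_sym.
Qed.

Lemma one_step :
  (forall v, #|nbhd v|%:R <= m) ->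
  alpha * ph * Dg / Bd <= eta -> eta <= 1 ->
  0 <= s -> s * (direct_bound ph D Dg Bd + (b + influence_bound ph n cod)) <= 1 / 4%:R -> s * ph <= 1 / 4%:R ->
  m ^+ 4 * (exp (8%:R * s ^+ 2 * variance_bound alpha ph n D Dg cod Bd b - s * t) +
            exp (8%:R * s ^+ 2 * (ph ^+ 2 * n) - s * t)) <= 1 / 4%:R ->
  j' <= j - 2%:R * alpha * theta / Lam - eta - t ->
  kappa alpha ph ^+ 3 * ((1 - alpha / 4%:R) * theta) + t <= theta' ->
  0 <= theta' ->
  exists cl' p', state n ph Lam j' theta' (D + Bd) cl' p'.
Proof.
move=> hm heta eta1 s0 hs1 hs2 hP hj' hth' th0'.
have mass u c : supp p u c -> 13%:R / 20%:R <= \sum_c0 p u c0.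
  move=> su; apply: le_trans (entropy_le_mass u); apply: le_trans j_ge _.
  exact: (st_entropy st (st_blank st su)).
have hJ v : cl v == None -> j <= entropy p ph Lam v by move/eqP/(st_entropy st).
have [w w_supp hw] := nibble_step p_ge0 p_le alpha_ge0 alpha_le ph_gt0 ph_le
  (conflict_irr cl) triple_sym triple_irr triple_irr1 D_ge0 (ltW n_gt0) (st_deg st) degree3 codegree
  supp_size b_gt0 truncation (ltW Bd_gt0) near_pair near_triple alpha_gt0 alpha_theta (st_Theta st)
  mass Lam_gt0 n_gt0 LamE (st_min st) nbhd_refl nbhd_sym (@conflict_nbhd cl) triple_nbhd
  hm Bd_gt0 heta eta1 j_le1 hJ s0 hs1 hs2 hP hj' hth'.
exists (color_step w), (weight_step w); split.
- move=> v c /(color_stepP)[/(st_list st) //|[_ /w_supp pv _]]; exact: (st_inlist st pv).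
- by move=> e c; apply: color_step_proper.
- by move=> v c /weight_step_supp[].
- move=> v c /weight_step_supp[_ /(new_weight_pos p_ge0 p_le alpha_ge0 alpha_le ph_le triple_irr) pv _ _].
  exact: (st_inlist st pv).
- move=> v c e /weight_step_supp[_ /(new_weight_pos p_ge0 p_le alpha_ge0 alpha_le ph_le triple_irr) pv uv _].
  exact: unblocked_alive.
- exact: weight_step_ge0.
- move=> v c; apply: le_trans (weight_step_le' w v c) _.
  apply: le_trans (new_weight_le p Q triple alpha ph_gt0 v c); apply: ler_piMr; last by rewrite lern1 leq_b1.
  exact: new_weight_ge0'.
- move=> v c h; have [cv q0 uv fv] := weight_step_supp h.
  have pv := new_weight_pos p_ge0 p_le alpha_ge0 alpha_le ph_le triple_irr q0.
  rewrite /weight_step cv uv fv !mulr1; apply: le_trans (st_min st pv) _.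
  exact: (new_weight_ge p_ge0 p_le alpha_ge0 alpha_le ph_le triple_irr q0).
- exact: degree_step.
- move=> v cv; rewrite entropy_step //; have clv : cl v = None.
    by move: cv; rewrite /color_step; case: (cl v).
  by case: (hw v); rewrite ?clv.
move=> v; case clv : (cl v) => [d|]; last first.
  apply: le_trans (Theta_step w_supp v) _; by case: (hw v); rewrite ?clv.
apply: le_trans th0'; rewrite /Theta big1 // => c _.
by rewrite /weight_step {1}/color_step clv mul0r.
Qed.

End OneStep.
End Hypergraph.

(** * Completing the coloring by one random choice per blank vertex *)

Section Finish.
Variables (V C : finType) (E : {set {set V}}) (Lst : V -> {set C}).
Hypothesis edge_size : forall e, e \in E -> (#|e| == 2%N) || (#|e| == 3%N).
Variables (n ph Lam j theta D : R) (cl : V -> option C) (p : V -> C -> R).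
Hypothesis st : state E Lst n ph Lam j theta D cl p.
Hypothesis ph_gt0 : 0 < ph.
Hypothesis n_gt0 : 0 < n.
Hypothesis j_ge : 13%:R / 20%:R <= j.
Hypothesis Lam_gt0 : 0 < Lam.
Hypothesis LamE : Lam = ln (ph * n).
Hypothesis theta_le : theta <= 1 / 96%:R.

Notation Q := (conflict E cl).
Notation T := (triple E).
Notation Om := {ffun V -> C}.

Let p_ge0 := st_ge0 st.

Let N v : R := \sum_c p v c.

Let N_ge v : cl v = None -> 13%:R / 20%:R <= N v.
Proof.
move=> cv; apply: le_trans j_ge _; apply: le_trans (st_entropy st cv) _.
exact: (entropy_le_mass st ph_gt0 n_gt0 Lam_gt0 LamE).
Qed.

Definition choice_law v c : R := if cl v is Some d then (c == d)%:R else p v c / N v.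

Let law_ge0 v c : 0 <= choice_law v c.
Proof.
rewrite /choice_law; case cv : (cl v) => [d|] //.
by rewrite divr_ge0 // sumr_ge0.
Qed.

Let law_sum1 v : \sum_c choice_law v c = 1.
Proof.
rewrite /choice_law; case cv : (cl v) => [d|].
  by rewrite (bigD1 d) //= eqxx big1 ?addr0 // => c /negPf ->.
rewrite -mulr_suml divff // gt_eqF //; apply: lt_le_trans (N_ge cv); lra.
Qed.

Notation PP := (pr choice_law).

Let law_le v c : cl v = None -> choice_law v c <= (20%:R / 13%:R) * p v c.
Proof.
move=> cv; rewrite /choice_law cv mulrC; apply: ler_wpM2r => //.
have -> : 20%:R / 13%:R = (13%:R / 20%:R)^-1 :> R by rewrite invf_div.
by rewrite lef_pV2 ?N_ge // posrE ?(lt_le_trans _ (N_ge cv)) //; lra.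
Qed.

Let expect_is v c : expect choice_law (fun w => (w v == c)%:R) = choice_law v c.
Proof.
rewrite (expect_at law_sum1 v (fun d => (d == c)%:R)) (bigD1 c) //= eqxx mulr1 big1 ?addr0 //.
by move=> d /negPf ->; rewrite mulr0.
Qed.

Let blank v := cl v == None.

(* Bad events are indexed by conflicts rather than by edges: many edges can produce the
   same conflict, which [Theta] counts only once. *)
Let event := ((C * (V * V)) + (C * (V * (V * V))))%type.

Let bad (k : event) (w : Om) : bool :=
  match k with
  | inl (c, (x, u)) => [&& Q c x u, blank x, blank u, w x == c & w u == c]
  | inr (c, (x, (y, z))) => [&& T x y z, blank x, blank y, blank z & [&& w x == c, w y == c & w z == c]]
  end.

Let verts (k : event) : {set V} :=
  match k with
  | inl (c, (x, u)) => [set x; u]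
  | inr (c, (x, (y, z))) => [set x; y; z]
  end.

Let bad_det k : determined_by (verts k) (bad k).
Proof.
case: k => [[c [x u]]|[c [x [y z]]]] w w' h; rewrite /bad.
  by rewrite (h x) ?(h u) // !inE eqxx ?orbT.
by rewrite (h x) ?(h y) ?(h z) // !inE eqxx ?orbT.
Qed.

Let det_is v c : determined_by [set v] (fun w : Om => (w v == c)%:R : R).
Proof. by move=> w w' h; rewrite h ?inE. Qed.

(** Normalizing weights of total at least [13/20] costs [20/13] per vertex; the square, and for
    triples the cube, of [20/13] is below 4. *)
Let bad2_le c x u : PP (bad (inl (c, (x, u)))) <= 4%:R * ((Q c x u)%:R * (p x c * p u c)).
Proof.
have rhs0 b : 0 <= 4%:R * ((b : bool)%:R * (p x c * p u c)) by rewrite !mulr_ge0.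
have zero (P : pred Om) : P =1 xpred0 -> PP P = 0.
  by move=> h; rewrite -[RHS](expect_const law_sum1); apply: eq_expect => w; rewrite h.
case hQ: (Q c x u); last by rewrite zero ?rhs0 // => w; rewrite /bad hQ.
case bx: (blank x); last by rewrite zero ?rhs0 // => w; rewrite /bad bx /= andbF.
case bu: (blank u); last by rewrite zero ?rhs0 // => w; rewrite /bad bu /= !andbF.
have xu : x != u by case/andP: hQ.
have -> : PP (bad (inl (c, (x, u)))) = choice_law x c * choice_law u c.
  rewrite -!expect_is -(expectM_indep law_sum1 (@det_is x c) (@det_is u c)) ?disjoints1 ?inE //.
  by apply: eq_expect => w; rewrite /bad hQ bx bu /= -natrM mulnb.
apply: (@le_trans _ _ ((20%:R / 13%:R * p x c) * (20%:R / 13%:R * p u c))).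
  by apply: ler_pM => //; apply: law_le; apply/eqP.
have : 0 <= p x c * p u c by apply: mulr_ge0.
by rewrite mul1r; lra.
Qed.

Let bad3_le c x y z : PP (bad (inr (c, (x, (y, z))))) <=
  4%:R * ((T x y z)%:R * (p x c * (p y c * p z c))).
Proof.
have rhs0 b : 0 <= 4%:R * ((b : bool)%:R * (p x c * (p y c * p z c))) by rewrite !mulr_ge0.
have zero (P : pred Om) : P =1 xpred0 -> PP P = 0.
  by move=> h; rewrite -[RHS](expect_const law_sum1); apply: eq_expect => w; rewrite h.
case hT: (T x y z); last by rewrite zero ?rhs0 // => w; rewrite /bad hT.
case bx: (blank x); last by rewrite zero ?rhs0 // => w; rewrite /bad bx /= !andbF.
case bY: (blank y); last by rewrite zero ?rhs0 // => w; rewrite /bad bY /= !andbF.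
case bz: (blank z); last by rewrite zero ?rhs0 // => w; rewrite /bad bz /= !andbF.
have /and4P[xy xz yz _] := hT.
have -> : PP (bad (inr (c, (x, (y, z))))) = choice_law x c * (choice_law y c * choice_law z c).
  rewrite -!expect_is -(expectM_indep law_sum1 (@det_is y c) (@det_is z c)) ?disjoints1 ?inE //.
  rewrite -(@expectM_indep _ _ _ law_sum1 [set x] [set y; z]).
  - by apply: eq_expect => w; rewrite /bad hT bx bY bz /= -!natrM !mulnb.
  - exact: det_is.
  - by move=> w w' h; rewrite (h y) ?(h z) // !inE eqxx ?orbT.
  - by rewrite disjoints1 !inE negb_or xy.
apply: (@le_trans _ _ ((20%:R / 13%:R * p x c) * ((20%:R / 13%:R * p y c) * (20%:R / 13%:R * p z c)))).
  apply: ler_pM => //; [exact: mulr_ge0|by apply: law_le; apply/eqP|].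
  by apply: ler_pM => //; apply: law_le; apply/eqP.
have : 0 <= p x c * (p y c * p z c) by rewrite !mulr_ge0.
by rewrite mul1r; lra.
Qed.

(** [v] may take two positions in a pair and three in a triple: [4 * 2] matches the weight of pairs
    in [8 * Theta], and [4 * 3] is below the [8 * 4] available for triples. *)
Let sum_at v : \sum_(k | v \in verts k) PP (bad k) <= 8%:R * theta.
Proof.
apply: (@le_trans _ _ (8%:R * Theta p Q T v)); last by rewrite ler_wpM2l ?(st_Theta st).
pose g2 c x u : R := (Q c x u)%:R * (p x c * p u c).
pose g3 c x y z : R := (T x y z)%:R * (p x c * (p y c * p z c)).
have g20 c x u : 0 <= g2 c x u by rewrite !mulr_ge0.
have g30 c x y z : 0 <= g3 c x y z by rewrite !mulr_ge0.
have ThE : Theta p Q T v = \sum_c \sum_u g2 c v u + 4%:R * \sum_c \sum_x \sum_y g3 c v x y.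
  rewrite /Theta mulr_sumr -big_split; apply: eq_bigr => c _; rewrite mulrDr; congr (_ + _).
    by rewrite /load mulr_sumr; apply: eq_bigr => u _; rewrite /g2; ring.
  rewrite /load3 mulrCA; congr (_ * _); rewrite mulr_sumr; apply: eq_bigr => x _.
  by rewrite mulr_sumr; apply: eq_bigr => y _; rewrite /g3; ring.
rewrite big_sumType /= ThE mulrDr mulrA; apply: lerD.
  apply: (@le_trans _ _ (\sum_(k : C * (V * V)) 4%:R * ((v == k.2.1)%:R * g2 k.1 k.2.1 k.2.2 +
     (v == k.2.2)%:R * g2 k.1 k.2.1 k.2.2))).
    rewrite big_mkcond; apply: ler_sum => -[c [x u]] _ /=; rewrite !inE.
    have h := bad2_le c x u; rewrite -/(g2 c x u) in h.
    case: (v == x) => /=; first by rewrite mul1r; apply: le_trans h _; rewrite ler_wpM2l // lerDl mulr_ge0.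
    by case: (v == u) => /=; rewrite ?mul1r mul0r add0r // mulr0.
  rewrite -(pair_big predT predT (fun c k => 4%:R * ((v == k.1)%:R * g2 c k.1 k.2 + (v == k.2)%:R * g2 c k.1 k.2))) /=.
  rewrite mulr_sumr; apply: ler_sum => c _; rewrite -mulr_sumr big_split /=.
  have e1 : \sum_(k : V * V) (v == k.1)%:R * g2 c k.1 k.2 = \sum_u g2 c v u.
    rewrite -(pair_big predT predT (fun x u => (v == x)%:R * g2 c x u)) /= (bigD1 v) //= [X in _ + X]big1 ?addr0.
      by apply: eq_bigr => u _; rewrite eqxx mul1r.
    by move=> x xv; rewrite big1 // => u _; rewrite eq_sym (negPf xv) mul0r.
  have e2 : \sum_(k : V * V) (v == k.2)%:R * g2 c k.1 k.2 = \sum_u g2 c v u.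
    rewrite -(pair_big predT predT (fun x u => (v == u)%:R * g2 c x u)) /=; apply: eq_bigr => x _.
    rewrite (bigD1 v) //= eqxx mul1r big1 ?addr0; last by move=> u uv; rewrite eq_sym (negPf uv) mul0r.
    by rewrite /g2 conflict_sym mulrCA mulrC; ring.
  by rewrite e1 e2; have : 0 <= \sum_u g2 c v u by [apply: sumr_ge0]; lra.
apply: (@le_trans _ _ (\sum_(k : C * (V * (V * V))) 4%:R * ((v == k.2.1)%:R * g3 k.1 k.2.1 k.2.2.1 k.2.2.2 +
    (v == k.2.2.1)%:R * g3 k.1 k.2.1 k.2.2.1 k.2.2.2 + (v == k.2.2.2)%:R * g3 k.1 k.2.1 k.2.2.1 k.2.2.2))).
  rewrite big_mkcond; apply: ler_sum => -[c [x [y z]]] _ /=; rewrite !inE.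
  have h := bad3_le c x y z; rewrite -/(g3 c x y z) in h; have := g30 c x y z.
  by case: (v == x); case: (v == y); case: (v == z); rewrite /= ?mulr1n ?mulr0n; lra.
rewrite -(pair_big predT predT (fun c k => 4%:R * ((v == k.1)%:R * g3 c k.1 k.2.1 k.2.2 +
   (v == k.2.1)%:R * g3 c k.1 k.2.1 k.2.2 + (v == k.2.2)%:R * g3 c k.1 k.2.1 k.2.2))) /=.
rewrite mulr_sumr; apply: ler_sum => c _; rewrite -mulr_sumr !big_split /=.
pose S := \sum_x \sum_y g3 c v x y.
have rot x y z : g3 c x y z = g3 c y x z by rewrite /g3 triple_rot; ring.
have sym x y z : g3 c x y z = g3 c x z y by rewrite /g3 triple_sym; ring.
have e1 : \sum_(k : V * (V * V)) (v == k.1)%:R * g3 c k.1 k.2.1 k.2.2 = S.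
  rewrite -(pair_big predT predT (fun x k => (v == x)%:R * g3 c x k.1 k.2)) /= (bigD1 v) //= [X in _ + X]big1 ?addr0.
    rewrite eqxx /S pair_big /=; apply: eq_bigr => k _; exact: mul1r.
  by move=> x xv; rewrite big1 // => u _; rewrite eq_sym (negPf xv) mul0r.
have e2 : \sum_(k : V * (V * V)) (v == k.2.1)%:R * g3 c k.1 k.2.1 k.2.2 = S.
  rewrite -(pair_big predT predT (fun x k => (v == k.1)%:R * g3 c x k.1 k.2)) /=; apply: eq_bigr => x _.
  rewrite -(pair_big predT predT (fun y z => (v == y)%:R * g3 c x y z)) /= (bigD1 v) //= [X in _ + X]big1 ?addr0.
    by apply: eq_bigr => z _; rewrite eqxx mul1r rot.
  by move=> y yv; rewrite big1 // => u _; rewrite eq_sym (negPf yv) mul0r.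
have e3 : \sum_(k : V * (V * V)) (v == k.2.2)%:R * g3 c k.1 k.2.1 k.2.2 = S.
  rewrite -(pair_big predT predT (fun x k => (v == k.2)%:R * g3 c x k.1 k.2)) /=; apply: eq_bigr => x _.
  rewrite -(pair_big predT predT (fun y z => (v == z)%:R * g3 c x y z)) /=; apply: eq_bigr => y _.
  rewrite (bigD1 v) //= eqxx mul1r big1 ?addr0; first by rewrite sym rot.
  by move=> z zv; rewrite eq_sym (negPf zv) mul0r.
rewrite e1 e2 e3; have : 0 <= S by apply: sumr_ge0 => x _; apply: sumr_ge0.
by rewrite -/S; lra.
Qed.

Theorem finish : exists f : V -> C, (forall v, f v \in Lst v) /\
  forall e, e \in E -> exists x y, [/\ x \in e, y \in e & f x != f y].
Proof.
have small k : \sum_(k' | (k' == k) || ~~ [disjoint verts k' & verts k]) PP (bad k') <= 1 / 4%:R.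
  apply: (@le_trans _ _ (\sum_(v in verts k) \sum_(k' | v \in verts k') PP (bad k'))).
    rewrite [leRHS](exchange_big_dep predT) //= [leLHS]big_mkcond /=; apply: ler_sum => k' _.
    case: ifP => [hk|_]; last by apply: sumr_ge0 => v _; apply: (pr_ge0 law_ge0).
    have [v vk vk'] : exists2 v, v \in verts k & v \in verts k'.
      case/orP: hk => [/eqP ->|]; last by rewrite -setI_eq0 => /set0Pn[v]; rewrite inE => /andP[]; exists v.
      by case: (k) => [[c [x u]]|[c [x [y z]]]]; exists x; rewrite !inE eqxx.
    rewrite (bigD1 v) /=; last by rewrite vk vk'.
    by rewrite lerDl; apply: sumr_ge0 => u _; apply: (pr_ge0 law_ge0).
  apply: (@le_trans _ _ (\sum_(v in verts k) 8%:R * theta)); first by apply: ler_sum => v _; apply: sum_at.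
  rewrite sumr_const -[leLHS]mulr_natl.
  have c3 : #|verts k|%:R <= 3%:R :> R.
    rewrite ler_nat; case: k => [[c [x u]]|[c [x [y z]]]] /=.
      by rewrite cards2; case: (_ != _).
    by rewrite -setUA cardsU1 cards2; case: (_ \notin _); case: (_ != _).
  (* Three vertices at [8 * theta] each stay below [1/4] exactly when [theta <= 1/96]. *)
  have [t0|t0] := leP 0 theta.
    apply: (@le_trans _ _ (3%:R * (8%:R * theta))); first by apply: ler_wpM2r => //; apply: mulr_ge0.
    by have := theta_le; lra.
  apply: (@le_trans _ _ 0); last by lra.
  by apply: mulr_ge0_le0 => //; apply: mulr_ge0_le0 => //; apply: ltW.
have [w pw hw] := local_lemma law_ge0 law_sum1 bad_det small.
have w_pos v : 0 < choice_law v (w v).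
  move: pw; rewrite /prob (bigD1 v) //= => h.
  rewrite lt_neqAle law_ge0 andbT; apply: contraTneq h => <-.
  by rewrite mul0r ltxx.
have w_cl v d : cl v = Some d -> w v = d.
  by move=> cv; have := w_pos v; rewrite /choice_law cv; case: eqP => //; rewrite ltxx.
have w_p v : cl v = None -> 0 < p v (w v).
  move=> cv; have := w_pos v; rewrite /choice_law cv pmulr_lgt0 // invr_gt0.
  by apply: lt_le_trans (N_ge cv); lra.
exists w; split.
  move=> v; case cv: (cl v) => [d|]; last exact: (st_inlist st (w_p v cv)).
  by rewrite (w_cl _ _ cv); apply: (st_list st cv).
move=> e eE.
case: (boolP [exists x in e, exists y in e, w x != w y]) => [/exists_inP[x xe /exists_inP[y ye xy]]|].
  by exists x, y.
move/exists_inPn => mono; exfalso.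
have same x y : x \in e -> y \in e -> w x = w y.
  by move=> xe ye; have /exists_inPn/(_ y ye) := mono x xe; rewrite negbK => /eqP.
have /card_gt0P [x0 x0e] : (0 < #|e|)%N by case/orP: (edge_size eE) => /eqP ->.
pose c := w x0.
(* [st_proper] and [st_alive] provide two vertices of the edge that were not colored [c] before. The
   completed coloring gives them [c], so they were blank, and the edge yields a bad pair or a bad
   triple. *)
have /forallPn [x] := st_proper st c eE; rewrite negb_imply => /andP[xe clx].
have bx : cl x = None.
  by case cx: (cl x) clx => [d|] //; rewrite -(w_cl _ _ cx) (same x x0) // eqxx.
have wx : w x = c by rewrite (same x x0).
have px : 0 < p x c by rewrite -wx w_p.
have /forallPn [u] := st_alive st px eE xe.
rewrite negb_imply negb_or => /and3P[ue ux clu].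
have bu : cl u = None.
  by case cu: (cl u) clu => [d|] //; rewrite -(w_cl _ _ cu) (same u x0) // eqxx.
have wu : w u = c by rewrite (same u x0).
have noQ : ~~ Q c x u.
  apply/negP => hQ; have /negP := hw (inl (c, (x, u))); apply.
  by rewrite /bad hQ /blank bx bu wx wu !eqxx.
have [eE2|[y eE3 Txuy]] := edge_cases edge_size eE xe ue ux.
  by case/negP: noQ; rewrite /conflict eq_sym ux -eE2 eE.
have ye : y \in e by rewrite eE3 !inE eqxx !orbT.
have wy : w y = c by rewrite (same y x0).
case cy: (cl y) => [d|].
  case/negP: noQ; rewrite /conflict eq_sym ux; apply/orP; right; apply/existsP; exists y.
  by rewrite cy -(w_cl _ _ cy) wy eqxx.
have /negP := hw (inr (c, (x, (u, y)))); apply.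
by rewrite /bad Txuy /blank bx bu cy wx wu wy !eqxx.
Qed.

End Finish.

(** * Degrees as sums over vertices, and the initial state *)

Section Counting.
Variables (V : finType) (E : {set {set V}}).

Lemma sum_indicator (T : finType) (P : pred T) : \sum_x (P x)%:R = #|[set x | P x]|%:R :> R.
Proof.
rewrite -sum1_card natr_sum [RHS]big_mkcond /=; apply: eq_bigr => x _; rewrite inE.
by case: (P x).
Qed.

Lemma degree2_count v :
  \sum_u ((v != u) && ([set v; u] \in E))%:R <= (deg_k E 2 v)%:R :> R.
Proof.
rewrite (sum_indicator (fun u => (v != u) && ([set v; u] \in E))) ler_nat /deg_k.
rewrite -(@card_in_imset _ _ (fun u => [set v; u])).
  apply/subset_leq_card/subsetP => e /imsetP[u]; rewrite inE => /andP[vu vuE] ->.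
  by rewrite !inE vuE eqxx cards2 vu.
move=> x y; rewrite !inE => /andP[vx _] /andP[vy _] /setP /(_ x).
by rewrite !inE eqxx orbT eq_sym (negPf vx) /= => /esym/eqP.
Qed.

(** Double counting: each edge of size 3 at [v] provides the two orders of its remaining
    vertices. *)
Lemma degree3_count v :
  \sum_x \sum_y (triple E v x y)%:R <= 2%:R * (deg_k E 3 v)%:R :> R.
Proof.
pose D3 := [set e in E | (v \in e) && (#|e| == 3%N)].
apply: (@le_trans _ _ (\sum_(e in D3) \sum_(x in e :\ v) \sum_(y in e :\ v :\ x) 1)); last first.
  rewrite /deg_k -/D3 mulr_natr -[leRHS]sumr_const; apply: ler_sum => e; rewrite inE => /and3P[_ ve /eqP e3].
  have c2 : (#|e :\ v| = 2)%N by apply/eqP; rewrite -eqSS -e3 (cardsD1 v e) ve.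
  rewrite (eq_bigr (fun=> 1)) ?sumr_const ?c2 // => x xe.
  by rewrite sumr_const (_ : #|_| = 1)%N //; apply/eqP; rewrite -eqSS -c2 (cardsD1 x (e :\ v)) xe.
apply: (@le_trans _ _ (\sum_x \sum_y \sum_(e in D3) ((x \in e :\ v) && (y \in e :\ v :\ x))%:R)).
  apply: ler_sum => x _; apply: ler_sum => y _; case: (boolP (triple E v x y)) => [|_]; last by apply: sumr_ge0.
  case/and4P=> vx vy xy eE; rewrite (bigD1 [set v; x; y]) /=; last first.
    by rewrite !inE eE eqxx -setUA cardsU1 cards2 !inE negb_or vx vy xy.
  rewrite !inE [x == v]eq_sym (negPf vx) [y == v]eq_sym (negPf vy) [y == x]eq_sym (negPf xy) !eqxx !orbT /=.
  by rewrite lerDl sumr_ge0.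
under eq_bigr do rewrite exchange_big /=.
rewrite exchange_big /=; apply: ler_sum => e _.
rewrite [leRHS]big_mkcond /=; apply: ler_sum => x _; case: ifP => xe; last by rewrite big1.
by rewrite [leRHS]big_mkcond /=; apply: ler_sum => y _; case: (y \in _).
Qed.

Lemma codegree_count v u : v != u ->
  \sum_y (triple E v u y)%:R <= (codeg_k E 3 v u)%:R :> R.
Proof.
move=> vu; rewrite (sum_indicator (fun y => triple E v u y)) ler_nat /codeg_k.
rewrite -(@card_in_imset _ _ (fun y => [set v; u; y])).
  apply/subset_leq_card/subsetP => e /imsetP[y]; rewrite inE => /and4P[_ vy uy eE] ->.
  by rewrite !inE eE !eqxx ?orbT -setUA cardsU1 cards2 !inE negb_or vu vy uy.
move=> x y; rewrite !inE => /and4P[_ vx ux _] /and4P[_ vy uy _] /setP /(_ x).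
by rewrite !inE eqxx orbT eq_sym (negPf vx) eq_sym (negPf ux) /= => /esym/eqP.
Qed.

Hypothesis edge_size : forall e, e \in E -> (#|e| == 2%N) || (#|e| == 3%N).

Lemma nbhd_count v : #|nbhd E v|%:R <=
  1 + (deg_k E 2 v)%:R + 2%:R * (deg_k E 3 v)%:R :> R.
Proof.
apply: (@le_trans _ _ (\sum_u ((u == v)%:R + ((v != u) && ([set v; u] \in E))%:R + \sum_y (triple E v u y)%:R))); last first.
  rewrite !big_split /=; apply: lerD; last by have := degree3_count v.
  apply: lerD; last by have := degree2_count v.
  by rewrite (bigD1 v) //= eqxx big1 ?addr0 ?lexx // => u /negPf ->.
rewrite -sum1_card natr_sum big_mkcond /=; apply: ler_sum => u _.
have s0 : 0 <= \sum_y (triple E v u y)%:R :> R by apply: sumr_ge0.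
case: ifP => [|_]; last by rewrite !addr_ge0.
rewrite inE => /orP[->|/exists_inP[e eE /andP[ve ue]]].
  by rewrite -addrA lerDl addr_ge0.
have [uv|uv] := eqVneq u v; first by rewrite -addrA lerDl addr_ge0.
rewrite add0r; have [eE2|[y _ Tvuy]] := edge_cases edge_size eE ve ue uv.
  by rewrite /= -eE2 eE lerDl.
by rewrite (bigD1 y) //= Tvuy addrCA lerDl addr_ge0 // sumr_ge0.
Qed.

Section Initial.
Variables (C : finType) (Lst : V -> {set C}) (n ph Lam d2 Dg theta0 : R).
Hypothesis list_size : forall v, #|Lst v|%:R = n.
Hypothesis n_gt0 : 0 < n.
Hypothesis ph_n : n^-1 <= ph.
Hypothesis Lam_gt0 : 0 < Lam.
Hypothesis LamE : Lam = ln (ph * n).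
Hypothesis deg2 : forall v, (deg_k E 2 v)%:R <= d2.
Hypothesis deg3 : forall v, \sum_x \sum_y (triple E v x y)%:R <= Dg.
Hypothesis theta0_ge : d2 / n + 4%:R * (Dg / n ^+ 2) <= theta0.

Lemma initial_state : state E Lst n ph Lam 1 theta0 d2
  (fun=> None) (fun v c => if c \in Lst v then n^-1 else 0).
Proof.
have ni0 : 0 <= n^-1 by rewrite invr_ge0 ltW.
have qE c v u : conflict E (fun=> None : option C) c v u = (v != u) && ([set v; u] \in E).
  rewrite /conflict; case: (v != u) => //=; rewrite [X in _ || X](_ : _ = false) ?orbF //.
  by apply/negbTE/existsP => -[x].
have inE' v c : 0 < (if c \in Lst v then n^-1 else 0) :> R -> c \in Lst v.
  by case: ifP => // _; rewrite ltxx.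
have mass v : \sum_c (if c \in Lst v then n^-1 else 0) = 1 :> R.
  by rewrite -big_mkcond sumr_const -[LHS]mulr_natl list_size divff ?gt_eqF.
split=> //.
- move=> e c eE; apply/negP => /forall_inP h.
  have /card_gt0P [x xe] : (0 < #|e|)%N by case/orP: (edge_size eE) => /eqP ->.
  by have := h x xe.
- move=> v c e _ eE ve; apply/negP => /forall_inP h.
  have /card_gt0P [x] : (0 < #|e :\ v|)%N.
    by rewrite -ltnS -[X in (X < _.+1)%N]/1%N; have := cardsD1 v e; rewrite ve add1n => <-; case/orP: (edge_size eE) => /eqP ->.
  by rewrite !inE => /andP[xv xe]; have := h x xe; rewrite (negPf xv).
- by move=> v c; case: ifP.
- by move=> v c; case: ifP => // _; apply: le_trans ni0 ph_n.
- by move=> v c /inE' ->.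
- by move=> v c _; under eq_bigr do rewrite qE; apply: le_trans (degree2_count v) (deg2 v).
(* At the initial weight [1/n] the entropy term equals the weight, so the entropy starts at 1. *)
- move=> v _; rewrite /entropy -[leLHS](mass v); apply: ler_sum => c _; case: ifP => _; last by rewrite entropy_term0.
  by rewrite /entropy_term invrK -LamE mulfK ?gt_eqF.
move=> v; apply: le_trans theta0_ge.
apply: (@le_trans _ _ (\sum_c (if c \in Lst v then n^-1 else 0) * (d2 / n + 4%:R * (Dg / n ^+ 2)))); last first.
  by rewrite -mulr_suml mass mul1r.
apply: ler_sum => c _; apply: ler_wpM2l; first by case: ifP.
apply: lerD.
  apply: (@le_trans _ _ (\sum_u ((v != u) && ([set v; u] \in E))%:R * n^-1)).
    apply: ler_sum => u _; rewrite qE; apply: ler_wpM2l => //; by case: ifP.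
  rewrite -mulr_suml; apply: ler_wpM2r => //; exact: le_trans (degree2_count v) (deg2 v).
apply: ler_wpM2l => //; apply: (@le_trans _ _ (\sum_x \sum_y (triple E v x y)%:R * (n ^+ 2)^-1)).
  apply: ler_sum => x _; apply: ler_sum => y _; apply: ler_wpM2l => //.
  rewrite -exprVn expr2; apply: ler_pM => //; by case: ifP.
under eq_bigr do rewrite -mulr_suml.
by rewrite -mulr_suml; apply: ler_wpM2r; rewrite ?deg3 // invr_ge0 sqr_ge0.
Qed.

End Initial.
End Counting.

(** * Iteration and asymptotics *)

Section Iterate.
(* [y] stands for [Delta^(1/100)], so that every power of [Delta] below is an integer power
   of [y] or of [u = 1/y]. *)
Variables (y alpha n d2 theta0 : R).
Hypothesis y_ge : 100%:R <= y.
Hypothesis n_lower : y ^+ 49 <= n.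
Hypothesis n_upper : n <= y ^+ 50.
Hypothesis alpha_lower : y^-1 <= alpha.
Hypothesis alpha_le : alpha <= 1 / 10%:R.
Hypothesis d2_ge0 : 0 <= d2.
Hypothesis d2_le : d2 <= y ^+ 51.
Hypothesis theta0_ge0 : 0 <= theta0.
Hypothesis alpha_theta0 : alpha * theta0 <= 1 / 20%:R.
Hypothesis exp_large : 8%:R * (4%:R * y ^+ 100) ^+ 4 <= exp y.

Let u := y^-1.
Let ph := y / n.

Let y_gt0 : 0 < y. Proof. by apply: lt_le_trans y_ge. Qed.
Let u_gt0 : 0 < u. Proof. by rewrite invr_gt0. Qed.
Let u_le : u <= 1 / 100%:R.
Proof. by rewrite div1r lef_pV2 // posrE. Qed.
Let uX_ge0 k : 0 <= u ^+ k. Proof. by rewrite exprn_ge0 // ltW. Qed.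
Let yX_gt0 k : 0 < y ^+ k. Proof. by rewrite exprn_gt0. Qed.
Let n_gt0 : 0 < n. Proof. exact: lt_le_trans (yX_gt0 49) n_lower. Qed.
Let ph_gt0 : 0 < ph. Proof. by rewrite divr_gt0. Qed.
Let nph : n * ph = y. Proof. by rewrite /ph mulrC divfK // gt_eqF. Qed.

Let uy k l : u ^+ (k + l) * y ^+ l = u ^+ k.
Proof. by rewrite exprD -mulrA -exprMn mulVf ?gt_eqF // expr1n mulr1. Qed.

Let yu k l : y ^+ (k + l) * u ^+ l = y ^+ k.
Proof. by rewrite exprD -mulrA -exprMn mulfV ?gt_eqF // expr1n mulr1. Qed.

(** Since [y >= 100], one spare power of [u] absorbs any constant up to 100; this takes the place of
    asymptotic notation. *)
Let small c k : c <= 100%:R -> c * u ^+ k.+1 <= u ^+ k.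
Proof.
move=> hc; rewrite exprS mulrA; apply: ler_piMl => //.
apply: (@le_trans _ _ (100%:R * u)); first by apply: ler_wpM2r => //; apply: ltW.
by have := u_le; lra.
Qed.

Let smallS k : 100%:R * u ^+ k.+1 <= u ^+ k. Proof. exact: small. Qed.

Let ph_le : ph <= u ^+ 48.
Proof.
rewrite /ph ler_pdivrMr //; apply: (@le_trans _ _ (u ^+ 48 * y ^+ 49)); last by apply: ler_wpM2l.
by rewrite (exprS y 48) mulrCA (uy 0 48) expr0 mulr1.
Qed.

Section Bounds.
Variable D : R.
Hypothesis D_ge0 : 0 <= D.
Hypothesis D_le : D <= y ^+ 56.

(** [Dg] and [cod] are the given degree bounds. The quantity capped by [few_selected] has
    expectation below [y ^+ 52], so the cap [y ^+ 54] is exceeded with probability at most [u ^+ 2],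
    and in at most [y] rounds the color degrees stay below [y ^+ 56]. The choice of [b] leaves room
    for the factor 20 above [alpha * ph] times the total influence, which is at most [u ^+ 38]. *)
Let Bd := y ^+ 54.
Let Dg := 2%:R * y ^+ 100.
Let cod := y ^+ 60.
Let b := u ^+ 36.

Let ph2 : ph ^+ 2 <= u ^+ 96.
Proof. by rewrite (exprM u 48 2); apply: lerXn2r; rewrite ?nnegrE // ltW. Qed.
Let ph3 : ph ^+ 3 <= u ^+ 144.
Proof. by rewrite (exprM u 48 3); apply: lerXn2r; rewrite ?nnegrE // ltW. Qed.
Let ph_ge0 : 0 <= ph. Proof. exact: ltW. Qed.
Let phX_ge0 k : 0 <= ph ^+ k. Proof. exact: exprn_ge0. Qed.
Let yX_ge0 k : 0 <= y ^+ k. Proof. exact: ltW. Qed.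

Lemma direct_bound_le : direct_bound ph D Dg Bd <= u ^+ 39.
Proof.
rewrite /direct_bound /Dg /Bd.
have h1 : ph ^+ 2 * D <= u ^+ 40 by rewrite -(uy 40 56); apply: ler_pM.
have h2 : ph ^+ 2 * y ^+ 54 <= u ^+ 42 by rewrite -(uy 42 54); apply: ler_pM.
have h3 : ph ^+ 3 * y ^+ 100 <= u ^+ 44 by rewrite -(uy 44 100); apply: ler_pM.
have -> : 4%:R * ph ^+ 3 * (2%:R * y ^+ 100) = 8%:R * (ph ^+ 3 * y ^+ 100).
  by move: (y ^+ 100) (ph ^+ 3) => a c; ring.
have := smallS 39; have := smallS 40; have := smallS 41; have := smallS 42; have := smallS 43.
have := uX_ge0 40; have := uX_ge0 41; have := uX_ge0 42; have := uX_ge0 43; have := uX_ge0 44; have := uX_ge0 39.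
move: h1 h2 h3; move: (ph ^+ 2 * D) (ph ^+ 2 * y ^+ 54) (ph ^+ 3 * y ^+ 100).
by move: (u ^+ 39) (u ^+ 40) (u ^+ 41) (u ^+ 42) (u ^+ 43) (u ^+ 44) => *; lra.
Qed.

Lemma influence_bound_le : b + influence_bound ph n cod <= u ^+ 33.
Proof.
rewrite /influence_bound /cod /b.
have h1 : ph ^+ 2 * n <= u ^+ 47.
  by rewrite expr2 -mulrA [ph * n]mulrC nph -(uy 47 1) expr1; apply: ler_wpM2r; rewrite // ltW.
have h2 : n * ph ^+ 3 * y ^+ 60 <= u ^+ 35.
  rewrite (exprS ph 2) mulrA nph mulrAC -exprS -(uy 35 61) mulrC; exact: ler_pM.
have h3 : u ^+ 47 <= u ^+ 35 by apply: ler_wiXn2l => //; [apply: ltW|have := u_le; lra].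
have -> : 4%:R * n * ph ^+ 3 * y ^+ 60 = 4%:R * (n * ph ^+ 3 * y ^+ 60).
  by move: (y ^+ 60) (ph ^+ 3) => a c; ring.
have := smallS 33; have := smallS 34; have := smallS 35; have := uX_ge0 33; have := uX_ge0 34; have := uX_ge0 35.
have := uX_ge0 36; move: h1 h2 h3; move: (n * ph ^+ 3 * y ^+ 60) (ph ^+ 2 * n).
by move: (u ^+ 33) (u ^+ 34) (u ^+ 35) (u ^+ 36) (u ^+ 47) => *; lra.
Qed.

Let y1 : 1 <= y. Proof. by have := y_ge; lra. Qed.

Let largeS k : 100%:R * y ^+ k <= y ^+ k.+1.
Proof. by rewrite exprS; apply: ler_wpM2r. Qed.

Lemma total_influence_le : total_influence ph n D Dg <= y ^+ 10.
Proof.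
rewrite /total_influence /Dg.
have h1 : ph ^+ 2 * (n * D) <= y ^+ 9.
  have -> : ph ^+ 2 * (n * D) = ph * (y * D) by rewrite -nph; ring.
  have -> : y ^+ 9 = u ^+ 48 * (y * y ^+ 56) by rewrite -exprS -(yu 9 48) mulrC.
  apply: ler_pM => //; first by rewrite mulr_ge0 // ltW.
  by apply: ler_wpM2l => //; apply: ltW.
have h2 : n * ph ^+ 3 * y ^+ 100 <= y ^+ 5.
  have -> : n * ph ^+ 3 * y ^+ 100 = ph ^+ 2 * (y * y ^+ 100).
    by rewrite -[X in _ * (X * _)]nph; move: (y ^+ 100) => a; ring.
  have -> : y ^+ 5 = u ^+ 96 * (y * y ^+ 100) by rewrite -exprS -(yu 5 96) mulrC.
  by apply: ler_wpM2r => //; rewrite -exprS.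
have h3 : y ^+ 5 <= y ^+ 9 by apply: ler_weXn2l.
have -> : 4%:R * n * ph ^+ 3 * (2%:R * y ^+ 100) = 8%:R * (n * ph ^+ 3 * y ^+ 100).
  by move: (y ^+ 100) (ph ^+ 3) => a c; ring.
have := largeS 9; have := yX_ge0 9; move: h1 h2 h3.
by move: (ph ^+ 2 * (n * D)) (n * ph ^+ 3 * y ^+ 100) (y ^+ 5) (y ^+ 9) (y ^+ 10) => *; lra.
Qed.

Let alpha_ge0 : 0 <= alpha.
Proof. by apply: le_trans alpha_lower; apply: ltW. Qed.

Let total_influence_ge0 : 0 <= total_influence ph n D Dg.
Proof.
rewrite /total_influence /Dg; have n0 := ltW n_gt0; apply: addr_ge0.
  by apply: mulr_ge0 => //; apply: mulr_ge0.
by apply: mulr_ge0; [apply: mulr_ge0 => //; apply: mulr_ge0|apply: mulr_ge0].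
Qed.

Lemma truncation_bound : alpha * ph * total_influence ph n D Dg <= b / 20%:R.
Proof.
have h : alpha * ph * total_influence ph n D Dg <= 1 * u ^+ 48 * y ^+ 10.
  have a1 : alpha <= 1 by have := alpha_le; lra.
  apply: ler_pM => //; [exact: mulr_ge0|exact: ler_pM|exact: total_influence_le].
apply: le_trans h _; rewrite mul1r (uy 38 10) /b.
have := smallS 36; have := smallS 37; have := uX_ge0 36; have := uX_ge0 37; have := uX_ge0 38.
by move: (u ^+ 36) (u ^+ 37) (u ^+ 38) => *; lra.
Qed.

Lemma variance_bound_le : variance_bound alpha ph n D Dg cod Bd b <= u ^+ 21.
Proof.
rewrite /variance_bound.
have M0 : 0 <= direct_bound ph D Dg Bd.
  rewrite /direct_bound /Dg /Bd; apply: addr_ge0; first by apply: addr_ge0; apply: mulr_ge0.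
  by apply: mulr_ge0; apply: mulr_ge0.
have w0 : 0 <= b + influence_bound ph n cod.
  have n0 := ltW n_gt0; rewrite /influence_bound /cod /b; apply: addr_ge0 => //; apply: addr_ge0.
    exact: mulr_ge0.
  by apply: mulr_ge0 => //; apply: mulr_ge0 => //; apply: mulr_ge0.
have h1 : direct_bound ph D Dg Bd ^+ 2 * n <= u ^+ 28.
  rewrite -(uy 28 50); apply: ler_pM => //; [exact: sqr_ge0|exact: ltW|].
  rewrite (exprM u 39 2); apply: lerXn2r; rewrite ?nnegrE //; exact: direct_bound_le.
have h2 : (b + influence_bound ph n cod) * (alpha * (n * ph) * total_influence ph n D Dg) <= u ^+ 22.
  rewrite -(uy 22 11) nph; apply: ler_pM => //.
  - by rewrite !mulr_ge0 // ltW.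
  - exact: influence_bound_le.
  - rewrite (exprS y 10); apply: ler_pM; rewrite ?total_influence_le ?mulr_ge0 //; first exact: ltW.
    by rewrite ler_piMl ?(ltW y_gt0) //; have := alpha_le; lra.
have h3 : u ^+ 28 <= u ^+ 22 by apply: ler_wiXn2l => //; [apply: ltW|have := u_le; lra].
have := smallS 21; have := uX_ge0 22; have := uX_ge0 21; move: h1 h2 h3.
move: (direct_bound ph D Dg Bd ^+ 2 * n) ((b + influence_bound ph n cod) * (alpha * (n * ph) * total_influence ph n D Dg)).
by move: (u ^+ 21) (u ^+ 22) (u ^+ 28) => *; lra.
Qed.

(** With [s = y ^+ 11] and [t = u ^+ 9], the gain [s * t = y ^+ 2] beats the variance terms, which
    are at most [8 * y] because the variances are below [u ^+ 21]. A failure probability of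
    [2 * exp (- y)] outweighs the polynomial number of dependent events. *)
Lemma failure_bound (m : R) : 0 <= m -> m <= 4%:R * y ^+ 100 ->
  m ^+ 4 * (exp (8%:R * (y ^+ 11) ^+ 2 * variance_bound alpha ph n D Dg cod Bd b - y ^+ 11 * u ^+ 9) +
            exp (8%:R * (y ^+ 11) ^+ 2 * (ph ^+ 2 * n) - y ^+ 11 * u ^+ 9)) <= 1 / 4%:R.
Proof.
move=> m0 hm.
have st : y ^+ 11 * u ^+ 9 = y ^+ 2 by rewrite (yu 2 9).
have yy : 100%:R * y <= y ^+ 2 by have := largeS 1; rewrite expr1.
have e1 : (y ^+ 11) ^+ 2 * variance_bound alpha ph n D Dg cod Bd b <= y.
  rewrite -exprM -[leRHS](expr1 y) -(yu 1 21); apply: ler_wpM2l => //; exact: variance_bound_le.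
have e2 : (y ^+ 11) ^+ 2 * (ph ^+ 2 * n) <= y.
  rewrite -exprM -[leRHS](expr1 y) -(yu 1 21); apply: ler_wpM2l => //.
  apply: (@le_trans _ _ (u ^+ 47)); last by apply: ler_wiXn2l => //; [apply: ltW|have := u_le; lra].
  by rewrite expr2 -mulrA [ph * n]mulrC nph -(uy 47 1) expr1; apply: ler_wpM2r; rewrite // ltW.
have f1 : exp (8%:R * (y ^+ 11) ^+ 2 * variance_bound alpha ph n D Dg cod Bd b - y ^+ 11 * u ^+ 9) <= exp (- y).
  by apply: ler_exp; rewrite st -mulrA; have := y_gt0; lra.
have f2 : exp (8%:R * (y ^+ 11) ^+ 2 * (ph ^+ 2 * n) - y ^+ 11 * u ^+ 9) <= exp (- y).
  by apply: ler_exp; rewrite st -mulrA; have := y_gt0; lra.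
apply: (@le_trans _ _ ((4%:R * y ^+ 100) ^+ 4 * (exp (- y) + exp (- y)))).
  apply: ler_pM; rewrite ?exprn_ge0 ?addr_ge0 ?exp_ge0 //; last exact: lerD.
  by apply: lerXn2r => //; rewrite nnegrE //; apply: mulr_ge0.
have e0 := exp_gt0 (- y).
have ee : exp y * exp (- y) = 1 by rewrite -expD subrr exp0.
have := ler_wpM2r (ltW e0) exp_large; rewrite ee.
by move: ((4%:R * y ^+ 100) ^+ 4) (exp (- y)) => z e; lra.
Qed.

(** Since [alpha * ph] is tiny compared with [alpha], one has [kappa ^+ 3 <= 1 + alpha / 16]. The
    remaining slack [alpha * theta / 16] covers the deviation [u ^+ 9] as long as [theta] is not
    below [1/96]. *)
Lemma kappa_bound theta : 1 / 96%:R <= theta ->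
  kappa alpha ph ^+ 3 * ((1 - alpha / 4%:R) * theta) + u ^+ 9 <= (1 - alpha / 8%:R) * theta.
Proof.
move=> th.
pose x := alpha * ph.
have x0 : 0 <= x by apply: mulr_ge0.
have x1 : x <= u ^+ 48.
  rewrite -[leRHS]mul1r; apply: ler_pM => //; have := alpha_le; lra.
have ua : u <= alpha by [].
have low k : (1 <= k)%N -> 100%:R * (100%:R * u ^+ k.+2) <= u.
  move=> k1; apply: (@le_trans _ _ (100%:R * u ^+ k.+1)); first by apply: ler_wpM2l => //; apply: smallS.
  apply: le_trans (smallS k) _; rewrite -[leRHS]expr1; apply: ler_wiXn2l => //; first exact: ltW.
  by have := u_le; lra.
have u48 := low 46 isT; have u9 := low 7 isT.
have xs : 100%:R * (100%:R * x) <= alpha.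
  by apply: le_trans ua; apply: le_trans u48; do 2 (apply: ler_wpM2l => //).
have k1 : kappa alpha ph <= 1 + 4%:R * x.
  have d0 : 0 < 1 - 3%:R * x by have := alpha_le; lra.
  rewrite /kappa -/x -div1r ler_pdivrMr //.
  have : 0 <= x * (1 - 12%:R * x) by rewrite mulr_ge0 //; have := alpha_le; lra.
  have -> : (1 + 4%:R * x) * (1 - 3%:R * x) = 1 + x * (1 - 12%:R * x) by ring.
  lra.
have k0 : 0 <= kappa alpha ph by rewrite /kappa invr_ge0 -/x; have := alpha_le; lra.
have k3 : kappa alpha ph ^+ 3 <= 1 + alpha / 16%:R.
  apply: (@le_trans _ _ ((1 + 4%:R * x) ^+ 3)); first by apply: lerXn2r; rewrite ?nnegrE //; lra.
  have xx : x <= 1 / 100%:R by have := alpha_le; lra.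
  have x2 : x ^+ 2 <= x by rewrite expr2; apply: ler_piMl => //; lra.
  have x3 : x ^+ 3 <= x by rewrite exprS; apply: ler_piMr => //; apply: le_trans x2 _; lra.
  have -> : (1 + 4%:R * x) ^+ 3 = 1 + 12%:R * x + 48%:R * x ^+ 2 + 64%:R * x ^+ 3 by ring.
  lra.
have th0 : 0 <= theta by lra.
have a4 : 0 <= (1 - alpha / 4%:R) * theta by rewrite mulr_ge0 //; have := alpha_le; lra.
have h1 := ler_wpM2r a4 k3.
have h2 : 0 <= alpha ^+ 2 * theta by rewrite mulr_ge0 ?sqr_ge0.
have h3 := ler_wpM2l alpha_ge0 th.
have -> : (1 - alpha / 8%:R) * theta = (1 + alpha / 16%:R) * ((1 - alpha / 4%:R) * theta) +
  (alpha * theta / 16%:R + alpha ^+ 2 * theta / 64%:R) by field.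
apply: lerD => //; lra.
Qed.

End Bounds.

(** * Iterating the step until the potential is small *)

Section Run.
Variables (V C : finType) (E : {set {set V}}) (Lst : V -> {set C}).
Hypothesis tri_free : triangle_free E.
Hypothesis edge_size : forall e, e \in E -> (#|e| == 2%N) || (#|e| == 3%N).
Hypothesis list_size : forall v, #|Lst v|%:R = n.
Hypothesis deg2 : forall v, (deg_k E 2 v)%:R <= d2.
Hypothesis deg3 : forall v, (deg_k E 3 v)%:R <= y ^+ 100.
Hypothesis codeg : forall v u, v != u -> (codeg_k E 3 v u)%:R <= y ^+ 60.
Hypothesis theta0_ge : d2 / n + 8%:R * (y ^+ 100 / n ^+ 2) <= theta0.
Hypothesis loss : 16%:R * theta0 <= 1 / 5%:R * ln y.
Variable K : nat.
Hypothesis K_le : K%:R <= y.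
Hypothesis theta_end : theta0 * (1 - alpha / 8%:R) ^+ K <= 1 / 96%:R.

Let Lam := ln y.
Let theta k := theta0 * (1 - alpha / 8%:R) ^+ k.
(** Round [k] loses [2 * alpha * theta k / Lam], and [alpha * theta k = 8 * (theta k - theta k.+1)],
    so these losses telescope. The terms [u ^+ 2] and [u ^+ 9] are the loss to dropped colors and
    the deviation allowed by concentration. *)
Let entropy_at k : R := 1 - 16%:R / Lam * (theta0 - theta k) - k%:R * (u ^+ 2 + u ^+ 9).
Let degree_at k : R := d2 + k%:R * y ^+ 54.

Let Lam_gt0 : 0 < Lam.
Proof.
rewrite /Lam; have -> : 0 = ln (1 : R) by rewrite ln_1.
by apply/RltP/ln_increasing; apply/RltP => //; apply: lt_le_trans y_ge; lra.
Qed.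

Let LamE : Lam = ln (ph * n). Proof. by rewrite mulrC nph. Qed.

Let q8_ge0 : 0 <= 1 - alpha / 8%:R. Proof. by have := alpha_le; lra. Qed.
Let q8_le1 : 1 - alpha / 8%:R <= 1.
Proof. have : 0 <= alpha by apply: le_trans alpha_lower; apply: ltW. lra. Qed.
Let theta_ge0 k : 0 <= theta k. Proof. by rewrite mulr_ge0 // exprn_ge0. Qed.
Let theta_le k : theta k <= theta0.
Proof. by rewrite /theta ler_piMr // exprn_ile1. Qed.

Let entropy_at_ge k : (k <= K)%N -> 13%:R / 20%:R <= entropy_at k.
Proof.
move=> kK; have kR : k%:R <= y by apply: le_trans K_le; rewrite ler_nat.
have h1 : 16%:R / Lam * (theta0 - theta k) <= 1 / 5%:R.
  apply: (@le_trans _ _ (16%:R / Lam * theta0)).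
    by apply: ler_wpM2l; [rewrite divr_ge0 // ltW|rewrite gerBl].
  by rewrite mulrAC ler_pdivrMr.
have h2 : k%:R * (u ^+ 2 + u ^+ 9) <= 1 / 10%:R.
  apply: (@le_trans _ _ (y * (u ^+ 2 + u ^+ 2))).
    apply: ler_pM => //; first by rewrite addr_ge0.
    by rewrite lerD2l; apply: ler_wiXn2l => //; [apply: ltW|have := u_le; lra].
  rewrite mulrDr expr2 mulrA mulfV ?gt_eqF // mul1r; have := u_le; lra.
by rewrite /entropy_at; lra.
Qed.

Let degree_at_le k : (k <= K)%N -> degree_at k <= y ^+ 56.
Proof.
move=> kK; have kR : k%:R <= y by apply: le_trans K_le; rewrite ler_nat.
have h1 : k%:R * y ^+ 54 <= y ^+ 55 by rewrite (exprS y 54); apply: ler_wpM2r => //; apply: ltW.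
have h2 : y ^+ 51 <= y ^+ 55 by apply: ler_weXn2l => //; have := y_ge; lra.
have h3 : 100%:R * y ^+ 55 <= y ^+ 56 by rewrite (exprS y 55); apply: ler_wpM2r => //; apply: ltW.
have := yX_gt0 55; move: d2_le h1 h2 h3; rewrite /degree_at.
by move: (k%:R * y ^+ 54) (y ^+ 51) (y ^+ 55) (y ^+ 56) => *; lra.
Qed.

Let run k : (k <= K)%N -> (forall i, (i < k)%N -> 1 / 96%:R <= theta i) ->
  exists cl p, state E Lst n ph Lam (entropy_at k) (theta k) (degree_at k) cl p.
Proof.
have alpha_gt0 : 0 < alpha by apply: lt_le_trans alpha_lower.
have yge0 := ltW y_gt0.
have dg3 v : \sum_x \sum_z (triple E v x z)%:R <= 2%:R * y ^+ 100.
  by apply: le_trans (degree3_count E v) _; apply: ler_wpM2l.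
have cod v w : \sum_z (triple E v w z)%:R <= y ^+ 60.
  have [->|vw] := eqVneq v w; last exact: le_trans (codegree_count E vw) (codeg vw).
  rewrite big1 => [|z _]; first exact/ltW.
  by rewrite (negPf (triple_irr1 E w z)).
elim: k => [_ _|k IH kK hk].
  have -> : entropy_at 0 = 1 by rewrite /entropy_at /theta expr0 mulr1 subrr mulr0 mul0r !subr0.
  have -> : theta 0 = theta0 by rewrite /theta expr0 mulr1.
  have -> : degree_at 0 = d2 by rewrite /degree_at mul0r addr0.
  exists (fun=> None), (fun v c => if c \in Lst v then n^-1 else 0).
  apply: (@initial_state _ _ edge_size _ _ _ _ _ _ (2%:R * y ^+ 100)) => //.
    rewrite /ph ler_pdivlMr // mulVf ?gt_eqF //; have := y_ge; lra.
  apply: le_trans theta0_ge; rewrite lerD2l; have -> : 4%:R * (2%:R * y ^+ 100 / n ^+ 2) = 8%:R * (y ^+ 100 / n ^+ 2).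
    by move: (y ^+ 100) (n ^+ 2)^-1 => a c; ring.
  exact: lexx.
have kK' : (k <= K)%N by apply: ltnW.
have [|cl [p st]] := IH kK'; first by move=> i ik; apply: hk; apply: ltnW.
have DDS : degree_at k + y ^+ 54 = degree_at k.+1 by rewrite /degree_at -[k.+1]addn1 natrD mulrDl mul1r addrA.
have D0 : 0 <= degree_at k by rewrite /degree_at addr_ge0 // mulr_ge0 // ltW.
have thk : 1 / 96%:R <= theta k by apply: hk.
rewrite -DDS.
apply: (@one_step _ _ _ _ tri_free edge_size n ph Lam (entropy_at k) (theta k) (degree_at k) cl p st alpha
  (2%:R * y ^+ 100) (y ^+ 60) (y ^+ 54) (u ^+ 36) (4%:R * y ^+ 100) (y ^+ 11) (u ^+ 9) (u ^+ 2)) => //.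
- apply: le_trans ph_le _; apply: (@le_trans _ _ (u ^+ 1)); last by rewrite expr1; have := u_le; lra.
  by apply: ler_wiXn2l => //; [apply: ltW|have := u_le; lra].
- by move=> v; rewrite list_size.
- exact: exprn_gt0.
- by apply: truncation_bound => //; apply: degree_at_le.
- by apply: le_trans alpha_theta0; apply: ler_wpM2l => //; apply: ltW.
- exact: entropy_at_ge.
- rewrite /entropy_at; have : 0 <= 16%:R / Lam * (theta0 - theta k).
    by rewrite mulr_ge0 ?subr_ge0 // divr_ge0 // ltW.
  have : 0 <= k%:R * (u ^+ 2 + u ^+ 9) by rewrite mulr_ge0 // addr_ge0.
  by move: (16%:R / Lam * _) (k%:R * _) => *; lra.
- move=> v; apply: le_trans (nbhd_count edge_size v) _.
  have y51 : y ^+ 51 <= y ^+ 100 by apply: ler_weXn2l => //; have := y_ge; lra.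
  have y0 : 1 <= y ^+ 100 by apply: exprn_ege1; have := y_ge; lra.
  have := deg2 v; have := deg3 v; move: d2_le y51 y0.
  by move: (y ^+ 51) (y ^+ 100) ((deg_k E 2 v)%:R) ((deg_k E 3 v)%:R) => *; lra.
- rewrite ler_pdivrMr //.
  apply: (@le_trans _ _ (1 / 10%:R * u ^+ 48 * (2%:R * y ^+ 100))).
    by apply: ler_wpM2r; [rewrite mulr_ge0 // ltW|apply: ler_pM => //; apply: ltW].
  have e : u ^+ 48 * y ^+ 100 = u ^+ 2 * y ^+ 54.
    have -> : y ^+ 100 = y ^+ 46 * y ^+ 54 by rewrite -exprD.
    by rewrite mulrA (uy 2 46).
  have -> : 1 / 10%:R * u ^+ 48 * (2%:R * y ^+ 100) = 1 / 5%:R * (u ^+ 48 * y ^+ 100).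
    by move: (u ^+ 48) (y ^+ 100) => a c; field.
  rewrite e; have : 0 <= u ^+ 2 * y ^+ 54 by rewrite mulr_ge0 // ltW.
  by move: (u ^+ 2 * _) => *; lra.
- by apply: exprn_ile1; [apply: ltW|have := u_le; lra].
- by apply: exprn_ge0.
- apply: (@le_trans _ _ (y ^+ 11 * (u ^+ 39 + u ^+ 33))).
    apply: ler_wpM2l; first exact: exprn_ge0.
    by apply: lerD; [apply: direct_bound_le => //; apply: degree_at_le|apply: influence_bound_le].
  have h : u ^+ 39 <= u ^+ 33 by apply: ler_wiXn2l => //; [apply: ltW|have := u_le; lra].
  have e : y ^+ 11 * u ^+ 33 = u ^+ 22 by rewrite mulrC (uy 22 11).
  apply: (@le_trans _ _ (2%:R * u ^+ 22)).
    rewrite -e mulrCA; apply: ler_wpM2l; first exact: exprn_ge0.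
    by move: h; move: (u ^+ 39) (u ^+ 33) => *; lra.
  have : u ^+ 22 <= u ^+ 1 by apply: ler_wiXn2l => //; [apply: ltW|have := u_le; lra].
  by rewrite expr1; have := u_le; move: (u ^+ 22) => *; lra.
- apply: (@le_trans _ _ (y ^+ 11 * u ^+ 48)); first by apply: ler_wpM2l => //; apply: exprn_ge0.
  rewrite mulrC (uy 37 11).
  have : u ^+ 37 <= u ^+ 1 by apply: ler_wiXn2l => //; [apply: ltW|have := u_le; lra].
  by rewrite expr1; have := u_le; move: (u ^+ 37) => *; lra.
- by apply: failure_bound => //; [apply: degree_at_le|rewrite mulr_ge0 // ltW].
- have -> : entropy_at k.+1 = entropy_at k - 2%:R * alpha * theta k / Lam - u ^+ 2 - u ^+ 9.
    rewrite /entropy_at -[k.+1]addn1 natrD.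
    have -> : theta (k + 1)%N = (1 - alpha / 8%:R) * theta k by rewrite /theta addn1 exprS; ring.
    field; exact: lt0r_neq0.
  exact: lexx.
have -> : theta k.+1 = (1 - alpha / 8%:R) * theta k by rewrite /theta exprS mulrCA.
exact: kappa_bound.
Qed.

Theorem list_colorable : exists f : V -> C, (forall v, f v \in Lst v) /\
  forall e, e \in E -> exists x z, [/\ x \in e, z \in e & f x != f z].
Proof.
have ex : exists k, theta k <= 1 / 96%:R by exists K.
(* The process stops at the first such [k], because [kappa_bound] needs [theta >= 1/96] in every
   round that is performed. *)
pose k := ex_minn ex.
have [hk kmin] : theta k <= 1 / 96%:R /\ forall i, theta i <= 1 / 96%:R -> (k <= i)%N.
  by rewrite /k; case: ex_minnP.
have kK : (k <= K)%N by apply: kmin.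
have [|cl [p st]] := run kK.
  by move=> i ik; rewrite leNgt; apply/negP => /ltW /kmin; rewrite leqNgt ik.
exact: (finish edge_size st ph_gt0 n_gt0 (entropy_at_ge kK) Lam_gt0 LamE hk).
Qed.

End Run.
End Iterate.

(** * Numerical inequalities for large [Delta] *)

Section Asymptotics.
Variables (c0 l y X : R).
Hypothesis c0_gt0 : 0 < c0.
Hypothesis c0E : 86%:R * 1000%:R * c0 = 1.
Hypothesis l_ge : 1000%:R ^+ 2 <= l.
Hypothesis yE : y = exp (l / 100%:R).
Hypothesis X_ge0 : 0 <= X.
Hypothesis XE : X ^+ 2 * (c0 * l) = y ^+ 100.

Let l_ge1 : 1000%:R <= l.
Proof. apply: le_trans l_ge; rewrite expr2; lra. Qed.
Let l_gt0 : 0 < l. Proof. have := l_ge1; lra. Qed.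

Lemma expX (x : R) (k : nat) : exp (x *+ k) = exp x ^+ k.
Proof. by elim: k => [|k IH]; rewrite ?mulr0n ?exp0 ?expr0 // mulrS expD IH exprS. Qed.

(** With [z = l / 400] one has [y = exp z ^+ 4 >= z ^+ 4], and this fourth power beats [8 l^2] once
    [l >= 10^6]. The bound makes the integer part of [y] a sufficient number of rounds. *)
Lemma y_square : 1 + 8%:R * l ^+ 2 <= y.
Proof.
pose z := l / 400%:R.
have lz : l = 400%:R * z by rewrite /z; field.
have z_ge : 2000%:R <= z.
  rewrite /z ler_pdivlMr //; apply: le_trans l_ge; rewrite expr2; lra.
have z0 : 0 <= z by lra.
have h := ler_expRD1 z.
have -> : y = exp z ^+ 4 by rewrite yE -expX; congr exp; rewrite lz -mulr_natl; field.
apply: (@le_trans _ _ (z ^+ 4)); last first.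
  by apply: lerXn2r; rewrite ?nnegrE ?exp_ge0 //; apply: le_trans h; rewrite lerDr.
have z2 : 2000%:R * 2000%:R <= z ^+ 2 by rewrite expr2; apply: ler_pM.
have -> : z ^+ 4 = z ^+ 2 * z ^+ 2 by ring.
have -> : 8%:R * l ^+ 2 = 8%:R * 400%:R * 400%:R * z ^+ 2 by rewrite lz; ring.
have z20 : 0 <= z ^+ 2 by apply: sqr_ge0.
have := ler_wpM2r z20 z2; move: z2; move: (z ^+ 2) => a; lra.
Qed.

Let y_gt : l ^+ 2 <= y.
Proof. have := y_square; have := sqr_ge0 l; lra. Qed.

Let l2 : 1000%:R * l <= l ^+ 2.
Proof. by rewrite expr2; apply: ler_wpM2r => //; apply: ltW. Qed.

Let c0_le : c0 <= 1.
Proof. have := c0E; have := c0_gt0; lra. Qed.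

Let c0l_le : c0 * l <= l.
Proof. by apply: ler_piMl => //; apply: ltW. Qed.

Let c0l_ge : 10%:R <= c0 * l.
Proof.
apply: (@le_trans _ _ (c0 * (1000%:R ^+ 2))); last by apply: ler_wpM2l => //; apply: ltW.
have -> : c0 * 1000%:R ^+ 2 = (86%:R * 1000%:R * c0) * (1000%:R / 86%:R) by field.
rewrite c0E; lra.
Qed.

Lemma y_ge100 : 100%:R <= y.
Proof. have := l_ge1; have := l2; have := y_gt; lra. Qed.

Let y_gt0 : 0 < y. Proof. by have := y_ge100; lra. Qed.

Lemma alpha_lower : y^-1 <= l^-1.
Proof. rewrite lef_pV2 ?posrE //; have := l_ge1; have := l2; have := y_gt; lra. Qed.

Lemma alpha_upper : l^-1 <= 1 / 10%:R.
Proof. rewrite div1r lef_pV2 ?posrE //; have := l_ge1; lra. Qed.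

Lemma X_lower : 2%:R * y ^+ 49 <= X.
Proof.
rewrite -(@ler_pXn2r _ 2) ?nnegrE ?mulr_ge0 ?exprn_ge0 ?(ltW y_gt0) //.
rewrite -(@ler_pM2r _ (c0 * l)); last by have := c0l_ge; lra.
rewrite XE; have -> : (2%:R * y ^+ 49) ^+ 2 = 4%:R * y ^+ 98.
  by rewrite exprMn -exprM; congr (_ * _); ring.
have -> : y ^+ 100 = y ^+ 2 * y ^+ 98 by rewrite -exprD.
rewrite mulrAC; apply: ler_wpM2r; first by rewrite exprn_ge0 // ltW.
apply: (@le_trans _ _ y); last by rewrite expr2 ler_peMr ?(ltW y_gt0) //; have := y_ge100; lra.
have := c0l_le; have := l_ge1; have := l2; have := y_gt; lra.
Qed.

Lemma X_upper : X <= y ^+ 50.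
Proof.
rewrite -(@ler_pXn2r _ 2) ?nnegrE ?exprn_ge0 ?(ltW y_gt0) // -exprM.
rewrite -XE ler_peMr ?sqr_ge0 //; have := c0l_ge; lra.
Qed.

Lemma d2_upper : X * (c0 * l) <= y ^+ 51.
Proof.
rewrite (exprSr y 50); apply: ler_pM => //; first by have := c0l_ge; lra.
  exact: X_upper.
have := c0l_le; have := l_ge1; have := l2; have := y_gt; lra.
Qed.

Lemma exp_large : 8%:R * (4%:R * y ^+ 100) ^+ 4 <= exp y.
Proof.
have e1 : 2%:R <= exp (1 : R) by apply: le_trans (ler_expRD1 1); lra.
have e11 : 2%:R ^+ 11 <= exp (11%:R : R).
  have -> : exp (11%:R : R) = exp 1 ^+ 11 by rewrite -expX.
  by apply: lerXn2r; rewrite ?nnegrE ?exp_ge0.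
have y100 : y ^+ 100 = exp l by rewrite yE -expX; congr exp; rewrite -mulr_natl; field.
rewrite y100 exprMn mulrA -expX.
have -> : 8%:R * 4%:R ^+ 4 = 2%:R ^+ 11 :> R by ring.
apply: (@le_trans _ _ (exp 11%:R * exp (l *+ 4))).
  by apply: ler_wpM2r => //; apply: exp_ge0.
rewrite -expD; apply: ler_exp; rewrite -mulr_natl.
have := l_ge1; have := l2; have := y_gt; lra.
Qed.

(** [K >= 8 l^2] by [y_square], so the decay factor is at most [exp (- l)], which absorbs [l]. *)
Lemma rounds (K : nat) : y <= K%:R + 1 ->
  10%:R * (c0 * l) * (1 - l^-1 / 8%:R) ^+ K <= 1 / 96%:R.
Proof.
move=> yK; have li : 0 < l^-1 by rewrite invr_gt0.
have h1 : (1 - l^-1 / 8%:R) ^+ K <= exp (- l).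
  apply: (@le_trans _ _ (exp (- (l^-1 / 8%:R)) ^+ K)).
    apply: lerXn2r; rewrite ?nnegrE ?exp_ge0 ?ler_expRD1 //.
    by have := alpha_upper; lra.
  rewrite -expX; apply: ler_exp; rewrite mulNrn lerN2 -(mulr_natl (l^-1 / 8%:R) K).
  have h : 8%:R * l ^+ 2 <= K%:R by have := y_square; lra.
  have := ler_wpM2r (ltW li) h.
  have -> : 8%:R * l ^+ 2 * l^-1 = 8%:R * l by field; apply: lt0r_neq0.
  by rewrite mulrA; lra.
have h2 : l * exp (- l) <= 1.
  have e : exp l * exp (- l) = 1 by rewrite -expD subrr exp0.
  rewrite -[leRHS]e; apply: ler_wpM2r; first exact: exp_ge0.
  by apply: le_trans (ler_expRD1 l); rewrite lerDr.
have e0 := exp_ge0 (- l).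
apply: (@le_trans _ _ (10%:R * (c0 * l) * exp (- l))).
  by apply: ler_wpM2l => //; have := c0l_ge; lra.
have -> : 10%:R * (c0 * l) * exp (- l) = 10%:R * c0 * (l * exp (- l)) by ring.
have := ler_wpM2l (ltW c0_gt0) h2; have := c0E; lra.
Qed.

(** Rounding [X] down to a natural number costs at most one percent. *)
Lemma floor_ratio (n : R) : X - 1 <= n -> X <= (101%:R / 100%:R) * n.
Proof.
move=> h; have := X_lower; have : y <= y ^+ 49.
  by rewrite (exprS y 48) ler_peMr ?(ltW y_gt0) // exprn_ege1 //; have := y_ge100; lra.
have := y_ge100; move: (y ^+ 49) => z; lra.
Qed.

(** With [r = X / n <= 101/100] the left side is [(r + 8 r^2) c0 l], and [r + 8 r^2 < 10]. *)
Lemma theta0_bound (n : R) : 0 < n -> X - 1 <= n ->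
  X * (c0 * l) / n + 8%:R * (y ^+ 100 / n ^+ 2) <= 10%:R * (c0 * l).
Proof.
move=> n0 /floor_ratio h.
pose r := X / n; have r0 : 0 <= r by rewrite divr_ge0 // ltW.
have r1 : r <= 101%:R / 100%:R by rewrite ler_pdivrMr.
have -> : X * (c0 * l) / n + 8%:R * (y ^+ 100 / n ^+ 2) = (r + 8%:R * r ^+ 2) * (c0 * l).
  by rewrite -XE /r; field; apply: lt0r_neq0.
apply: ler_wpM2r; first by have := c0l_ge; lra.
have := ler_pM r0 r0 r1 r1; rewrite expr2; lra.
Qed.

End Asymptotics.

Lemma sub_set_card (T : finType) (A : {set T}) (q : nat) : (q <= #|A|)%N ->
  exists B : {set T}, (B \subset A) && (#|B| == q).
Proof.
move/card_geqP => [s [us ss sA]]; exists [set x in s]; apply/andP; split.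
  by apply/subsetP => x; rewrite inE; apply: sA.
by rewrite cardsE (card_uniqP us) ss.
Qed.

(** * From lists of numbers to finite color sets of equal size *)

Section Main.
Variables (V : finType) (E : {set {set V}}) (Delta c0 X : R).
Hypothesis tri_free : triangle_free E.
Hypothesis edge_size : forall e, e \in E -> (#|e| == 2%N) || (#|e| == 3%N).
Hypothesis c0_gt0 : 0 < c0.
Hypothesis c0E : 86%:R * 1000%:R * c0 = 1.
Hypothesis Delta_gt0 : 0 < Delta.
Hypothesis Delta_ge : 1000%:R ^+ 2 <= ln Delta.
Hypothesis X_ge0 : 0 <= X.
Hypothesis XE : X ^+ 2 * (c0 * ln Delta) = Delta.
Hypothesis deg3 : forall v, (deg_k E 3 v)%:R <= Delta.
Hypothesis deg2 : forall v, (deg_k E 2 v)%:R <= X * (c0 * ln Delta).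
Hypothesis codeg : forall v u, v != u -> (codeg_k E 3 v u)%:R <= exp (60%:R / 100%:R * ln Delta).

Theorem choosable_truncn : choosable E (Num.truncn X).
Proof.
set q := Num.truncn X; set l := ln Delta; pose y := exp (l / 100%:R).
have /andP[qX Xq] := truncn_itv X_ge0; rewrite -/q in qX Xq.
have DE : exp l = Delta by rewrite exp_ln //; apply/RltP.
have y100 : y ^+ 100 = Delta by rewrite -DE /y -expX; congr exp; rewrite -mulr_natl; field.
have XE' : X ^+ 2 * (c0 * l) = y ^+ 100 by rewrite y100.
have y60 : exp (60%:R / 100%:R * ln Delta) = y ^+ 60.
  by rewrite /y -expX; congr exp; rewrite -mulr_natl -/l; field.
have Xn : X - 1 <= q%:R by move: Xq; rewrite -addn1 natrD; lra.
have Xlow := X_lower c0_gt0 c0E Delta_ge (erefl y) X_ge0 XE'.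
have ylow := y_ge100 Delta_ge (erefl y).
have l_gt0 : 0 < l by apply: lt_le_trans Delta_ge; rewrite exprn_gt0.
have y49 : 1 <= y ^+ 49 by rewrite exprn_ege1 //; lra.
have qlow : y ^+ 49 <= q%:R by move: Xlow Xn y49; move: (y ^+ 49) => z; lra.
have q_gt0 : 0 < q%:R :> R by lra.
move=> L hL.
(* Only finitely many colors occur; they are moved into the finite type of the numbers up to their
   maximum [m]. *)
pose m := (\max_v \max_(c <- L v) c)%N.
have cm v c : c \in L v -> (c < m.+1)%N.
  move=> cL; rewrite ltnS; apply: leq_trans (leq_bigmax v).
  exact: (leq_bigmax_seq c).
pose S v : {set 'I_m.+1} := [set i : 'I_m.+1 | val i \in L v].
have cardS v : (q <= #|S v|)%N.
  apply: leq_trans (hL v) _; apply/card_geqP; exists (map (@inord m) (undup (L v))); split.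
  - rewrite map_inj_in_uniq ?undup_uniq // => c d; rewrite !mem_undup => /cm hc /cm hd.
    by move/(congr1 val); rewrite /= !inordK.
  - by rewrite size_map.
  - move=> i /mapP[c]; rewrite mem_undup => cL ->; rewrite inE /= inordK //; exact: cm cL.
have sub v : exists B : {set 'I_m.+1}, (B \subset S v) && (#|B| == q) by apply: sub_set_card.
(* All lists are trimmed to exactly [q] colors, because the process starts from the uniform weight
   [1/q] at every vertex. *)
pose Lst v := xchoose (sub v).
have LstP v : (Lst v \subset S v) /\ #|Lst v| = q.
  by have /andP[h /eqP] := xchooseP (sub v).
pose K := Num.truncn y.
have y0 : 0 <= y by lra.
have /andP[Ky yK] := truncn_itv y0; rewrite -/K in Ky yK.
have c0l0 : 0 <= c0 * l by rewrite mulr_ge0 // ltW.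
have hln : ln y = l / 100%:R by rewrite lnK.
have yE := erefl y; rewrite {2}/y in yE.
have [f [fL fE]] : exists f : V -> 'I_m.+1, (forall v, f v \in Lst v) /\
    forall e, e \in E -> exists x z, [/\ x \in e, z \in e & f x != f z].
  apply: (@list_colorable y l^-1 q%:R (X * (c0 * l)) (10%:R * (c0 * l)) _ _ _ _ _ _ _ _ _ _
    V 'I_m.+1 E Lst _ _ _ _ _ _ _ _ K) => //.
  - exact: le_trans qX (X_upper c0_gt0 c0E Delta_ge yE X_ge0 XE').
  - exact: (alpha_lower Delta_ge yE).
  - exact: (alpha_upper Delta_ge).
  - by rewrite mulr_ge0.
  - exact: (d2_upper c0_gt0 c0E Delta_ge yE X_ge0 XE').
  - by rewrite mulr_ge0.
  - rewrite (_ : l^-1 * (10%:R * (c0 * l)) = 10%:R * c0); last by field; apply: lt0r_neq0.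
    by have := c0E; lra.
  - exact: (exp_large Delta_ge yE).
  - by move=> v; case: (LstP v) => _ ->.
  - by move=> v; rewrite y100.
  - by move=> v u vu; rewrite -y60; apply: codeg.
  - exact: (theta0_bound c0_gt0 c0E Delta_ge yE X_ge0 XE').
  (* Here [16 theta0 <= ln y / 5] reads [160 c0 l <= l / 500], the inequality that limits [c0]. *)
  - rewrite hln; have : 0 < c0 * l by rewrite mulr_gt0.
    have : l = 86%:R * 1000%:R * (c0 * l) by rewrite mulrA c0E mul1r.
    by move: (c0 * l) => z; lra.
  - apply: (rounds c0_gt0 c0E Delta_ge yE); move: yK; rewrite -addn1 natrD; exact: ltW.
exists (fun v => val (f v)); split.
  move=> e /fE[x [z [xe ze fxz]]]; exists x, z; split=> //.
  by move=> /val_inj xz; rewrite xz eqxx in fxz.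
move=> v; have [/subsetP h _] := LstP v.
by have := h _ (fL v); rewrite inE.
Qed.

End Main.

(** [ln Delta >= 10^6] suffices for all the numerical inequalities; writing it as a square keeps the
    natural-number literals small. *)
Definition Delta0 : R := exp (1000%:R ^+ 2).

Theorem list_chromatic_bound (Delta : R) (V : finType) (E : {set {set V}}) :
  let c0 := Rdiv (IZR 1) (IZR 86000) in
  Rle Delta0 Delta -> triangle_free E ->
  (forall e, e \in E -> (#|e| == 2%N) || (#|e| == 3%N)) ->
  (forall v, Rle (INR (deg_k E 3 v)) Delta) ->
  (forall v, Rle (INR (deg_k E 2 v)) (sqrt (Rmult (Rmult c0 Delta) (ln Delta)))) ->
  (forall v u, v != u -> Rle (INR (codeg_k E 3 v u)) (Rpower Delta (Rdiv (IZR 6) (IZR 10)))) ->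
  list_chromatic_le E (sqrt (Rdiv Delta (Rmult c0 (ln Delta)))).
Proof.
move=> c0 /RleP hD tri sizes deg3 deg2 codeg.
have D0 : 0 < Delta by apply: lt_le_trans hD; apply: exp_gt0.
have l_ge : 1000%:R ^+ 2 <= ln Delta by rewrite -[leLHS]lnK; apply: ler_ln hD; apply: exp_gt0.
have l0 : 0 < ln Delta by apply: lt_le_trans l_ge; rewrite exprn_gt0.
have c0E : 86%:R * 1000%:R * c0 = 1 by rewrite -!INRE; apply: inv_86000.
have c0_gt0 : 0 < c0.
  by rewrite -(@pmulr_rgt0 _ (86%:R * 1000%:R)) ?c0E // mulr_gt0.
have cl0 : 0 < c0 * ln Delta by apply: mulr_gt0.
set X := sqrt _.
have X0 : 0 <= X by apply/RleP; apply: sqrt_pos.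
have XE : X ^+ 2 * (c0 * ln Delta) = Delta.
  by rewrite expr2; apply: sqrt_div_sqr; apply/RltP.
exists (Num.truncn X); split.
  by apply/RleP; rewrite INRE; case/andP: (truncn_itv X0).
apply: (choosable_truncn tri sizes c0_gt0 c0E D0 l_ge X0 XE).
- by move=> v; rewrite -INRE; apply/RleP.
- move=> v; rewrite -INRE; apply/RleP; apply: Rle_trans (deg2 v) _.
  by rewrite sqrt_div_mul; [apply: Rle_refl|apply/RltP..].
- move=> v u vu; rewrite -!INRE; apply/RleP; apply: Rle_trans (codeg v u vu) _.
  by rewrite six_tenths; apply: Rle_refl.
Qed.

End Nibble.

Theorem mainTheorem2 :
  let c0 : R := (1 / 86000)%R in
  exists Delta0 : R, forall Delta : R, (Delta0 <= Delta)%R ->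
  forall (V : finType) (E : {set {set V}}),
    triangle_free E ->
    (forall e, e \in E -> (#|e| == 2) || (#|e| == 3)) ->
    (forall x : V, (INR (deg_k E 3 x) <= Delta)%R) ->
    (forall x : V, (INR (deg_k E 2 x) <= sqrt (c0 * Delta * ln Delta))%R) ->
    (forall x y : V, x != y -> (INR (codeg_k E 3 x y) <= Rpower Delta (6 / 10))%R) ->
    list_chromatic_le E (sqrt (Delta / (c0 * ln Delta))).
Proof.
by exists Nibble.Delta0 => Delta hD V E; apply: Nibble.list_chromatic_bound.
Qed.
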